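(* Let $n>1$ and let $\{V_i:i=1,\dots,n\}$ be an irreducible family on a Hilbert space $\mathcal{H}$ which is a $\mathcal{U}_n$-twisted power partial isometry with respect to commuting unitaries $\{U_{ij}\}$. Let $\mathcal{H}_u,\mathcal{H}_s,\mathcal{H}_b,\mathcal{H}_p$ ($p\ge1$) be the Halmos–Wallen subspaces of $V_1$. (1) If $\mathcal{H}=\mathcal{H}_s$, then, up to a unitary identification $\mathcal{H}=\ell^2(\mathbb{Z}_+)\otimes\mathcal{M}_s$ for a Hilbert space $\mathcal{M}_s$, $V_1=S\otimes 1_{\mathcal{M}_s}$ and $V_j=D(U_{1j})\otimes\tilde V_j$ for $j=2,\dots,n$. (2) If $\mathcal{H}=\mathcal{H}_b$, then, up to a unitary identification $\mathcal{H}=\ell^2(\mathbb{Z}_+)\otimes\mathcal{M}_b$ for a Hilbert space $\mathcal{M}_b$, $V_1=S^*\otimes 1_{\mathcal{M}_b}$ and $V_j=D(U_{j1})\otimes\tilde V_j$ for $j=2,\dots,n$. (3) If $\mathcal{H}=\mathcal{H}_p$ for some $p\ge 1$, then, up to a unitary identification $\mathcal{H}=\mathbb{C}^p\otimes\mathcal{M}_p$ for a Hilbert space $\mathcal{M}_p$, $V_1=J_p\otimes 1_{\mathcal{M}_p}$ and $V_j=d(U_{1j})\otimes\tilde V_j$ for $j=2,\dots,n$. In cases (1)–(3), $\{\tilde V_j:j=2,\dots,n\}$ is an irreducible family of $n-1$ twisted power partial isometries (with respect to $\{U_{ij}\}_{2\le i<j\le n}$) acting on the corresponding Hilbert space $\mathcal{M}_s$,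 $\mathcal{M}_b$, $\mathcal{M}_p$. (4) If $\mathcal{H}=\mathcal{H}_u$, then $V_1=U_1$ with $U_1$ unitary, $U_1^*V_j=U_{1j}V_jU_1^*$ and $V_jU_1=U_{1j}U_1V_j$ for $j=2,\dots,n$, where $V_2,\dots,V_n$ are twisted power partial isometries (with respect to $\{U_{ij}\}_{2\le i<j\le n}$), and the family $\{U_1,V_j,\ j=2,\dots,n\}$ is irreducible. Families corresponding to different cases are not unitarily equivalent. Two families, corresponding to $\{\tilde V_j^{(1)}\}_{j=2}^n$ and $\{\tilde V_j^{(2)}\}_{j=2}^n$ inside the same one of the cases (1)–(3) (with the same $p$ in case (3)), are unitarily equivalent if and only if the families $\{\tilde V_j^{(1)}\}_{j=2}^n$ and $\{\tilde V_j^{(2)}\}_{j=2}^n$ are unitarily equivalent.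
   Context: An operator $V$ is a power partial isometry if $V^n$ is a partial isometry for all $n\ge0$. Let $n>1$ and let $\{U_{ij}\}_{1\le i<j\le n}$ be commuting unitaries on $\mathcal{H}$, $U_{ji}:=U_{ij}^*$. A family $(V_1,\dots,V_n)$ of power partial isometries on $\mathcal{H}$ is a $\mathcal{U}_n$-twisted power partial isometry with respect to $\{U_{ij}\}_{i<j}$ if $V_i^*V_j=U_{ij}V_jV_i^*$, $V_iV_j=U_{ji}V_jV_i$ and $V_kU_{ij}=U_{ij}V_k$ for all $i,j,k$ with $i\neq j$. (For a single operator, ''twisted'' imposes no relation.) The family is irreducible if $\mathcal{H}\neq0$ and no closed subspaces other than $0,\mathcal{H}$ reduce all $V_i$. Two families $(V_i)$ on $\mathcal{H}$ and $(W_i)$ on $\mathcal{K}$ are unitarily equivalent if there is one unitary $Z:\mathcal{H}\to\mathcal{K}$ with $ZV_iZ^*=W_i$ for all $i$. Halmos–Wallen subspaces of a power partial isometry $V$: with $P,Q$ the orthogonal projections onto $\bigcap_{n\ge1}V^n\mathcal{H}$ and $\bigcap_{n\ge1}V^{*n}\mathcal{H}$ (these commute), $\mathcal{H}_u=PQ\mathcal{H}$, $\mathcal{H}_s=(1-P)Q\mathcal{H}$, $\mathcal{H}_b=(1-Q)P\mathcal{H}$, and for $p\ge1$, $\mathcal{H}_p=\sum_{n=1}^p(V^{n-1}V^{*(n-1)}-V^nV^{*n})(V^{*(p-n)}V^{p-n}-V^{*(p-n+1)}V^{p-n+1})\mathcal{H}$. One has $\mathcal{H}=\mathcal{H}_u\oplus\mathcal{H}_s\oplus\mathcal{H}_b\oplus\bigoplus_{p\ge1}\mathcal{H}_p$.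 $S$ is the unilateral shift $Se_k=e_{k+1}$ on $\ell^2(\mathbb{Z}_+)$ with basis $(e_k)_{k\ge0}$; $J_p$ is the truncated shift on $\mathbb{C}^p$ with basis $e_1,\dots,e_p$: $J_pe_k=e_{k+1}$ for $k<p$, $J_pe_p=0$ (so $J_1=0$). Notation for the diagonal operators: the $U_{ij}$ commute with all $V_k$, hence with all $V_k^*$, so irreducibility makes them scalars, $U_{ij}=\lambda_{ij}I$ with $|\lambda_{ij}|=1$ and $\lambda_{ji}=\overline{\lambda_{ij}}$; accordingly the same scalars twist the $\tilde V_j$. $D(U_{ij})$ is the diagonal unitary $e_k\mapsto\lambda_{ij}^{k}e_k$ on $\ell^2(\mathbb{Z}_+)$, and $d(U_{ij})$ is the diagonal unitary $e_k\mapsto\lambda_{ij}^{k-1}e_k$ on $\mathbb{C}^p$. In the equivalence statements the twisting unitaries are fixed, i.e. the families compared have the same scalars $\lambda_{ij}$. ''Different cases'' refers to the cases (1), (2), (3) for each value of $p\geq 1$, and (4). *)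

(* Defs.v *)
From HB Require Import structures.
From mathcomp Require Import all_boot all_order all_algebra finmap.
From mathcomp Require Import complex.
From mathcomp Require Import boolp classical_sets functions reals.
From mathcomp Require Import topology normedtype.
From mathcomp Require Import summability.
From mathcomp Require Import ring.

Set Implicit Arguments.
Unset Strict Implicit.
Unset Printing Implicit Defensive.

Import Order.TTheory GRing.Theory Num.Theory.
Import numFieldNormedType.Exports.

Local Open Scope classical_set_scope.
Local Open Scope ring_scope.


Section DotNorm.
Variables (C : numClosedFieldType) (U : lmodType C) (f : {dot U for Num.conj}).

Definition dot_norm (x : U) : C := sqrtC (f x x).

Lemma dot_normK x : dot_norm x ^+ 2 = f x x. Proof. exact: sqrtCK. Qed.

Lemma dot_norm_ge0 x : 0 <= dot_norm x. Proof. exact: sqrt_dnorm_ge0. Qed.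

Lemma dot_norm_eq0 x : dot_norm x = 0 -> x = 0.
Proof. by move=> /eqP; rewrite sqrt_dnorm_eq0 => /eqP. Qed.

Lemma dot_normZ a x : dot_norm (a *: x) = `|a| * dot_norm x.
Proof. by rewrite /dot_norm dnormZ sqrtCM ?nnegrE ?exprn_ge0// sqrCK. Qed.

Lemma dot_CauchySchwarz x y : `|f x y| <= dot_norm x * dot_norm y.
Proof.
have [->|y0] := eqVneq y 0.
  by rewrite linear0r normr0 mulr_ge0// dot_norm_ge0.
have yy0 : 0 < f y y by rewrite dnorm_gt0.
have yx : f y x = (f x y)^* by rewrite hermC mul1r.
have yyJ : (f y y)^* = f y y by rewrite geC0_conj// ltW.
have := dnorm_ge0 f (f y y *: x - f x y *: y).
rewrite dnormB !dnormZ linearZl_LR linearZr_LR/= normCK yyJ.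
rewrite !rmorphM/= conjCK yyJ -yx.
rewrite [X in 0 <= X](_ : _ = f y y * (f x x * f y y - `|f x y| ^+ 2)); last first.
  by rewrite normCK -yx; ring.
rewrite pmulr_rge0// subr_ge0 => h.
rewrite -(ler_pXn2r (ltn0Sn 1)) ?nnegrE ?mulr_ge0 ?dot_norm_ge0//.
by rewrite exprMn !dot_normK.
Qed.

Lemma ler_dot_normD x y : dot_norm (x + y) <= dot_norm x + dot_norm y.
Proof.
rewrite -(ler_pXn2r (ltn0Sn 1)) ?nnegrE ?addr_ge0 ?dot_norm_ge0//.
rewrite dot_normK dnormD sqrrD !dot_normK addrAC lerD2r lerD2l.
have -> : f x y + (f x y)^* = 'Re (f x y) *+ 2.
  by rewrite ReE -mulr_natr divfK // pnatr_eq0.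
rewrite lerMn2r/=; apply: le_trans (dot_CauchySchwarz x y).
by have [] := leif_Re_Creal (f x y).
Qed.

End DotNorm.

HB.mixin Record NormedModule_hasDot (R : realType) V
    & NormedModule R[i] V := {
  inner : {dot V for Num.conj};
  sqr_norm_inner : forall x, `|x| ^+ 2 = inner x x
}.

#[short(type="preHilbertType")]
HB.structure Definition PreHilbert (R : realType) :=
  {V of NormedModule R[i] V & NormedModule_hasDot R V}.

#[short(type="hilbertType")]
HB.structure Definition Hilbert (R : realType) :=
  {V of PreHilbert R V & CompleteNormedModule R[i] V}.

HB.factory Record Lmodule_isPreHilbert (R : realType) V
    & GRing.Lmodule R[i] V := {
  dot : V -> V -> R[i];
  dot_linear : forall y a x x', dot (a *: x + x') y = a * dot x y + dot x' y;
  dot_conj : forall x y, dot x y = (dot y x)^*;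
  dot_gt0 : forall x, x != 0 -> 0 < dot x x
}.
HB.builders Context R V & Lmodule_isPreHilbert R V.

Lemma dot_bilinear :
  bilinear_for *%R ((Num.conj : {rmorphism R[i] -> R[i]}) \; *%R :
    GRing.Scale.law _ _) dot.
Proof.
split=> [y a x x'|x a y y']; first exact: dot_linear.
rewrite dot_conj dot_linear rmorphD rmorphM/=.
by rewrite [dot x y]dot_conj [dot x y']dot_conj.
Qed.

HB.instance Definition _ :=
  bilinear_isBilinear.Build R[i] V V R[i] _ _ dot dot_bilinear.
HB.instance Definition _ :=
  @isHermitianSesquilinear.Build R[i] V false Num.conj dot
  (fun x y => etrans (dot_conj x y) (esym (mul1r _))).
HB.instance Definition _ := @isDotProduct.Build R[i] V dot dot_gt0.

HB.instance Definition _ := Lmodule_isNormed.Build R[i] V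
  (@ler_dot_normD _ _ dot) (@dot_normZ _ _ dot) (@dot_norm_eq0 _ _ dot).
HB.instance Definition _ := NormedModule_hasDot.Build R V (@dot_normK _ _ dot).
HB.end.

#[export] Existing Instance totally_filter.

Section ComplexLimits.
Variable R : realType.
Local Notation C := R[i].

Lemma sqr_normD_le (u v : C) : `|u + v| ^+ 2 <= 2 * `|u| ^+ 2 + 2 * `|v| ^+ 2.
Proof.
have : 0 <= `|u - v| ^+ 2 by rewrite exprn_ge0.
rewrite -(lerD2l (`|u + v| ^+ 2)) addr0 => /le_trans; apply.
rewrite le_eqVlt; apply/orP; left; apply/eqP.
by rewrite !normCK !(rmorphD, rmorphN)/=; ring.
Qed.

Lemma lim_ge0 (T : Type) (F : set_system T) (FF : ProperFilter F)
    (g : T -> C^o) (l : C^o) :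
  g @ F --> l -> (\forall x \near F, 0 <= (g x : C)) -> 0 <= (l : C).
Proof.
move=> gl g0; suff <- : `|l| = l by exact: normr_ge0.
apply: (cvg_unique (@norm_hausdorff _ C^o) (F := g @ F)) => //.
apply: cvg_trans (cvg_norm gl).
by apply: near_eq_cvg; apply: filterS g0 => x /ger0_norm.
Qed.

Lemma norm_real_complex (r : R) : `|(r%:C)%C| = (`|r|%:C)%C :> C.
Proof. by rewrite normc_def/= expr0n/= addr0 sqrtr_sqr. Qed.

Lemma norm_complex_i : `|'i%C| = 1 :> C.
Proof. by rewrite normc_def/= expr0n/= expr1n add0r sqrtr1. Qed.

Lemma norm_Im_le (z : C) : (`|complex.Im z|%:C)%C <= `|z|.
Proof.
rewrite -normrN -ReiNIm; apply: le_trans (normc_ge_Re _) _.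
by rewrite normrM norm_complex_i mulr1.
Qed.

Lemma norm_le_ReIm (z : C) :
  `|z| <= ((`|complex.Re z| + `|complex.Im z|)%:C)%C :> C.
Proof.
rewrite {1}(complexE z) rmorphD/=; apply: le_trans (ler_normD _ _) _.
by rewrite normrM norm_complex_i mul1r !norm_real_complex lexx.
Qed.

Lemma gtc0_Re (e : C) : 0 < e -> 0 < complex.Re e /\ e = ((complex.Re e)%:C)%C.
Proof.
case: e => a b; rewrite ltcE/= => /andP[/eqP b0 a0].
by rewrite a0 b0.
Qed.

Lemma complex_cauchy_cvg (F : set_system C^o) :
  ProperFilter F -> cauchy F -> cvg F.
Proof.
move=> FF /cauchy_ballP Fc.
have cauchy_part (f : C^o -> R^o) :
    (forall z w, f z - f w = f (z - w)) ->
    (forall z : C, (`|f z|%:C)%C <= `|z|) ->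
  exists l : R^o, f @ F --> l.
  move=> fB f_le; apply/cvg_ex; apply: cauchy_cvg; apply/cauchy_ballP => e e0.
  have e0C : 0 < (e%:C)%C :> C by rewrite ltcR.
  have [[A B] /= [FA FB] AB] := Fc _ e0C.
  exists (f @` A, f @` B).
    by split; [apply: filterS FA|apply: filterS FB] => x Ax; exists x.
  move=> [_ _] /= [[x Ax <-] [y By <-]].
  have := AB (x, y) (conj Ax By).
  rewrite /ball/= /ball_/= => xye.
  by rewrite -ltcR fB (le_lt_trans (f_le _)).
have [a Fa] : exists a, (fun z : C^o => complex.Re z : R^o) @ F --> (a : R^o).
  by apply: cauchy_part; [case=> ? ? [? ?]|exact: normc_ge_Re].
have [b Fb] : exists b, (fun z : C^o => complex.Im z : R^o) @ F --> (b : R^o).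
  by apply: cauchy_part; [case=> ? ? [? ?]|exact: norm_Im_le].
apply/cvg_ex; exists (a +i* b)%C.
apply/cvgrPdist_lt => e /gtc0_Re[e0 ->].
have e20 : 0 < complex.Re e / 2 by rewrite divr_gt0.
move/cvgrPdist_lt : Fa => /(_ _ e20) Fa.
move/cvgrPdist_lt : Fb => /(_ _ e20) Fb.
apply: filterS2 Fa Fb => -[x y] /= ax b_y.
apply: le_lt_trans (norm_le_ReIm _) _.
by rewrite ltcR/= [ltRHS](splitr (complex.Re e)) ltrD.
Qed.

Lemma partial_sumE (I : choiceType) (a : I -> C^o) (A : {fset I}) :
  partial_sum a A = \sum_(i <- A) a i.
Proof. by rewrite /partial_sum big_seq_fsetE. Qed.

Lemma le_partial_sum (I : choiceType) (a : I -> C^o) (A A' : {fset I}) :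
  (forall i, 0 <= (a i : C)) -> (A `<=` A')%fset ->
  (partial_sum a A : C) <= partial_sum a A'.
Proof.
move=> a0 AA'.
rewrite !partial_sumE (perm_big [seq i <- A' | i \in A])/=; last first.
  apply: uniq_perm => [||i]; rewrite ?filter_uniq ?fset_uniq// mem_filter.
  by case: (boolP (i \in A)) => // /(fsubsetP AA') ->.
rewrite big_filter big_mkcond/=; apply: ler_sum => i _.
by case: ifP.
Qed.

Lemma nneg_sum_cvg (I : choiceType) (a : I -> C^o) (B : C) :
  (forall i, 0 <= (a i : C)) ->
  (forall A : {fset I}, \sum_(i <- A) (a i : C) <= B) ->
  cvg (partial_sum a @ totally).
Proof.
move=> a0 aB.
pose S := [set complex.Re (partial_sum a A) | A in [set: {fset I}]].
have real_sum A : partial_sum a A = (complex.Re (partial_sum a A))%:C%C.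
  have : 0 <= (partial_sum a A : C) by rewrite partial_sumE sumr_ge0.
  by case: (partial_sum a A) => x y; rewrite lecE/= => /andP[/eqP ->].
have supS : has_sup S.
  split; first by exists (complex.Re (partial_sum a fset0)), fset0.
  exists (complex.Re B) => _ [A _ <-].
  by have := aB A; rewrite -partial_sumE lecE => /andP[].
apply/cvg_ex; exists (sup S)%:C%C.
apply/cvgrPdist_lt => e /gtc0_Re[e0 ->].
have [_ [A _ <-] sA] := sup_adherent e0 supS.
exists A => // A' /= AA'.
have le_AA' : complex.Re (partial_sum a A) <= complex.Re (partial_sum a A').
  suff : (partial_sum a A : C) <= partial_sum a A' by rewrite lecE => /andP[].
  exact: le_partial_sum.
have A'S : complex.Re (partial_sum a A') <= sup S.
  by apply: sup_upper_bound => //; exists A'.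
rewrite [partial_sum a A']real_sum -rmorphB norm_real_complex ltcR.
rewrite ger0_norm ?subr_ge0//.
by rewrite ltrBlDr -ltrBlDl (lt_le_trans sA).
Qed.

End ComplexLimits.

(* The sums over I are unconditional: limits along the finite subsets of I.
   The space C^p with its Euclidean structure is ell2 R 'I_p. *)
Section Ell2.
Variables (R : realType) (I : choiceType).
Local Notation C := R[i].

Definition square_summable : {pred I -> C} := fun x =>
  `[< exists B : C, forall A : {fset I}, \sum_(i <- A) `|x i| ^+ 2 <= B >].

Lemma square_summable_submod : submod_closed square_summable.
Proof.
split.
  by apply/asboolP; exists 0 => A; rewrite big1// => i _; rewrite normr0 expr0n.
move=> a x y /asboolP[B xB] /asboolP[B' yB']; apply/asboolP.
exists (2 * `|a| ^+ 2 * B + 2 * B') => A.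
apply: (@le_trans _ _
    (\sum_(i <- A) (2 * `|a| ^+ 2 * `|x i| ^+ 2 + 2 * `|y i| ^+ 2))).
  apply: ler_sum => i _; rewrite -mulrA -exprMn -normrM.
  exact: sqr_normD_le.
rewrite big_split/= -!mulr_sumr lerD// ler_wpM2l//.
by rewrite mulr_ge0// exprn_ge0.
Qed.

HB.instance Definition _ := GRing.isSubmodClosed.Build C (I -> C)
  square_summable square_summable_submod.

Record ell2 := Ell2 {
  ell2_fun :> I -> C;
  ell2P : ell2_fun \in square_summable }.

HB.instance Definition _ := [isSub for ell2_fun].
HB.instance Definition _ := [Choice of ell2 by <:].
HB.instance Definition _ := [SubChoice_isSubLmodule of ell2 by <:].

Definition ell2_dot (x y : ell2) : C := sum (fun i => x i * (y i)^* : C^o).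

Lemma sqr_norm_sum_cvg (x : ell2) :
  cvg (partial_sum (fun i => `|x i| ^+ 2 : C^o) @ totally).
Proof.
have /asboolP[B xB] := ell2P x.
by apply: (nneg_sum_cvg (B := B)) => // i; rewrite exprn_ge0.
Qed.

Lemma polarization (C' : numClosedFieldType) (u v : C') :
  u * v^* = 4^-1 * (`|u + v| ^+ 2 - `|u - v| ^+ 2 +
                    'i * `|u + 'i * v| ^+ 2 - 'i * `|u + (- 'i) * v| ^+ 2).
Proof.
rewrite !normCK !(rmorphD, rmorphN, rmorphM)/= conjCi.
have i2 : 'i ^+ 2 = -1 :> C' by rewrite sqrCi.
have n4 : (4 : C') != 0 by rewrite pnatr_eq0.
by field: i2.
Qed.

Lemma ell2_dot_cvg (x y : ell2) :
  partial_sum (fun i => x i * (y i)^* : C^o) @ totally --> (ell2_dot x y : C^o).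
Proof.
suff : cvg (partial_sum (fun i => x i * (y i)^* : C^o) @ totally) by [].
pose q (z : ell2) : {fset I} -> C^o := partial_sum (fun i => `|z i| ^+ 2 : C^o).
have -> : partial_sum (fun i => x i * (y i)^* : C^o) =
    (fun A => (4^-1 : C^o) * (q (x + y) A - q (x - y) A +
                    ('i : C^o) * q (x + 'i *: y) A - ('i : C^o) * q (x + (- 'i) *: y) A)).
  apply/funext => A; rewrite /q !partial_sumE.
  rewrite !mulr_sumr -!sumrN -!big_split/= mulr_sumr.
  by apply: eq_bigr => i _; rewrite polarization.
have qc z : cvg (q z @ totally) by exact: sqr_norm_sum_cvg.
apply: is_cvgM; first exact: is_cvg_cst.
apply: is_cvgB; last by apply: is_cvgM; [exact: is_cvg_cst|exact: qc].
apply: is_cvgD; last by apply: is_cvgM; [exact: is_cvg_cst|exact: qc].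
by apply: is_cvgB; exact: qc.
Qed.

Lemma ell2_dot_lim (x y : ell2) (l : C) :
  partial_sum (fun i => x i * (y i)^* : C^o) @ totally --> (l : C^o) -> 
  ell2_dot x y = l.
Proof.
move=> xyl; apply: (cvg_unique (@norm_hausdorff _ C^o)) xyl.
exact: ell2_dot_cvg.
Qed.

Lemma ell2_dot_linear (y : ell2) (a : C) (x x' : ell2) :
  ell2_dot (a *: x + x') y = a * ell2_dot x y + ell2_dot x' y.
Proof.
apply: ell2_dot_lim.
rewrite (_ : partial_sum _ = (fun A => (a : C^o) *
    partial_sum (fun i => x i * (y i)^* : C^o) A +
    partial_sum (fun i => x' i * (y i)^* : C^o) A)); last first.
  apply/funext => A; rewrite !partial_sumE mulr_sumr -big_split/=.
  by apply: eq_bigr => i _; rewrite mulrDl mulrA.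
apply: cvgD; last exact: ell2_dot_cvg.
by apply: cvgM; [exact: cvg_cst|exact: ell2_dot_cvg].
Qed.

Lemma cvg_conj (T : Type) (F : set_system T) (FF : Filter F)
    (g : T -> C^o) (l : C^o) :
  g @ F --> l -> (fun t => (g t : C)^* : C^o) @ F --> ((l : C)^* : C^o).
Proof.
move=> /cvgrPdist_lt gl; apply/cvgrPdist_lt => e e0.
by apply: filterS (gl e e0) => t; rewrite -rmorphB norm_conjC.
Qed.

Lemma ell2_dot_conj (x y : ell2) : ell2_dot x y = (ell2_dot y x)^*.
Proof.
apply: ell2_dot_lim.
rewrite (_ : partial_sum _ = Num.conj \o
    partial_sum (fun i => y i * (x i)^* : C^o)); last first.
  apply/funext => A /=; rewrite !partial_sumE rmorph_sum/=.
  by apply: eq_bigr => i _; rewrite rmorphM/= conjCK mulrC.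
by apply: cvg_conj; exact: ell2_dot_cvg.
Qed.

Lemma ell2_sum_le_dot (x : ell2) (A : {fset I}) :
  \sum_(i <- A) `|x i| ^+ 2 <= ell2_dot x x.
Proof.
rewrite -subr_ge0.
have h : (fun A' => partial_sum (fun i => x i * (x i)^* : C^o) A'
    - \sum_(i <- A) (`|x i| ^+ 2 : C^o)) @ totally
  --> (ell2_dot x x - \sum_(i <- A) (`|x i| ^+ 2) : C^o).
  by apply: cvgB; [exact: ell2_dot_cvg|exact: cvg_cst].
apply: (lim_ge0 _ h).
exists A => // A' /= AA'; rewrite subr_ge0.
have -> : (fun i => x i * (x i)^* : C^o) = (fun i => `|x i| ^+ 2 : C^o).
  by apply/funext => i; rewrite normCK.
rewrite -partial_sumE; apply: le_partial_sum => // i.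
by rewrite exprn_ge0.
Qed.

Lemma ell2_dot_le (x : ell2) (B : C) :
  (forall A : {fset I}, \sum_(i <- A) `|x i| ^+ 2 <= B) -> ell2_dot x x <= B.
Proof.
move=> xB; rewrite -subr_ge0.
have h : (fun A' => (B : C^o) - partial_sum (fun i => x i * (x i)^* : C^o) A')
   @ totally --> (B - ell2_dot x x : C^o).
  by apply: cvgB; [exact: cvg_cst|exact: ell2_dot_cvg].
apply: (lim_ge0 _ h); near=> A; rewrite subr_ge0 partial_sumE.
by under eq_bigr do rewrite -normCK.
Unshelve. all: by end_near. Qed.

Lemma ell2_dot_gt0 (x : ell2) : x != 0 -> 0 < ell2_dot x x.
Proof.
move=> x0; have [i xi0] : exists i, x i != 0.
  apply: contrapT => /forallNP xz; move/eqP: x0; apply.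
  by apply/val_inj/funext => i; apply/eqP/negPn/negP; exact: xz.
apply: (@lt_le_trans _ _ (`|x i| ^+ 2)); first by rewrite exprn_gt0// normr_gt0.
by have := ell2_sum_le_dot x [fset i]%fset; rewrite big_seq_fset1.
Qed.

HB.instance Definition _ := @Lmodule_isPreHilbert.Build R ell2
  ell2_dot ell2_dot_linear ell2_dot_conj ell2_dot_gt0.

Lemma sqr_norm_ell2 (x : ell2) : `|x| ^+ 2 = ell2_dot x x.
Proof. by rewrite sqr_norm_inner. Qed.

Lemma ell2_norm_le (x : ell2) (e : C) : 0 <= e ->
  (forall A : {fset I}, \sum_(i <- A) `|x i| ^+ 2 <= e ^+ 2) -> `|x| <= e.
Proof.
move=> e0 xe; rewrite -(ler_pXn2r (ltn0Sn 1)) ?nnegrE// sqr_norm_ell2.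
exact: ell2_dot_le.
Qed.

Lemma ell2_sum_le (x : ell2) (A : {fset I}) :
  \sum_(i <- A) `|x i| ^+ 2 <= `|x| ^+ 2.
Proof. by rewrite sqr_norm_ell2; exact: ell2_sum_le_dot. Qed.

Lemma ell2_coord_le (x : ell2) (i : I) : `|x i| <= `|x|.
Proof.
rewrite -(ler_pXn2r (ltn0Sn 1)) ?nnegrE//.
by have := ell2_sum_le x [fset i]%fset; rewrite big_seq_fset1.
Qed.

Lemma ell2_complete (F : set_system ell2) : ProperFilter F -> cauchy F -> cvg F.
Proof.
move=> FF /cauchy_ballP Fc.
have coord_cvg i : exists l : C^o, (fun x : ell2 => x i : C^o) @ F --> l.
  apply/cvg_ex; apply: complex_cauchy_cvg; apply/cauchy_ballP => e e0.
  have [[A B] /= [FA FB] AB] := Fc _ e0.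
  exists ((fun x : ell2 => x i : C^o) @` A, (fun x : ell2 => x i : C^o) @` B).
    by split; [apply: filterS FA|apply: filterS FB] => x Ax; exists x.
  move=> [_ _] /= [[x Ax <-] [y By <-]].
  have := AB (x, y) (conj Ax By); rewrite -!ball_normE /ball_/=.
  exact: le_lt_trans (ell2_coord_le (x - y) i).
pose l i : C := projT1 (cid (coord_cvg i)).
have Fl i : (fun x : ell2 => x i : C^o) @ F --> (l i : C^o) := projT2 (cid (coord_cvg i)).
have near_l e : 0 < e -> exists2 P, F P & forall x : ell2, P x ->
    forall A : {fset I}, \sum_(i <- A) `|x i - l i| ^+ 2 <= e ^+ 2.
  move=> e0; have [[P Q] /= [FP FQ] PQ] := Fc _ e0.
  exists P => // x Px A; rewrite -subr_ge0.
  have h : (fun y : ell2 => (e ^+ 2 : C^o) - \sum_(i <- A) (`|x i - y i| ^+ 2 : C^o))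
     @ F --> (e ^+ 2 - \sum_(i <- A) `|x i - l i| ^+ 2 : C^o).
    apply: cvgB; first exact: cvg_cst.
    apply: (@cvg_big C^o I +%R 0 xpredT _ _ F A
      (fun i (y : ell2) => (`|x i - y i| ^+ 2 : C^o))) => [|i _]; first exact: add_continuous.
    have hi : (fun y : ell2 => `|(x i : C^o) - y i|) @ F --> (`|x i - l i| : C^o).
      by apply: cvg_norm; apply: cvgB; [exact: cvg_cst|exact: Fl].
    rewrite expr2; under eq_fun do rewrite expr2.
    exact: cvgM.
  apply: (lim_ge0 _ h); apply: filterS FQ => y Qy; rewrite subr_ge0.
  apply: le_trans (ell2_sum_le (x - y) A) _.
  have := PQ (x, y) (conj Px Qy); rewrite -!ball_normE /ball_/= => /ltW.
  by rewrite -(ler_pXn2r (ltn0Sn 1)) ?nnegrE// ltW.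
have l_ell2 : l \in square_summable.
  have [P FP Pl] := near_l 1 ltr01.
  have [x Px] := filter_ex FP.
  rewrite (_ : l = val x - ((x : I -> C) - l)); last first.
    by apply/funext => i; rewrite !fctE opprB addrCA subrr addr0.
  apply: rpredB; first exact: ell2P.
  by apply/asboolP; exists (1 ^+ 2); exact: Pl.
apply/cvg_ex; exists (Ell2 l_ell2); apply/cvgrPdist_le => e e0.
have [P FP Pl] := near_l e e0.
apply: filterS FP => x Px; rewrite distrC; apply: ell2_norm_le (ltW e0) _.
exact: Pl.
Qed.

HB.instance Definition _ := Uniform_isComplete.Build ell2 ell2_complete.

End Ell2.

Section Ell2Fin.
Variables (R : realType) (I : finType).
Local Notation C := R[i].

Lemma square_summable_fin (x : I -> C) : x \in @square_summable R I.
Proof.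
apply/asboolP; exists (\sum_i `|x i| ^+ 2) => A.
rewrite (perm_big [seq i <- index_enum I | i \in A])/=; last first.
  apply: uniq_perm => [||i]; rewrite ?fset_uniq ?filter_uniq ?index_enum_uniq//.
  by rewrite mem_filter mem_index_enum andbT.
rewrite big_filter big_mkcond/=; apply: ler_sum => i _.
by case: ifP => // _; rewrite exprn_ge0.
Qed.

Lemma ell2_fin_inner (x y : ell2 R I) : inner x y = \sum_i x i * (y i)^*.
Proof.
suff: ell2_dot x y = \sum_i x i * (y i)^* by [].
apply: ell2_dot_lim; apply: cvg_near_cst.
exists [fset i in index_enum I]%fset => // A /= /fsubsetP IA.
rewrite partial_sumE (perm_big (index_enum I))//=.
apply: uniq_perm => [||i]; rewrite ?fset_uniq ?index_enum_uniq//.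
by rewrite mem_index_enum; apply: IA; rewrite inE/= mem_index_enum.
Qed.

End Ell2Fin.

Section Ell2Operators.
Variables (R : realType).
Local Notation C := R[i].

Lemma square_summable_reindex (I J : choiceType) (g : J -> option I)
    (h : I -> J) (x : I -> C) : ocancel g h -> x \in @square_summable R I ->
  (fun j => if g j is Some i then x i else 0) \in @square_summable R J.
Proof.
move=> gK /asboolP[B xB]; apply/asboolP; exists B => A.
have uA : uniq (pmap g A) by rewrite (pmap_uniq gK)// fset_uniq.
apply: le_trans (xB [fset i in pmap g A]%fset).
rewrite [leRHS](perm_big (pmap g A))/=; last first.
  by apply: uniq_perm; rewrite ?fset_uniq// => i; rewrite !inE.
rewrite -(big_map g xpredT (fun o => `|if o is Some i then x i else 0| ^+ 2)).
elim: (enum_fset A) {uA} => [|j s IHs]/=; first by rewrite !big_nil.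
rewrite big_cons; case: (g j) => [i|]/=; first by rewrite big_cons lerD2l.
by rewrite normr0 expr0n add0r.
Qed.

Definition ounsucc (k : nat) : option nat :=
  if k is k'.+1 then Some k' else None.

Lemma ounsuccK : ocancel ounsucc succn. Proof. by case. Qed.

Definition unilateral_shift (x : ell2 R nat) : ell2 R nat :=
  Ell2 (square_summable_reindex ounsuccK (ell2P x)).

Definition ounsucc_ord p (k : 'I_p) : option 'I_p :=
  if nat_of_ord k is k'.+1 then insub k' else None.

Lemma ounsucc_ordK p :
  ocancel (@ounsucc_ord p) (fun k => insubd k k.+1).
Proof.
case=> [[|k] kp]//=; rewrite /ounsucc_ord/=.
rewrite insubT ?(ltnW kp)//= => kp'; apply: val_inj => /=.
by rewrite insubdK.
Qed.

(* The basis vector e_k of C^p, 1 <= k <= p, is indexed by k - 1 : 'I_p. *)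
Definition trunc_shift p (x : ell2 R 'I_p) : ell2 R 'I_p :=
  Ell2 (square_summable_reindex (@ounsucc_ordK p) (ell2P x)).

(* Total in w: the value is 0 where w x is not square summable, which does not
   happen for bounded w. *)
Definition diag_op (I : choiceType) (w : I -> C) (x : ell2 R I) : ell2 R I :=
  insubd 0 (fun i => w i * x i).

Lemma diag_opE (I : choiceType) (w : I -> C) (x : ell2 R I) (i : I) :
  (forall j, `|w j| <= 1) -> diag_op w x i = w i * x i.
Proof.
move=> w1; rewrite /diag_op -[LHS]/(val (insubd _ _) i) insubdK//.
have /asboolP[B xB] := ell2P x.
apply/asboolP; exists B => A; apply: le_trans (xB A).
apply: ler_sum => j _; rewrite normrM exprMn ler_piMl ?exprn_ge0//.
by rewrite exprn_ile1.
Qed.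

Definition D_op (a : C) : ell2 R nat -> ell2 R nat := diag_op (fun k => a ^+ k).

Definition d_op p (a : C) : ell2 R 'I_p -> ell2 R 'I_p :=
  diag_op (fun k : 'I_p => a ^+ k).

Lemma ell2_deltaP (I : choiceType) (i : I) :
  (fun j => (j == i)%:R) \in @square_summable R I.
Proof.
apply/asboolP; exists 1 => A.
have [iA|iA] := boolP (i \in A).
  rewrite (big_fsetD1 i)//= eqxx normr1 expr1n big1_fset ?addr0// => j.
  by rewrite in_fsetD1 => /andP[/negPf ->] _ _; rewrite normr0 expr0n.
rewrite big1_fset// => j jA _; rewrite (_ : j == i = false) ?normr0 ?expr0n//.
by apply: contraNF iA => /eqP <-.
Qed.

Definition ell2_delta (I : choiceType) (i : I) : ell2 R I :=
  Ell2 (ell2_deltaP i).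

Lemma unilateral_shift_delta k :
  unilateral_shift (ell2_delta k) = ell2_delta k.+1.
Proof. by apply/val_inj/funext => -[|j]. Qed.

Lemma trunc_shift_delta p (k : 'I_p) (kp : (k.+1 < p)%N) :
  trunc_shift (ell2_delta k) = ell2_delta (Ordinal kp).
Proof.
apply/val_inj/funext => -[[|j] jp]//=; rewrite /ounsucc_ord/=.
by rewrite insubT ?(ltnW jp)//= => jp'; rewrite -!val_eqE.
Qed.

Lemma trunc_shift_delta_last p (k : 'I_p) : k.+1 = p ->
  trunc_shift (ell2_delta k) = 0.
Proof.
move=> kp; apply/val_inj/funext => -[[|j] jp]//=; rewrite /ounsucc_ord/=.
rewrite insubT ?(ltnW jp)//= => jp'; rewrite -val_eqE/=.
suff -> : (j == k) = false by [].
by apply/negbTE/eqP => jk; move: (jp); rewrite jk kp ltnn.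
Qed.

Lemma D_op_delta (a : C) k : `|a| <= 1 ->
  D_op a (ell2_delta k) = a ^+ k *: ell2_delta k.
Proof.
move=> a1; apply/val_inj/funext => j /=.
rewrite [LHS]diag_opE => [|i]; last by rewrite normrX exprn_ile1.
transitivity (a ^+ k * (j == k)%:R); last by [].
by rewrite /=; case: eqVneq => [->|_]//; rewrite !mulr0.
Qed.

Lemma d_op_delta p (a : C) (k : 'I_p) : `|a| <= 1 ->
  d_op a (ell2_delta k) = a ^+ k *: ell2_delta k.
Proof.
move=> a1; apply/val_inj/funext => j /=.
rewrite [LHS]diag_opE => [|i]; last by rewrite normrX exprn_ile1.
transitivity (a ^+ k * (j == k)%:R); last by [].
by rewrite /=; case: eqVneq => [->|_]//; rewrite !mulr0.
Qed.

End Ell2Operators.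

Section Operators.
Variable R : realType.
Implicit Types H K : hilbertType R.

Definition bounded_op H K (V : H -> K) : Prop := linear V /\ continuous V.

(* The adjoint of a bounded operator exists (Riesz) and is unique. *)
Definition adjoint H K (V : H -> K) : K -> H :=
  xget (fun=> 0) [set W | forall x y, inner (V x) y = inner x (W y)].

Definition unitary H K (Z : H -> K) : Prop :=
  [/\ bounded_op Z, adjoint Z \o Z = id & Z \o adjoint Z = id].

Definition scalar_op H (a : R[i]) : H -> H := fun x => a *: x.

Definition partial_isometry H (V : H -> H) : Prop :=
  bounded_op V /\
  forall x, (forall y, V y = 0 -> inner x y = 0) -> `|V x| = `|x|.

Definition power_partial_isometry H (V : H -> H) : Prop :=
  forall n, partial_isometry (iter n V).

Definition closed_subspace H (L : set H) : Prop :=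
  [/\ closed L, L 0 & forall (a : R[i]) x y, L x -> L y -> L (a *: x + y)].

(* The projection onto a closed subspace exists and is unique. *)
Definition orth_proj H (L : set H) : H -> H :=
  xget (fun=> 0)
    [set P | forall x, L (P x) /\ forall y, L y -> inner (x - P x) y = 0].

End Operators.

Section Families.
Variable R : realType.
Implicit Types H K M : hilbertType R.

(* Only the entries U i j with i < j are data; U j i stands for their
   adjoints. *)
Definition twist n H (U : 'I_n -> 'I_n -> H -> H) (i j : 'I_n) : H -> H :=
  if (i < j)%N then U i j else adjoint (U j i).

Definition commuting_unitaries n H (U : 'I_n -> 'I_n -> H -> H) : Prop :=
  (forall i j : 'I_n, (i < j)%N -> unitary (U i j)) /\
  (forall i j k l : 'I_n, (i < j)%N -> (k < l)%N ->
    U i j \o U k l = U k l \o U i j).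

Definition twisted_ppi n H (U : 'I_n -> 'I_n -> H -> H) (V : 'I_n -> H -> H) :
    Prop :=
  [/\ commuting_unitaries U,
      forall i, power_partial_isometry (V i),
      forall i j, i != j ->
        adjoint (V i) \o V j = twist U i j \o V j \o adjoint (V i),
      forall i j, i != j -> V i \o V j = twist U j i \o V j \o V i &
      forall i j k, i != j -> V k \o twist U i j = twist U i j \o V k].

Definition reduces H (L : set H) (V : H -> H) : Prop :=
  forall x, L x -> L (V x) /\ L (adjoint V x).

Definition irreducible n H (V : 'I_n -> H -> H) : Prop :=
  (exists x : H, x != 0) /\
  forall L : set H, closed_subspace L -> (forall i, reduces L (V i)) ->
    L = [set 0] \/ L = setT.

Definition unitarily_equivalent n H K (V : 'I_n -> H -> H)
    (W : 'I_n -> K -> K) : Prop :=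
  exists Z : H -> K, unitary Z /\ forall i, Z \o V i \o adjoint Z = W i.

Definition twist_scalars n (lam : 'I_n -> 'I_n -> R[i]) : Prop :=
  forall i j, i != j -> `|lam i j| = 1 /\ lam j i = (lam i j)^*.

Definition scalar_twist H n (lam : 'I_n -> 'I_n -> R[i]) :
  'I_n -> 'I_n -> H -> H := fun i j => @scalar_op R H (lam i j).

Definition irreducible_twisted_ppi n H (lam : 'I_n -> 'I_n -> R[i])
    (V : 'I_n -> H -> H) : Prop :=
  twisted_ppi (scalar_twist lam) V /\ irreducible V.

End Families.

Section HalmosWallen.
Variables (R : realType) (H : hilbertType R) (V : H -> H).

Definition hw_P : H -> H :=
  orth_proj (\bigcap_(n in [set n | (1 <= n)%N]) range (iter n V)).

Definition hw_Q : H -> H :=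
  orth_proj (\bigcap_(n in [set n | (1 <= n)%N]) range (iter n (adjoint V))).

Definition hw_u : set H := range (hw_P \o hw_Q).

Definition hw_s : set H := range ((id \- hw_P) \o hw_Q).

Definition hw_b : set H := range ((id \- hw_Q) \o hw_P).

Definition hw_E k : H -> H := iter k V \o iter k (adjoint V).

Definition hw_F k : H -> H := iter k (adjoint V) \o iter k V.

Definition hw_p (p : nat) : set H :=
  range (fun x => \sum_(1 <= n < p.+1)
    ((hw_E n.-1 \- hw_E n) \o (hw_F (p - n) \- hw_F (p - n).+1)) x).

End HalmosWallen.

Variant hw_case := Case_s | Case_b | Case_p of nat | Case_u.

Definition in_hw_case (R : realType) (H : hilbertType R) (V : H -> H)
    (c : hw_case) : Prop :=
  match c with
  | Case_s => hw_s V = setT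
  | Case_b => hw_b V = setT
  | Case_p p => (1 <= p)%N /\ hw_p V p = setT
  | Case_u => hw_u V = setT
  end.

Section Tensor.
Variable R : realType.
Implicit Types H K M : hilbertType R.

(* A Hilbert space tensor product of H and K, which is unique up to a unitary
   compatible with the simple tensors: the completion of the algebraic tensor
   product for the inner product that is multiplicative on simple tensors. *)
Record tensorProduct H K := TensorProduct {
  tensor_space :> hilbertType R;
  tens : H -> K -> tensor_space;
  tens_linearl : forall y, linear (tens^~ y);
  tens_linearr : forall x, linear (tens x);
  inner_tens : forall x x' y y',
    inner (tens x y) (tens x' y') = inner x x' * inner y y';
  tens_dense : closure [set z | exists m (x : 'I_m -> H) (y : 'I_m -> K),
    z = \sum_i tens (x i) (y i)] = setT
}.

(* For bounded A and B there is exactly one such operator. *)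
Definition tensor_op H K (T : tensorProduct H K) (A : H -> H) (B : K -> K) :
    T -> T :=
  xget (fun=> 0)
    [set C | bounded_op C /\ forall x y, C (tens T x y) = tens T (A x) (B y)].

Definition tensor_form n H K M (A : K -> K) (D : 'I_n -> K -> K)
    (Vt : 'I_n -> M -> M) (V : 'I_n.+1 -> H -> H) : Prop :=
  exists (T : tensorProduct K M) (Z : H -> T),
    [/\ unitary Z,
        Z \o V ord0 \o adjoint Z = tensor_op A id &
        forall j, Z \o V (lift ord0 j) \o adjoint Z = tensor_op (D j) (Vt j)].

End Tensor.

Section Forms.
Variables (R : realType) (n : nat) (lam : 'I_n.+1 -> 'I_n.+1 -> R[i]).
Variables (H M : hilbertType R).
Variables (Vt : 'I_n -> M -> M) (V : 'I_n.+1 -> H -> H).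

Definition form_s : Prop :=
  tensor_form (@unilateral_shift R)
    (fun j => D_op (lam ord0 (lift ord0 j))) Vt V.

Definition form_b : Prop :=
  tensor_form (adjoint (@unilateral_shift R))
    (fun j => D_op (lam (lift ord0 j) ord0)) Vt V.

Definition form_p (p : nat) : Prop :=
  tensor_form (@trunc_shift R p)
    (fun j => d_op (lam ord0 (lift ord0 j))) Vt V.

End Forms.

Definition tail_scalars (R : realType) n (lam : 'I_n.+1 -> 'I_n.+1 -> R[i]) :
  'I_n -> 'I_n -> R[i] := fun i j => lam (lift ord0 i) (lift ord0 j).

(* Main.v *)
Require Import Defs.
From HB Require Import structures.
From mathcomp Require Import all_boot all_order all_algebra.
From mathcomp Require Import complex.
From mathcomp Require Import boolp classical_sets functions reals.
From mathcomp Require Import topology normedtype.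
From mathcomp Require Import finmap sequences summability ring lra.

Set Implicit Arguments.
Unset Strict Implicit.
Unset Printing Implicit Defensive.

Import Order.TTheory GRing.Theory Num.Theory.
Import numFieldNormedType.Exports.

Local Open Scope classical_set_scope.
Local Open Scope ring_scope.

(** Why the theorem holds.

    Irreducibility turns the twisting unitaries into scalars by Schur's lemma
    ([schur]): an operator A that commutes with the family and its adjoints is a
    scalar.  For such an A that is self-adjoint, and a real t, the operator B = A - t
    and a square root S of B * B satisfy (S - B)(S + B) = 0, and the kernel of
    S - B reduces the family; so B >= 0 or B <= 0 for every t, which leaves a
    single point t where the sign changes.  The square root is the limit of a
    monotone iteration ([sqrt_one_minus]).  A unitary is a linear combination of
    its real and imaginary parts, which are self-adjoint.

    Cases (1), (2) and (3) rest on one construction.  Let W be V_1, or its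
    adjoint in case (2), let M be the kernel of the adjoint of W, and let I be
    nat, or {0, ..., p - 1} in case (3).  The Halmos-Wallen hypothesis says that
    the W^k M with k in I are isometric copies of M and span the whole space
    ([hw_s_isometry], [hw_p_nilpotent], [wandering_complement]); they are
    pairwise orthogonal because M is orthogonal to the range of W.  Hence the
    space itself is a tensor product of l2(I) and M, with
    x (x) m = sum_k x_k W^k m ([wandering_tensor]).  The relations
    V_j W = mu_j W V_j and the adjoint ones say that every V_j maps M to itself
    and acts on W^k m as mu_j^k W^k V_j m, that is, as a diagonal operator
    tensored with its restriction to M
    ([wandering_model]).  A subspace L of M that reduces the restrictions gives a
    subspace that reduces the family, namely the orthogonal complement of all
    W^k m with m orthogonal to L, so the restrictions are irreducible too.

    The four cases, and the values of p, are told apart by the injectivity of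
    V_1 and of its adjoint and by the order of nilpotency of V_1, which are
    unitary invariants ([kernel_pattern]).

    In a tensor product of l2(I) and M, the kernel of the adjoint of the shift
    tensored with 1 is the copy of M over the first basis vector.  A unitary that
    intertwines two families carries one copy to the other and restricts to a
    unitary that intertwines the small families; conversely a unitary Y of the
    small families extends to 1 (x) Y ([tensor_form_equivalent]).  The tensor
    products are arbitrary here, so the existence of the operators A (x) B and
    1 (x) Y has to be proved; all of them come from [orthogonal_synthesis]. *)

(** * Inner products *)

Section InnerProduct.
Variables (R : realType) (H : hilbertType R).
Implicit Types (x y z : H) (a : R[i]).

Lemma innerC x y : inner x y = (inner y x)^*.
Proof. by rewrite hermC mul1r. Qed.

Lemma innerDl x y z : inner (x + y) z = inner x z + inner y z.
Proof. by rewrite linearDl. Qed.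

Lemma innerDr x y z : inner z (x + y) = inner z x + inner z y.
Proof. by rewrite linearDr. Qed.

Lemma innerZl a x y : inner (a *: x) y = a * inner x y.
Proof. by rewrite linearZl_LR. Qed.

Lemma innerZr a x y : inner x (a *: y) = a^* * inner x y.
Proof. by rewrite linearZr_LR. Qed.

Lemma innerBl x y z : inner (x - y) z = inner x z - inner y z.
Proof. by rewrite linearBl. Qed.

Lemma innerBr x y z : inner z (x - y) = inner z x - inner z y.
Proof. by rewrite linearBr. Qed.

Lemma inner0l x : inner 0 x = 0. Proof. by rewrite linear0l. Qed.
Lemma inner0r x : inner x 0 = 0. Proof. by rewrite linear0r. Qed.

Lemma inner_sumr (T : Type) (s : seq T) P (F : T -> H) x :
  inner x (\sum_(i <- s | P i) F i) = \sum_(i <- s | P i) inner x (F i).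
Proof. by rewrite linear_sumr. Qed.

Lemma inner_suml (T : Type) (s : seq T) P (F : T -> H) x :
  inner (\sum_(i <- s | P i) F i) x = \sum_(i <- s | P i) inner (F i) x.
Proof. by rewrite linear_sumlz. Qed.

Lemma innerxx_eq0 x : inner x x = 0 -> x = 0.
Proof. by rewrite -sqr_norm_inner => /eqP; rewrite sqrf_eq0 normr_eq0 => /eqP. Qed.

Lemma inner_ext x y : (forall z, inner x z = inner y z) -> x = y.
Proof.
move=> xy; apply/eqP; rewrite -subr_eq0; apply/eqP/innerxx_eq0.
by rewrite innerBl xy subrr.
Qed.

Lemma inner_eq0C x y : inner x y = 0 -> inner y x = 0.
Proof. by move=> xy; rewrite innerC xy rmorph0. Qed.

Lemma inner_CauchySchwarz x y : `|inner x y| <= `|x| * `|y|.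
Proof.
have dn z : dot_norm (@inner R H) z = `|z|.
  by apply/eqP; rewrite -(@eqrXn2 _ 2%N)// ?dot_norm_ge0// dot_normK sqr_norm_inner.
by rewrite -!dn dot_CauchySchwarz.
Qed.

Lemma sqr_normD x y :
  `|x + y| ^+ 2 = `|x| ^+ 2 + `|y| ^+ 2 + (inner x y + (inner x y)^*).
Proof. by rewrite !sqr_norm_inner innerDl !innerDr (innerC y x); ring. Qed.

Lemma sqr_normB x y :
  `|x - y| ^+ 2 = `|x| ^+ 2 + `|y| ^+ 2 - (inner x y + (inner x y)^*).
Proof. by rewrite !sqr_norm_inner innerBl !innerBr (innerC y x); ring. Qed.

Lemma parallelogram x y :
  `|x + y| ^+ 2 + `|x - y| ^+ 2 = 2 * `|x| ^+ 2 + 2 * `|y| ^+ 2.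
Proof. by rewrite sqr_normD sqr_normB; ring. Qed.

End InnerProduct.

(** * Bounded operators and the projection theorem *)

Section BoundedOperators.
Variable R : realType.
Implicit Types H K L : hilbertType R.

(** Operators are bare functions here; bundling one with a proof of its linearity
    makes the general lemmas on linear maps apply. *)
Definition linear_pack H K (V : H -> K) (Vl : linear V) : {linear H -> K} :=
  HB.pack V (GRing.isLinear.Build R[i] H K *:%R V Vl).

Lemma bounded_opP H K (V : H -> K) : bounded_op V <->
  linear V /\ exists2 C, 0 <= C & forall x, `|V x| <= C * `|x|.
Proof.
split=> [[Vl Vc]|[Vl [C C0 VC]]]; split=> //.
  have /continuous_linear_bounded : {for 0, continuous (linear_pack Vl)} by exact: Vc.
  move=> /(_ 0)/linear_boundedP/pinfty_ex_gt0[C C0 VC].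
  by exists C => //; exact: ltW.
apply: (@bounded_linear_continuous _ _ _ (linear_pack Vl)).
apply/ex_bound; exists C; apply/nbhs_norm0P; exists 1 => //= x /= x1.
by apply: le_trans (VC x) _; rewrite ler_piMr // ltW.
Qed.

Section Linear.
Variables (H K : hilbertType R) (V : H -> K) (Vb : bounded_op V).

Lemma blinear : linear V. Proof. by case: Vb. Qed.
Lemma blinP a x y : V (a *: x + y) = a *: V x + V y.
Proof. exact: blinear. Qed.
Lemma blin0 : V 0 = 0. Proof. exact: (linear0 (linear_pack blinear)). Qed.
Lemma blinD x y : V (x + y) = V x + V y.
Proof. exact: (linearD (linear_pack blinear)). Qed.
Lemma blinB x y : V (x - y) = V x - V y.
Proof. exact: (linearB (linear_pack blinear)). Qed.
Lemma blinZ a x : V (a *: x) = a *: V x.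
Proof. exact: (linearZ_LR (linear_pack blinear)). Qed.
Lemma blin_sum (T : Type) (s : seq T) P (F : T -> H) :
  V (\sum_(i <- s | P i) F i) = \sum_(i <- s | P i) V (F i).
Proof. exact: (linear_sum (linear_pack blinear)). Qed.
Lemma bop_bound : exists2 C, 0 <= C & forall x, `|V x| <= C * `|x|.
Proof. by have /bounded_opP[] := Vb. Qed.

End Linear.

Lemma bounded_op_id H : bounded_op (@id H).
Proof. by split=> [|x]; [move=> a x y|exact: cvg_id]. Qed.

Lemma bounded_op_comp H K L (A : K -> L) (B : H -> K) :
  bounded_op A -> bounded_op B -> bounded_op (A \o B).
Proof.
move=> /bounded_opP[Al [C C0 AC]] /bounded_opP[Bl [C' C'0 BC]].
apply/bounded_opP; split; first by move=> a x y /=; rewrite Bl Al.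
exists (C * C') => [|x]; first exact: mulr_ge0.
by rewrite -mulrA; apply: le_trans (AC _) _; rewrite ler_wpM2l.
Qed.

Lemma bounded_op_iter H (A : H -> H) k : bounded_op A -> bounded_op (iter k A).
Proof.
move=> Ab; elim: k => [|k IH]; first exact: bounded_op_id.
exact: bounded_op_comp Ab IH.
Qed.

Lemma bounded_op_add H K (A B : H -> K) :
  bounded_op A -> bounded_op B -> bounded_op (fun x => A x + B x).
Proof.
move=> [Al Ac] [Bl Bc]; split.
  by move=> a x y; rewrite Al Bl scalerDr addrACA.
by move=> x; apply: cvgD; [exact: Ac|exact: Bc].
Qed.

Lemma bounded_op_scale H K a (A : H -> K) :
  bounded_op A -> bounded_op (fun x => a *: A x).
Proof.
move=> /bounded_opP[Al [C C0 AC]]; apply/bounded_opP; split.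
  by move=> b x y; rewrite Al scalerDr !scalerA mulrC.
by exists (`|a| * C) => [|x]; rewrite ?mulr_ge0// normrZ -mulrA ler_wpM2l.
Qed.

Lemma bounded_op_sub H K (A B : H -> K) :
  bounded_op A -> bounded_op B -> bounded_op (fun x => A x - B x).
Proof.
move=> Ab Bb; rewrite (_ : (fun x => _) = (fun x => A x + (-1) *: B x)).
  by apply: bounded_op_add => //; exact: bounded_op_scale.
by apply/funext => x; rewrite scaleN1r.
Qed.

End BoundedOperators.

Section ClosedSubspaces.
Variables (R : realType) (H : hilbertType R).
Implicit Types (L : set H) (x y z : H).

Lemma closed_subspace_approx L x : closed_subspace L ->
  (forall e : R[i], 0 < e -> exists2 y, L y & `|x - y| < e) -> L x.
Proof.
move=> [Lc _ _] Lx; apply: Lc => B /nbhs_normP[e /= e0 eB].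
by have [y Ly xy] := Lx _ e0; exists y; split => //; exact: eB.
Qed.

(** Completeness in the form used below: a map into the space that is Cauchy along
    a filter converges, whatever the source of the map. *)
Lemma complete_filter (T : Type) (F : set_system T) (FF : ProperFilter F)
    (f : T -> H) :
  (forall e : R[i], 0 < e -> exists2 P, F P &
    forall s t, P s -> P t -> `|f s - f t| < e) ->
  exists l : H, f @ F --> l.
Proof.
move=> Fc; apply/cvg_ex; apply: cauchy_cvg; apply/cauchy_ballP => e e0.
have [P FP Pe] := Fc _ e0.
have fP : F (f @^-1` (f @` P)) by apply: filterS FP => t Pt; exists t.
exists (f @` P, f @` P) => //.
by move=> [_ _] /= [[s Ps <-] [t Pt <-]]; rewrite -ball_normE /ball_/=; exact: Pe.
Qed.

(** The orthogonal complement of an arbitrary subset. *)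
Definition oc L : set H := [set x | forall y, L y -> inner x y = 0].

Lemma inner_eq0_closed y : closed_subspace [set x | inner x y = 0].
Proof.
split.
- move=> x xcl /=; apply/eqP; apply/negPn/negP => xy0.
  have y0 : 0 < `|y|.
    by rewrite normr_gt0; apply: contraNneq xy0 => ->; rewrite inner0r.
  have e0 : 0 < `|inner x y| / `|y| by rewrite divr_gt0// normr_gt0.
  have [z /= [zy xz]] := xcl _ (nbhsx_ballx x _ e0).
  move: xz; rewrite -ball_normE /ball_/= => xz.
  have := inner_CauchySchwarz (x - z) y; rewrite innerBl zy subr0 => h.
  by move: xz; rewrite ltr_pdivlMr// => /(le_lt_trans h); rewrite ltxx.
- by rewrite /= inner0l.
- by move=> a x z /= xy zy; rewrite innerDl innerZl xy zy mulr0 addr0.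
Qed.

Lemma closed_subspace_bigcap (T : Type) (D : set T) (F : T -> set H) :
  (forall t, D t -> closed_subspace (F t)) ->
  closed_subspace (\bigcap_(t in D) F t).
Proof.
move=> Fc; split.
- by apply: closed_bigI => t /Fc[].
- by move=> t /Fc[].
- by move=> a x y Fx Fy t Dt; have [_ _] := Fc t Dt; apply; [exact: Fx|exact: Fy].
Qed.

Lemma oc_closed L : closed_subspace (oc L).
Proof.
have -> : oc L = \bigcap_(y in L) [set x | inner x y = 0] by [].
by apply: closed_subspace_bigcap => y _; exact: inner_eq0_closed.
Qed.

Lemma gec0_Re (z : R[i]) : 0 <= z -> z = (complex.Re z)%:C%C.
Proof. by case: z => a b; rewrite lecE/= => /andP[/eqP -> _]. Qed.

(** The vectors of L that nearly minimize the distance to x form a Cauchy filter,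
    by the parallelogram law; its limit y is a minimizer, and perturbing y along
    a vector z of L shows that x - y is orthogonal to z. *)
Theorem projection L x : closed_subspace L ->
  exists2 y, L y & forall z, L z -> inner (x - y) z = 0.
Proof.
move=> Lc; have [_ L0 Llin] := Lc.
pose q y := complex.Re (`|x - y| ^+ 2).
have qE y : `|x - y| ^+ 2 = (q y)%:C%C by apply: gec0_Re; rewrite exprn_ge0.
have q_ge0 y : 0 <= q y by rewrite -lecR -qE exprn_ge0.
have infS : has_inf (q @` L).
  by split; [exists (q 0), 0|exists 0 => _ [y _ <-]].
pose d := inf (q @` L).
have d_le y : L y -> d <= q y by move=> Ly; apply: inf_lbound; [case: infS|exists y].
pose F := filter_from [set e : R | 0 < e] (fun e => [set y | L y /\ q y < d + e]).
have FF : ProperFilter F.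
  apply: filter_from_proper => [|e e0].
    apply: filter_from_filter; first by exists 1 => /=.
    move=> e1 e2 /= e10 e20; exists (Num.min e1 e2) => /=.
      by rewrite lt_min e10.
    move=> y [Ly qy]; split; split=> //; apply: lt_le_trans qy _;
    by rewrite lerD2l ge_min lexx ?orbT.
  by have [_ [y Ly <-] qy] := inf_adherent e0 infS; exists y.
have para y z : L y -> L z -> `|y - z| ^+ 2 <= (2 * q y + 2 * q z - 4 * d)%:C%C.
  move=> Ly Lz; have := parallelogram (x - y) (x - z).
  have -> : x - y - (x - z) = - (y - z) by rewrite opprB addrC addrA subrK opprB.
  have -> : x - y + (x - z) = 2 *: (x - 2^-1 *: (y + z)).
    rewrite scalerBr scalerA mulfV ?pnatr_eq0// scale1r addrACA -opprD.
    by rewrite scaler_nat mulr2n.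
  rewrite normrN normrZ exprMn !qE.
  have -> : `|2 : R[i]| ^+ 2 = 4%:R by rewrite ger0_norm// -natrX.
  move=> h.
  have -> : `|y - z| ^+ 2 = (2 * q y + 2 * q z - 4 * q (2^-1 *: (y + z)))%:C%C.
    rewrite rmorphB rmorphD !rmorphM !rmorph_nat/=.
    apply: (addrI (4 * (q (2^-1 *: (y + z)))%:C%C)); rewrite [LHS]h; ring.
  rewrite lecR lerD2l lerN2 ler_wpM2l// d_le// -[_ *: _]addr0; apply: (Llin) => //.
  by rewrite -[y]scale1r; apply: Llin.
have [y Fy] : exists y : H, id @ F --> y.
  apply: complete_filter => e /gtc0_Re[e0 ->].
  set r := complex.Re e in e0 *.
  exists [set y | L y /\ q y < d + r ^+ 2 / 8].
    by exists (r ^+ 2 / 8) => //=; rewrite divr_gt0// exprn_gt0.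
  move=> s t /= [Ls qs] [Lt qt].
  rewrite -(@ltr_pXn2r _ 2%N)// ?nnegrE ?lecR ?(ltW e0)//.
  have r20 : 0 < r ^+ 2 by rewrite exprn_gt0.
  apply: le_lt_trans (para _ _ Ls Lt) _; rewrite -rmorphXn ltcR; lra.
have Ly : L y.
  apply: (closed_subspace_approx Lc) => e e0.
  move/cvgrPdist_lt : Fy => /(_ _ e0) Fe.
  have FL : F L by exists 1 => //= z [].
  by have [z [Lz yz]] := filter_ex (filterI FL Fe); exists z.
have qy : q y <= d.
  rewrite leNgt; apply/negP => dq.
  pose r := Num.sqrt (q y) - Num.sqrt d.
  have d0 : 0 <= d by apply: lb_le_inf; [case: infS|move=> _ [z _ <-]].
  have r0 : 0 < r by rewrite subr_gt0 ltr_sqrt// (le_lt_trans d0).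
  have r0C : 0 < (r / 2)%:C%C by rewrite ltcR divr_gt0.
  move/cvgrPdist_lt : Fy => /(_ _ r0C) Fe.
  have Fd : F [set z | L z /\ q z < d + (Num.sqrt d * r + r ^+2/4)].
    exists (Num.sqrt d * r + r ^+2/4) => //=.
    by rewrite ltr_wpDl ?mulr_ge0 ?divr_gt0 ?exprn_gt0 ?sqrtr_ge0 ?(ltW r0).
  have [z [/= [Lz qz] yz]] := filter_ex (filterI Fd Fe).
  have xz : `|x - z| < (Num.sqrt d + r / 2)%:C%C.
    rewrite -(@ltr_pXn2r _ 2%N)// ?nnegrE ?lecR ?addr_ge0 ?sqrtr_ge0 ?divr_ge0 ?(ltW r0)//.
    rewrite qE -rmorphXn ltcR; apply: lt_le_trans qz _.
    have -> : (Num.sqrt d + r / 2) ^+ 2 = d + (Num.sqrt d * r + r ^+ 2 / 4).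
      by rewrite sqrrD sqr_sqrtr//; field.
    by [].
  have xy : `|x - y| < (Num.sqrt (q y))%:C%C.
    rewrite -(subrK z x) -addrA; apply: le_lt_trans (ler_normD _ _) _.
    have -> : Num.sqrt (q y) = (Num.sqrt d + r / 2) + r / 2 by rewrite /r; lra.
    by rewrite rmorphD ltrD// distrC.
  move: xy; rewrite -(@ltr_pXn2r _ 2%N)// ?nnegrE ?lecR ?sqrtr_ge0//.
  by rewrite qE -rmorphXn ltcR sqr_sqrtr ?ltxx.
exists y => // z Lz.
have [->|z0] := eqVneq z 0; first by rewrite inner0r.
have zz0 : 0 < inner z z by rewrite dnorm_gt0.
(* Among the y + a z, the one closest to x. *)
pose a := inner (x - y) z / inner z z.
have Lw : L (a *: z + y) by exact: Llin.
have zJ : (inner z z)^* = inner z z by rewrite -innerC.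
have : `|x - (a *: z + y)| ^+ 2 = `|x - y| ^+ 2 - `|inner (x - y) z| ^+ 2 / inner z z.
  have -> : x - (a *: z + y) = (x - y) - a *: z by rewrite opprD addrA addrAC.
  rewrite sqr_normB normrZ exprMn innerZr.
  rewrite (sqr_norm_inner z) /a.
  rewrite !normCK !(rmorphM, fmorphV)/= ?conjCK !zJ; field; exact: lt0r_neq0.
have : `|x - y| ^+ 2 <= `|x - (a *: z + y)| ^+ 2.
  by rewrite !qE lecR (le_trans qy)// d_le.
move=> /[swap] ->; rewrite lerBrDr gerDl => h.
apply/eqP; rewrite -normr_eq0 -sqrf_eq0 eq_le exprn_ge0// andbT.
by move: h; rewrite pmulr_lle0// invr_gt0.
Qed.

Lemma oc_trivial L : closed_subspace L -> oc L `<=` [set 0] -> L = setT.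
Proof.
move=> Lc L0; apply/seteqP; split=> // x _.
have [y Ly xy] := projection x Lc.
suff /eqP : x - y = 0 by rewrite subr_eq0 => /eqP ->.
exact: (L0 (x - y)).
Qed.

End ClosedSubspaces.

(** * Adjoints, unitaries and partial isometries *)

Section Adjoint.
Variable R : realType.
Implicit Types H K L : hilbertType R.

(** A vector u orthogonal to the kernel of f represents f up to a factor, because
    x - (f x / f u) u is in that kernel. *)
Lemma riesz H (f : H -> R[i]) (C : R[i]) :
  (forall a x y, f (a *: x + y) = a * f x + f y) ->
  (forall x, `|f x| <= C * `|x|) -> exists w, forall x, f x = inner x w.
Proof.
move=> fl fC.
have f0 : f 0 = 0.
  by apply/eqP; rewrite -normr_le0 (le_trans (fC 0))// normr0 mulr0.
have [[x0 fx0]|/forallNP f00] := pselect (exists x, f x != 0); last first.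
  by exists 0 => x; rewrite inner0r; apply: contrapT => /eqP /f00.
have C0 : 0 < C.
  have x00 : x0 != 0 by apply: contraNneq fx0 => ->; rewrite f0.
  by rewrite -(@pmulr_lgt0 _ `|x0|) ?normr_gt0// (lt_le_trans _ (fC x0))// normr_gt0.
have fZ a x : f (a *: x) = a * f x by rewrite -[a *: x]addr0 fl f0 addr0.
have fB x y : f (x - y) = f x - f y by rewrite addrC -scaleN1r fl mulN1r addrC.
have Lc : closed_subspace [set x | f x = 0].
  split=> //; last by move=> a x y /= fx fy; rewrite fl fx fy mulr0 addr0.
  move=> x xcl /=; apply/eqP; apply/negPn/negP => fx0'.
  have e0 : 0 < `|f x| / C by rewrite divr_gt0// normr_gt0.
  have [z /= [fz]] := xcl _ (nbhsx_ballx x _ e0).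
  rewrite -ball_normE /ball_/= ltr_pdivlMr// mulrC => xz.
  by have := fC (x - z); rewrite fB fz subr0 => /le_lt_trans/(_ xz); rewrite ltxx.
have [y fy xy] := projection x0 Lc.
pose u := x0 - y.
have fu : f u != 0 by rewrite fB fy subr0.
have u0 : 0 < inner u u by rewrite dnorm_gt0; apply: contraNneq fu => ->; rewrite f0.
exists ((f u / inner u u)^* *: u) => x.
have : f (x - (f x / f u) *: u) = 0 by rewrite fB fZ divfK// subrr.
move/xy => /inner_eq0C; rewrite innerBl innerZl => /eqP; rewrite subr_eq0 => /eqP h.
rewrite innerZr conjCK h; move: (f x) (f u) fu (inner u u) (lt0r_neq0 u0) => c a a0 b b0.
by field; rewrite a0 b0.
Qed.

Lemma adjoint_exists H K (V : H -> K) : bounded_op V ->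
  exists W : K -> H, forall x y, inner (V x) y = inner x (W y).
Proof.
move=> Vb; have [C C0 VC] := bop_bound Vb.
suff /choice[W WP] : forall y, exists w, forall x, inner (V x) y = inner x w.
  by exists W => x y; exact: WP.
move=> y; apply: (@riesz _ (fun x => inner (V x) y) (C * `|y|)) => [a x x'|x].
  by rewrite blinP// innerDl innerZl.
apply: le_trans (inner_CauchySchwarz _ _) _.
by rewrite mulrAC ler_wpM2r.
Qed.

Section AdjointTheory.
Variables (H K : hilbertType R) (V : H -> K).
Hypothesis Vb : bounded_op V.

Lemma adjP x y : inner (V x) y = inner x (adjoint V y).
Proof.
rewrite /adjoint; case: xgetP => [W _|/(_ _)]; first exact.
by have [W WP] := adjoint_exists Vb; move=> /(_ W).
Qed.

Lemma adjP' x y : inner (adjoint V y) x = inner y (V x).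
Proof. by rewrite innerC -adjP -innerC. Qed.

Lemma adjE W : (forall x y, inner (V x) y = inner x (W y)) -> adjoint V = W.
Proof.
move=> VW; apply/funext => y; apply: inner_ext => x.
by rewrite innerC -adjP VW -innerC.
Qed.

Lemma norm_adj_le C : 0 <= C -> (forall x, `|V x| <= C * `|x|) ->
  forall y, `|adjoint V y| <= C * `|y|.
Proof.
move=> C0 VC y.
have [->|Wy0] := eqVneq (adjoint V y) 0; first by rewrite normr0 mulr_ge0.
have Wy : 0 < `|adjoint V y| by rewrite normr_gt0.
rewrite -(ler_pM2r Wy) -expr2 sqr_norm_inner adjP'.
have -> : inner y (V (adjoint V y)) = `|inner y (V (adjoint V y))|.
  by rewrite ger0_norm// -adjP' -sqr_norm_inner exprn_ge0.
apply: le_trans (inner_CauchySchwarz _ _) _.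
by rewrite mulrC mulrAC ler_wpM2r.
Qed.

Lemma adj_bounded : bounded_op (adjoint V).
Proof.
have [C C0 VC] := bop_bound Vb.
apply/bounded_opP; split; last by exists C => //; exact: norm_adj_le.
move=> a x y; apply: inner_ext => z.
by rewrite adjP' innerDl innerZl innerDl innerZl !adjP'.
Qed.

End AdjointTheory.

Lemma adjK H K (V : H -> K) : bounded_op V -> adjoint (adjoint V) = V.
Proof.
move=> Vb; apply: adjE; first exact: adj_bounded.
by move=> x y; rewrite adjP'.
Qed.

Lemma adj_comp H K L (A : K -> L) (B : H -> K) : bounded_op A -> bounded_op B ->
  adjoint (A \o B) = adjoint B \o adjoint A.
Proof.
move=> Ab Bb; apply: adjE; first exact: bounded_op_comp.
by move=> x y /=; rewrite adjP// adjP.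
Qed.

Lemma adj_id H : adjoint (@id H) = id.
Proof. by apply: adjE => //; exact: bounded_op_id. Qed.

Lemma adj_iter H (V : H -> H) k : bounded_op V ->
  adjoint (iter k V) = iter k (adjoint V).
Proof.
move=> Vb; elim: k => [|k IH]; first exact: adj_id.
transitivity (adjoint (V \o iter k V)); first by [].
rewrite adj_comp//; last exact: bounded_op_iter.
by rewrite IH; apply/funext => x /=; rewrite -iterSr.
Qed.

Lemma bounded_op_scalar H (a : R[i]) : bounded_op (@scalar_op R H a).
Proof. by apply: (bounded_op_scale a); exact: bounded_op_id. Qed.

Lemma adj_scalar H (a : R[i]) : adjoint (@scalar_op R H a) = @scalar_op R H a^*.
Proof.
apply: adjE; first exact: bounded_op_scalar.
by move=> x y; rewrite /scalar_op innerZl innerZr conjCK.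
Qed.

Lemma norm_isometry H K (V : H -> K) : bounded_op V ->
  (forall x, adjoint V (V x) = x) -> forall x, `|V x| = `|x|.
Proof.
move=> Vb VV x; apply/eqP; rewrite -(@eqrXn2 _ 2%N)//.
by rewrite !sqr_norm_inner adjP// VV.
Qed.

Lemma ker_closed H K (V : H -> K) : bounded_op V ->
  closed_subspace [set x | V x = 0].
Proof.
move=> Vb; rewrite (_ : [set x | _] = oc (range (adjoint V))).
  exact: oc_closed.
apply/seteqP; split=> x /=.
  by move=> Vx _ [y _ <-]; rewrite -adjP// Vx inner0l.
move=> h; apply: inner_ext => z; rewrite adjP// inner0l.
by apply: h; exists z.
Qed.

Lemma unitaryP H K (Z : H -> K) : unitary Z <->
  [/\ bounded_op Z, forall x, adjoint Z (Z x) = x &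
      forall y, Z (adjoint Z y) = y].
Proof.
split=> -[Zb ZZ ZZ']; split=> //; last 2 first.
- by apply/funext.
- by apply/funext.
- by move=> x; rewrite -[LHS]/((adjoint Z \o Z) x) ZZ.
- by move=> x; rewrite -[LHS]/((Z \o adjoint Z) x) ZZ'.
Qed.

Lemma unitary_adj H K (Z : H -> K) : unitary Z -> unitary (adjoint Z).
Proof. by move=> [Zb Z1 Z2]; split; rewrite ?adjK//; exact: adj_bounded. Qed.

Lemma unitary_comp H K L (A : K -> L) (B : H -> K) :
  unitary A -> unitary B -> unitary (A \o B).
Proof.
move=> /unitaryP[Ab A1 A2] /unitaryP[Bb B1 B2]; apply/unitaryP; split.
- exact: bounded_op_comp.
- by move=> x; rewrite adj_comp//= A1.
- by move=> x; rewrite adj_comp//= B2.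
Qed.

Lemma unitary_id H : unitary (@id H).
Proof. by apply/unitaryP; split; rewrite ?adj_id//; exact: bounded_op_id. Qed.

(** Operators that agree on a set with trivial orthogonal complement are equal:
    the adjoint of their difference has its range in that complement. *)
Lemma eq_bounded_op H K (A B : H -> K) (X : set H) :
  bounded_op A -> bounded_op B -> oc X `<=` [set 0] ->
  (forall x, X x -> A x = B x) -> A = B.
Proof.
move=> Ab Bb X0 AB; pose D := fun x => A x - B x.
have Db : bounded_op D by exact: bounded_op_sub.
apply/funext => x; apply/eqP; rewrite -subr_eq0; apply/eqP.
apply: innerxx_eq0; rewrite -/(D x) adjP// -[RHS](inner0r x); congr (inner _ _).
by apply: X0 => y Xy; rewrite adjP'// [D y]/D AB// subrr inner0r.
Qed.

End Adjoint.

Section PartialIsometries.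
Variables (R : realType) (H : hilbertType R).
Implicit Types V : H -> H.

(** Decompose along the kernel N of V.  If V is isometric on the complement of N,
    then for y in this complement V* V y has norm at most that of y and the same
    inner product with y as y itself, so V* V y = y.  Conversely V V* V = V says
    that V* V x - x is in N for every x. *)
Lemma partial_isometryP V : partial_isometry V <->
  bounded_op V /\ forall x, V (adjoint V (V x)) = V x.
Proof.
split=> -[Vb VP]; split=> //.
  pose N := [set x | V x = 0].
  have isoN y : oc N y -> `|V y| = `|y| by move=> yN; apply: VP => z; apply: yN.
  have dec x : exists2 y, oc N y & V x = V y /\ `|y| <= `|x|.
    have [k /= Vk xk] := projection x (ker_closed Vb).
    exists (x - k); first exact: xk.
    rewrite blinB// Vk subr0; split=> //.
    rewrite -ler_sqr ?nnegrE//; have := sqr_normD (x - k) k.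
    by rewrite subrK xk// rmorph0 !addr0 => ->; rewrite lerDl exprn_ge0.
  have V1 x : `|V x| <= 1 * `|x|.
    by have [y /isoN yN [-> yx]] := dec x; rewrite yN mul1r.
  move=> x; have [y yN [-> _]] := dec x.
  suff -> : adjoint V (V y) = y by [].
  apply/eqP; rewrite -subr_eq0 -normr_eq0 -sqrf_eq0 eq_le exprn_ge0// andbT.
  rewrite sqr_normB adjP'// -sqr_norm_inner.
  have -> : (`|V y| ^+ 2)^* = `|V y| ^+ 2 by rewrite geC0_conj// exprn_ge0.
  rewrite (isoN _ yN) opprD addrA addrK subr_le0 ler_sqr ?nnegrE//.
  by have := norm_adj_le Vb ler01 V1 (V y); rewrite mul1r isoN.
move=> x xN; apply/eqP; rewrite -(@eqrXn2 _ 2%N)//.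
rewrite !sqr_norm_inner adjP//; apply/eqP; congr (inner _ _).
apply/eqP; rewrite -subr_eq0; apply/eqP.
set d := _ - _; have Vd : V d = 0 by rewrite blinB// VP subrr.
apply: innerxx_eq0; rewrite {1}/d innerBl adjP'// Vd inner0r sub0r.
by rewrite xN// oppr0.
Qed.

Lemma orth_projP (L : set H) : closed_subspace L ->
  forall x, L (orth_proj L x) /\
    forall y, L y -> inner (x - orth_proj L x) y = 0.
Proof.
move=> Lc; rewrite /orth_proj; case: xgetP => [P _|/(_ _)]; first exact.
suff /choice[P PP] : forall x, exists y, L y /\ forall z, L z -> inner (x - y) z = 0.
  by move=> /(_ P) [].
by move=> x; have [y Ly xy] := projection x Lc; exists y.
Qed.

Lemma orth_proj_id (L : set H) x : closed_subspace L -> L x -> orth_proj L x = x.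
Proof.
move=> Lc Lx; have [Ly h] := orth_projP Lc x; have [_ _ Ll] := Lc.
apply/esym/eqP; rewrite -subr_eq0; apply/eqP/innerxx_eq0; apply: h.
by rewrite addrC -scaleN1r; apply: Ll.
Qed.

End PartialIsometries.

(** * A square root by monotone iteration *)

Section SquareRoot.
Variables (R : realType) (H : hilbertType R) (X : H -> H).
Hypotheses (Xb : bounded_op X) (X1 : forall x, `|X x| <= `|x|).

(** Solves 2 Y = X + Y^2 from the start 0.  Every iterate is a polynomial in X with
    nonnegative coefficients, so the same iteration for the number 1 in place of
    X, [sqrt_majorant], controls the norms of the iterates and of their
    differences. *)
Fixpoint sqrt_iter n (x : H) : H :=
  if n is n'.+1 then 2^-1 *: (X x + sqrt_iter n' (sqrt_iter n' x)) else 0.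

Fixpoint sqrt_majorant n : R :=
  if n is n'.+1 then 2^-1 * (1 + sqrt_majorant n' ^+ 2) else 0.

Let Y := sqrt_iter.
Let r := sqrt_majorant.

Lemma sqrt_iter_bounded n : bounded_op (Y n).
Proof.
elim: n => [|n IH].
  apply/bounded_opP; split => [a x y|]; first by rewrite /= scaler0 addr0.
  by exists 0 => // x; rewrite normr0 mul0r.
apply: bounded_op_scale; apply: bounded_op_add => //.
exact: (bounded_op_comp IH IH).
Qed.

Lemma sqrt_iter_commute B : bounded_op B -> (forall x, B (X x) = X (B x)) ->
  forall n x, B (Y n x) = Y n (B x).
Proof.
move=> Bb BX; elim=> [|n IH] x; first by rewrite (blin0 Bb).
by rewrite [Y _]/= (blinZ Bb) (blinD Bb) BX !IH.
Qed.

Lemma sqrt_majorant_bounds n : 0 <= r n <= 1.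
Proof.
elim: n => [|n]; first by rewrite lexx ler01.
rewrite [r n.+1]/= -/(r n) => /andP[r0 r1]; apply/andP; split; nra.
Qed.

Lemma sqrt_majorant_nondecreasing n : r n <= r n.+1.
Proof. by have /andP[r0 r1] := sqrt_majorant_bounds n; rewrite {2}/r/= -/(r n); nra. Qed.

Lemma sqrt_iter_le n x : `|Y n x| <= (r n)%:C%C * `|x|.
Proof.
elim: n x => [|n IH] x; first by rewrite /= normr0 rmorph0 mul0r.
have -> : (r n.+1)%:C%C = 2^-1 * (1 + (r n)%:C%C ^+ 2) :> R[i].
  by rewrite /= rmorphM rmorphD rmorphXn rmorph1 fmorphV rmorph_nat.
rewrite [Y _ _]/= normrZ ger0_norm ?invr_ge0// -mulrA ler_wpM2l ?invr_ge0//.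
apply: le_trans (ler_normD _ _) _; rewrite mulrDl mul1r lerD//.
apply: le_trans (IH _) _; rewrite expr2 -mulrA ler_wpM2l// lecR.
by have /andP[] := sqrt_majorant_bounds n.
Qed.

(** The iterates commute, so the difference of two squares factors. *)
Lemma sqrt_iter_step n x :
  `|Y n.+1 x - Y n x| <= (r n.+1 - r n)%:C%C * `|x|.
Proof.
elim: n x => [|n IH] x.
  by have := sqrt_iter_le 1 x; rewrite !subr0.
have Yb := sqrt_iter_bounded.
have YX m z : Y m (X z) = X (Y m z) by rewrite (sqrt_iter_commute Xb).
have YY m k z : Y m (Y k z) = Y k (Y m z).
  by rewrite (sqrt_iter_commute (Yb m)).
have -> : Y n.+2 x - Y n.+1 x =
    2^-1 *: (Y n.+1 (Y n.+1 x - Y n x) + Y n (Y n.+1 x - Y n x)).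
  rewrite [LHS](_ : _ = 2^-1 *: (X x + Y n.+1 (Y n.+1 x)) -
    2^-1 *: (X x + Y n (Y n x)))// -scalerBr !(blinB (Yb _)) (YY n n.+1 x).
  by rewrite addrA subrK opprD addrACA subrr add0r.
have -> : (r n.+2 - r n.+1)%:C%C =
    2^-1 * ((r n.+1)%:C%C + (r n)%:C%C) * (r n.+1 - r n)%:C%C :> R[i].
  rewrite -rmorphD -(rmorph_nat (real_complex R) 2) -fmorphV -!rmorphM.
  congr (_%:C)%C; rewrite (_ : r n.+2 = 2^-1 * (1 + r n.+1 ^+ 2))//.
  by rewrite (_ : r n.+1 = 2^-1 * (1 + r n ^+ 2))//; field.
rewrite normrZ ger0_norm ?invr_ge0// -!mulrA ler_wpM2l ?invr_ge0//.
apply: le_trans (ler_normD _ _) _; rewrite mulrDl lerD//;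
  apply: le_trans (sqrt_iter_le _ _) _; rewrite ler_wpM2l// lecR;
  by have /andP[] := sqrt_majorant_bounds n; have /andP[] := sqrt_majorant_bounds n.+1.
Qed.

Lemma sqrt_iter_cauchy m n x : (m <= n)%N ->
  `|Y n x - Y m x| <= (r n - r m)%:C%C * `|x|.
Proof.
move=> /subnK <-; elim: (n - m)%N => [|k IH]; first by rewrite !subrr normr0 rmorph0 mul0r.
rewrite addSn -(subrK (Y (k + m) x) (Y _ x)) -addrA.
apply: le_trans (ler_normD _ _) _.
rewrite -(subrK (r (k + m)) (r _.+1)) -addrA rmorphD mulrDl lerD//.
exact: sqrt_iter_step.
Qed.

Lemma sqrt_iter_cvg x : exists l : H, (Y ^~ x) @ \oo --> l.
Proof.
have rc : cvgn r.
  apply: nondecreasing_is_cvgn.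
    by apply/nondecreasing_seqP; exact: sqrt_majorant_nondecreasing.
  by exists 1 => _ [n _ <-]; have /andP[] := sqrt_majorant_bounds n.
apply: complete_filter.
move=> e /gtc0_Re[e0 ->]; set e' := complex.Re e in e0 *.
have nx0 : 0 <= complex.Re `|x| by rewrite -lecR -gec0_Re ?normr_ge0.
pose d := e' / (complex.Re `|x| + 1).
have d0 : 0 < d by rewrite divr_gt0// ltr_wpDl.
move/cvg_ex : rc => [l /cvgrPdist_lt/(_ (d / 2))].
rewrite divr_gt0// => /(_ isT) rl.
exists [set n | `|l - r n| < d / 2] => // s t /= ls lt.
suff wl s' t' : (s' <= t')%N -> `|l - r s'| < d / 2 -> `|l - r t'| < d / 2 ->
    `|Y t' x - Y s' x| < e'%:C%C.
  by case/orP: (leq_total s t) => st; [rewrite distrC|]; exact: wl.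
move=> st ls' lt'; apply: le_lt_trans (sqrt_iter_cauchy x st) _.
rewrite (gec0_Re (normr_ge0 x)) -rmorphM ltcR.
have rd : r t' - r s' < d.
  by move: ls' lt'; rewrite !ltr_norml => /andP[? ?] /andP[? ?]; lra.
apply: (@le_lt_trans _ _ (d * complex.Re `|x|)); first by rewrite ler_wpM2r// ltW.
by rewrite /d mulrAC ltr_pdivrMr ?ltr_wpDl// ltr_pM2l// ltrDl.
Qed.

(** The limit Y of the iteration satisfies 2 Y = X + Y^2, that is,
    (1 - Y)^2 = 1 - X.  It has norm at most 1, hence the sign of 1 - Y, and it
    commutes with whatever commutes with X. *)
Lemma sqrt_one_minus : exists S : H -> H,
  [/\ bounded_op S,
      forall x, S (S x) = x - X x,
      forall x, 0 <= 'Re (inner (S x) x) &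
      forall B, bounded_op B -> (forall x, B (X x) = X (B x)) ->
        forall x, B (S x) = S (B x)].
Proof.
have /choice[Z YZ] := sqrt_iter_cvg.
have H0 := @norm_hausdorff R[i] H.
have Yb := sqrt_iter_bounded.
have Zl : linear Z.
  move=> a x y; apply: (cvg_unique H0 (YZ _)).
  rewrite (_ : Y^~ _ = (fun n => a *: Y n x + Y n y)); last first.
    by apply/funext => n; rewrite (blinP (Yb n)).
  by apply: cvgD => //; apply: cvgZl_tmp.
have Y1 n x : `|Y n x| <= `|x|.
  apply: le_trans (sqrt_iter_le _ _) _; rewrite ler_piMl// lecR.
  by have /andP[] := sqrt_majorant_bounds n.
have Z1 x : `|Z x| <= `|x|.
  apply/ler_addgt0Pr => e e0.
  have /cvgrPdist_lt/(_ _ e0)/filter_ex[n /= Zn] := YZ x.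
  rewrite -(subrK (Y n x) (Z x)); apply: le_trans (ler_normD _ _) _.
  by rewrite addrC lerD// ltW.
have Zb : bounded_op Z.
  by apply/bounded_opP; split=> //; exists 1 => // x; rewrite mul1r.
have ZZ x : Z x = 2^-1 *: (X x + Z (Z x)).
  have YSZ : (fun n => Y n.+1 x) @ \oo --> Z x by rewrite (cvg_shiftS (Y^~ x)).
  apply: (cvg_unique H0 YSZ).
  apply: cvgZl_tmp; apply: cvgD; first exact: cvg_cst.
  apply/cvgrPdist_le => e e0.
  have e20 : 0 < e / 2 by rewrite divr_gt0.
  have /cvgrPdist_lt/(_ _ e20) h1 := YZ x.
  have /cvgrPdist_lt/(_ _ e20) h2 := YZ (Z x).
  apply: filterS2 h1 h2 => n h1 h2 /=.
  rewrite -(subrK (Y n (Z x)) (Z (Z x))) -addrA -(blinB (Yb n)).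
  apply: le_trans (ler_normD _ _) _; rewrite [e]splitr lerD// ?(ltW h2)//.
  by apply: le_trans (Y1 _ _) _; exact: ltW.
exists (fun x => x - Z x); split.
- exact: bounded_op_sub (@bounded_op_id _ _) Zb.
- move=> x; rewrite (blinB Zb); have := ZZ x => /(congr1 (fun z => 2 *: z)).
  rewrite scalerA mulfV ?pnatr_eq0// scale1r scaler_nat mulr2n => h.
  have -> : X x = Z x + Z x - Z (Z x) by rewrite h addrK.
  by rewrite -[LHS]addrA -opprD addrA.
- move=> x; rewrite innerBl raddfB/= subr_ge0 -sqr_norm_inner.
  have -> : 'Re (`|x| ^+ 2) = `|x| ^+ 2 by apply/Creal_ReP; rewrite ger0_real ?exprn_ge0.
  apply: le_trans (_ : `|inner (Z x) x| <= _).
    by have [] := leif_Re_Creal (inner (Z x) x).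
  apply: le_trans (inner_CauchySchwarz _ _) _.
  by rewrite expr2 ler_wpM2r.
- move=> B Bb BX x; rewrite (blinB Bb); congr (_ - _).
  apply: (cvg_unique H0 _ (YZ _)).
  rewrite (_ : Y^~ _ = B \o (Y^~ x)).
    by apply: continuous_cvg => //; case: Bb => _ Bc; exact: Bc.
  by apply/funext => n /=; rewrite sqrt_iter_commute.
Qed.

End SquareRoot.

(** * Schur's lemma *)

Section Schur.
Variables (R : realType) (H : hilbertType R).
Implicit Types A B : H -> H.

(** When A commutes with a family and its adjoints, a hyperinvariant subspace of A
    reduces the family; this brings irreducibility to A alone. *)
Definition hyperinvariant A (L : set H) := forall B, bounded_op B ->
  (forall x, B (A x) = A (B x)) -> forall x, L x -> L (B x).

Definition hyper_irreducible A := forall L, closed_subspace L ->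
  hyperinvariant A L -> L = [set 0] \/ L = setT.

Definition selfadjoint A := forall x y, inner (A x) y = inner x (A y).

Lemma selfadjoint_real A x : selfadjoint A -> inner (A x) x \is Num.real.
Proof. by move=> As; apply/CrealP; rewrite -innerC As. Qed.

(** A square root S of A^2 in the double commutant of A gives (S - A)(S + A) = 0.
    The kernel of S - A is hyperinvariant: if it is everything, A = S >= 0; if it
    is 0, then S + A = 0 and A = - S <= 0. *)
Lemma selfadjoint_contraction_sign A : hyper_irreducible A -> bounded_op A ->
  selfadjoint A -> (forall x, `|A x| <= `|x|) ->
  (forall x, 0 <= inner (A x) x) \/ (forall x, inner (A x) x <= 0).
Proof.
move=> Airr Ab As A1.
(* X is a contraction, as |X x|^2 = |x|^2 - 2 |A x|^2 + |A (A x)|^2. *)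
pose X x := x - A (A x).
have Xb : bounded_op X.
  by apply: bounded_op_sub; [exact: bounded_op_id|exact: (bounded_op_comp Ab Ab)].
have X1 x : `|X x| <= `|x|.
  rewrite -ler_sqr ?nnegrE// sqr_normB.
  have -> : inner x (A (A x)) = `|A x| ^+ 2 by rewrite -As sqr_norm_inner.
  rewrite geC0_conj ?exprn_ge0// -addrA gerDl opprD addrA subr_le0.
  by rewrite lerBlDr ler_wpDr ?exprn_ge0// ler_sqr ?nnegrE.
have [S [Sb SS Sre SC]] := sqrt_one_minus Xb X1.
have AX x : A (X x) = X (A x) by rewrite /X (blinB Ab).
have SA x : A (S x) = S (A x) by exact: SC.
have SSA x : S (S x) = A (A x) by rewrite SS /X subKr.
have key x : S (S x + A x) - A (S x + A x) = 0.
  by rewrite (blinD Sb) (blinD Ab) SSA -SA (addrC (A (S x))) subrr.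
pose D x := S x - A x.
have Db : bounded_op D by exact: bounded_op_sub.
have Dh : hyperinvariant A [set x | D x = 0].
  move=> B Bb BA x /= Dx; have BX z : B (X z) = X (B z) by rewrite /X (blinB Bb) !BA.
  by rewrite /D -SC// -BA -(blinB Bb) -/(D x) Dx (blin0 Bb).
have [D0|DT] := Airr _ (ker_closed Db) Dh; [right|left] => x.
  have : [set x | D x = 0] (S x + A x) by exact: key.
  rewrite D0 /= => /eqP; rewrite addr_eq0 => /eqP Sx.
  have := Sre x; rewrite Sx linearNl raddfN/=.
  by rewrite (Creal_ReP _ (selfadjoint_real x As)) oppr_ge0.
have : [set x | D x = 0] x by rewrite DT.
move=> /= /eqP; rewrite subr_eq0 => /eqP Sx.
by have := Sre x; rewrite Sx (Creal_ReP _ (selfadjoint_real x As)).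
Qed.

Lemma selfadjoint_sign A : hyper_irreducible A -> bounded_op A ->
  selfadjoint A ->
  (forall x, 0 <= inner (A x) x) \/ (forall x, inner (A x) x <= 0).
Proof.
move=> Airr Ab As; have [C C0 AC] := bop_bound Ab.
pose c := (C + 1)^-1.
have C1 : 0 < C + 1 by rewrite ltr_wpDl.
have c0 : 0 < c by rewrite invr_gt0.
pose B x := c *: A x.
have cJ : c^* = c by rewrite geC0_conj// ltW.
have Bb : bounded_op B by exact: bounded_op_scale.
have Bs : selfadjoint B by move=> x y; rewrite innerZl innerZr cJ As.
have B1 x : `|B x| <= `|x|.
  rewrite normrZ gtr0_norm// ler_pdivrMl// (le_trans (AC x))// ler_wpM2r//.
  by rewrite lerDl.
have Birr : hyper_irreducible B.
  move=> L Lc Lh; apply: Airr => // E Eb EA x Lx; apply: (Lh) => // z.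
  by rewrite /B (blinZ Eb) EA.
by have [h|h] := selfadjoint_contraction_sign Birr Bb Bs B1; [left|right] => x;
  have := h x; rewrite innerZl ?pmulr_rge0 ?pmulr_rle0.
Qed.

(** At the vector x + A x the form takes the value 2 |A x|^2. *)
Lemma selfadjoint_zero A : bounded_op A -> selfadjoint A ->
  (forall x, inner (A x) x = 0) -> forall x, A x = 0.
Proof.
move=> Ab As A0 x; apply: innerxx_eq0.
have := A0 (x + A x); rewrite (blinD Ab) innerDl !innerDr !A0 add0r addr0.
rewrite [inner (A (A x)) x]As -mulr2n => /eqP; rewrite mulrn_eq0/=.
by move/eqP.
Qed.

(** A - t has a sign for every real t; the supremum m of the t with A >= t then
    satisfies both A >= m and A <= m. *)
Lemma selfadjoint_scalar A : hyper_irreducible A -> bounded_op A ->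
  selfadjoint A -> exists c : R[i], forall x, A x = c *: x.
Proof.
move=> Airr Ab As.
have [[x0 x00]|/forallNP H0] := pselect (exists x : H, x != 0); last first.
  exists 0 => x; rewrite scale0r; apply: contrapT => /eqP Ax0; exact: (H0 (A x)).
have [C C0 AC] := bop_bound Ab.
pose n (x : H) : R := complex.Re (`|x| ^+ 2).
pose q (x : H) : R := complex.Re (inner (A x) x).
have nE x : `|x| ^+ 2 = (n x)%:C%C by apply: gec0_Re; rewrite exprn_ge0.
have n0 x : 0 <= n x by rewrite -lecR -nE exprn_ge0.
have qE x : inner (A x) x = (q x)%:C%C.
  have := selfadjoint_real x As; rewrite /q; case: (inner (A x) x) => a b.
  by rewrite complex_real => /eqP/= ->.
have [C' CE] : exists C' : R, C = C'%:C%C by exists (complex.Re C); exact: gec0_Re.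
have qC x : `|q x| <= C' * n x.
  rewrite -lecR rmorphM/= -CE -nE -norm_real_complex -qE.
  by apply: le_trans (inner_CauchySchwarz _ _) _; rewrite expr2 mulrA ler_wpM2r.
have shift (t : R) : (forall x, t * n x <= q x) \/ (forall x, q x <= t * n x).
  pose B x := A x - scalar_op t%:C%C x.
  have Bb : bounded_op B by apply: bounded_op_sub => //; exact: bounded_op_scalar.
  have Bs : selfadjoint B.
    move=> x y; rewrite innerBl innerBr As innerZl innerZr; congr (_ - _ * _).
    by rewrite /=; apply/esym/CrealP; rewrite complex_real.
  have Birr : hyper_irreducible B.
    move=> L Lc Lh; apply: Airr => // E Eb EA x Lx; apply: (Lh) => // z.
    by rewrite /B (blinB Eb) EA /scalar_op (blinZ Eb).
  have Bq x : inner (B x) x = (q x - t * n x)%:C%C.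
    by rewrite innerBl innerZl qE -sqr_norm_inner nE rmorphB rmorphM.
  by have [h|h] := selfadjoint_sign Birr Bb Bs; [left|right] => x;
    have := h x; rewrite Bq -(rmorph0 (real_complex R)) lecR ?subr_ge0 ?subr_le0.
pose T := [set t : R | forall x, t * n x <= q x].
have nx0 : 0 < n x0 by rewrite -ltcR -nE exprn_gt0// normr_gt0.
have Tsup : has_sup T.
  split.
    exists (- C') => x.
    by rewrite mulNr lerNl (le_trans _ (qC x))// -normrN ler_norm.
  exists C' => t /(_ x0) tq; rewrite -(ler_pM2r nx0) (le_trans tq)//.
  by apply: le_trans (qC _); exact: ler_norm.
pose m := sup T.
have mle x : m * n x <= q x.
  have [nx|nx] := ltP 0 (n x); last first.
    have nx0' : n x = 0 by apply/eqP; rewrite eq_le nx n0.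
    have := qC x; rewrite nx0' !mulr0 normr_le0 => /eqP -> //.
  rewrite -ler_pdivlMr//; apply: ge_sup; first by case: Tsup.
  by move=> t /(_ x); rewrite ler_pdivlMr.
have lem x : q x <= m * n x.
  rewrite leNgt; apply/negP => h.
  have nx : 0 < n x.
    rewrite lt_neqAle n0 andbT eq_sym; apply/eqP => nx0'; have := qC x.
    move: h; rewrite nx0' !mulr0 => h; rewrite normr_le0 => /eqP qx.
    by rewrite qx ltxx in h.
  have mq : m < q x / n x by rewrite ltr_pdivlMr.
  pose t := (m + q x / n x) / 2.
  have [mt tq] : m < t /\ t < q x / n x by rewrite /t; split; lra.
  have [tT|/(_ x)] := shift t; last by rewrite leNgt -ltr_pdivlMr// tq.
  by have := sup_upper_bound Tsup tT; rewrite leNgt mt.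
exists m%:C%C.
pose B x := A x - scalar_op m%:C%C x.
have Bb : bounded_op B by apply: bounded_op_sub => //; exact: bounded_op_scalar.
have Bs : selfadjoint B.
  move=> x y; rewrite innerBl innerBr As innerZl innerZr; congr (_ - _ * _).
  by rewrite /=; apply/esym/CrealP; rewrite complex_real.
have B0 x : inner (B x) x = 0.
  rewrite innerBl innerZl qE -sqr_norm_inner nE -rmorphM -rmorphB.
  by rewrite (_ : q x = m * n x) ?subrr// ?rmorph0//; apply/eqP; rewrite eq_le mle lem.
move=> x; apply/eqP; rewrite -subr_eq0; apply/eqP.
exact: (selfadjoint_zero Bb Bs B0).
Qed.

(** If U commutes with the family, so does its adjoint, since U is unitary; hence
    twice the real part of U and twice its imaginary part up to sign are scalars. *)
Lemma schur n (V : 'I_n -> H -> H) (U : H -> H) : irreducible V ->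
  (forall i, bounded_op (V i)) -> unitary U ->
  (forall i x, V i (U x) = U (V i x)) ->
  exists c : R[i], `|c| = 1 /\ U = scalar_op c.
Proof.
move=> [[x0 x00] Virr] Vb /unitaryP[Ub U1 U2] VU.
have VU' i x : V i (adjoint U x) = adjoint U (V i x).
  by rewrite -[LHS]U1 -VU U2.
have V'U i x : adjoint (V i) (U x) = U (adjoint (V i) x).
  by apply: inner_ext => z; rewrite adjP'// adjP// [RHS]adjP// adjP'// VU'.
have V'U' i x : adjoint (V i) (adjoint U x) = adjoint U (adjoint (V i) x).
  by rewrite -[LHS]U1 -V'U U2.
have U'b := adj_bounded Ub.
have scal (A : H -> H) : bounded_op A -> selfadjoint A ->
    (forall i x, V i (A x) = A (V i x)) ->
    (forall i x, adjoint (V i) (A x) = A (adjoint (V i) x)) ->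
    exists c : R[i], forall x, A x = c *: x.
  move=> Ab As VA V'A; apply: selfadjoint_scalar => // L Lc Lh.
  apply: Virr => // i x Lx; split; apply: (Lh) => //; exact: adj_bounded.
have [||i x|i x|a aE] := scal (fun x => U x + adjoint U x).
- exact: bounded_op_add.
- by move=> x y; rewrite innerDl innerDr adjP// adjP'// addrC.
- by rewrite (blinD (Vb i)) VU VU'.
- by rewrite (blinD (adj_bounded (Vb i))) V'U V'U'.
have [||i x|i x|b bE] := scal (fun x => 'i *: (U x - adjoint U x)).
- by apply: bounded_op_scale; exact: bounded_op_sub.
- move=> x y; rewrite innerZl innerZr conjCi innerBl innerBr adjP// adjP'//.
  by rewrite mulNr -mulrN opprB.
- by rewrite (blinZ (Vb i)) (blinB (Vb i)) VU VU'.
- by rewrite (blinZ (adj_bounded (Vb i))) (blinB (adj_bounded (Vb i))) V'U V'U'.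
have UE : U = scalar_op (2^-1 * (a - 'i * b)).
  apply/funext => x; rewrite /scalar_op -scalerA scalerBl -scalerA -aE -bE/= scalerA.
  have -> : 'i * 'i = -1 :> R[i] by rewrite -expr2 sqrCi.
  rewrite scaleN1r opprK addrACA subrr addr0.
  have -> : U x + U x = 2%:R *: U x by rewrite scaler_nat mulr2n.
  by rewrite scalerA mulVf ?pnatr_eq0// scale1r.
exists (2^-1 * (a - 'i * b)); split=> //.
have := norm_isometry Ub U1 x0; rewrite UE /scalar_op normrZ => /eqP.
by rewrite -subr_eq0 -[X in _ - X]mul1r -mulrBl mulf_eq0 normr_eq0 (negPf x00)
  orbF subr_eq0 => /eqP.
Qed.

End Schur.

(** * Construction of operators from their values on orthogonal families *)

Section Extension.
Variable R : realType.
Implicit Types H K : hilbertType R.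

Lemma closure_approx H (D : set H) x : closure D x <->
  forall e : R[i], 0 < e -> exists2 y, D y & `|x - y| < e.
Proof.
split=> [Dx e e0|h B /nbhs_normP[e /= e0 eB]].
  have [y [Dy xy]] := Dx _ (nbhsx_ballx x _ e0).
  by exists y => //; move: xy; rewrite -ball_normE.
by have [y Dy xy] := h _ e0; exists y; split => //; exact: eB.
Qed.

Lemma dist_linear_lt H (a e : R[i]) (x y x' y' : H) :
  `|x - x'| < e / 2 / (`|a| + 1) -> `|y - y'| < e / 2 ->
  `|a *: x + y - (a *: x' + y')| < e.
Proof.
have a0 : 0 < `|a| + 1 by rewrite ltr_wpDl.
move=> xx' yy'; rewrite opprD addrACA -scalerBr.
apply: le_lt_trans (ler_normD _ _) _; rewrite [e]splitr ler_ltD// normrZ.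
apply: (@le_trans _ _ ((`|a| + 1) * `|x - x'|)).
  by rewrite ler_wpM2r// lerDl.
by rewrite mulrC -ler_pdivlMr// ltW.
Qed.

Lemma closure_subspace H (D : set H) : D 0 ->
  (forall (a : R[i]) x y, D x -> D y -> D (a *: x + y)) ->
  closed_subspace (closure D).
Proof.
move=> D0 Dl; split; first exact: closed_closure.
  exact: subset_closure.
move=> a x y /closure_approx Dx /closure_approx Dy; apply/closure_approx => e e0.
have a0 : 0 < `|a| + 1 by rewrite ltr_wpDl.
have e1 : 0 < e / 2 / (`|a| + 1) by rewrite !divr_gt0.
have e2 : 0 < e / 2 by rewrite divr_gt0.
have [x' Dx' xx'] := Dx _ e1; have [y' Dy' yy'] := Dy _ e2.
exists (a *: x' + y'); first exact: Dl.
exact: dist_linear_lt.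
Qed.

Lemma dense_of_total H (D : set H) : D 0 ->
  (forall (a : R[i]) x y, D x -> D y -> D (a *: x + y)) ->
  oc D `<=` [set 0] -> closure D = setT.
Proof.
move=> D0 Dl Dt; apply: oc_trivial; first exact: closure_subspace.
by move=> z zD; apply: Dt => y Dy; apply: zD; exact: subset_closure.
Qed.

(** Extension by continuity, for a linear relation G in place of a map on a
    subspace: the bound makes G single-valued, and the closure of G is the graph
    of the extension. *)
Lemma extend_linear_relation H K (G : H -> K -> Prop) (C : R[i]) :
  0 <= C -> G 0 0 ->
  (forall (a : R[i]) h k h' k', G h k -> G h' k' -> G (a *: h + h') (a *: k + k')) ->
  (forall h k, G h k -> `|k| <= C * `|h|) ->
  oc [set h | exists k, G h k] `<=` [set 0] ->
  exists T : H -> K, bounded_op T /\ forall h k, G h k -> T h = k.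
Proof.
move=> C0 G0 Gl GC Gt.
pose D := [set h | exists k, G h k].
have Dd : closure D = setT.
  apply: dense_of_total => //; first by exists 0.
  by move=> a x y [k Gk] [k' Gk']; exists (a *: k + k'); exact: Gl.
pose Q h k := forall e : R[i], 0 < e ->
  exists h' k', [/\ G h' k', `|h - h'| < e & `|k - k'| < e].
have Ql (a : R[i]) h k h' k' : Q h k -> Q h' k' -> Q (a *: h + h') (a *: k + k').
  move=> Q1 Q2 e e0.
  have a0 : 0 < `|a| + 1 by rewrite ltr_wpDl.
  have e1 : 0 < e / 2 / (`|a| + 1) by rewrite !divr_gt0.
  have e2 : 0 < e / 2 by rewrite divr_gt0.
  have [x [y [Gxy hx ky]]] := Q1 _ e1; have [x' [y' [Gxy' hx' ky']]] := Q2 _ e2.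
  exists (a *: x + x'), (a *: y + y').
  by split; [exact: Gl|exact: dist_linear_lt|exact: dist_linear_lt].
have GB h k h' k' : G h k -> G h' k' -> `|k - k'| <= C * `|h - h'|.
  move=> G1 G2; apply: GC; have := Gl (-1) _ _ _ _ G2 G1.
  by rewrite !scaleN1r ![- _ + _]addrC.
have QC h k : Q h k -> `|k| <= C * `|h|.
  move=> Qhk; apply/ler_addgt0Pr => e e0.
  have C1 : 0 < C + 1 by rewrite ltr_wpDl.
  have e1 : 0 < e / (C + 1) by rewrite divr_gt0.
  have [x [y [Gxy hx ky]]] := Qhk _ e1.
  rewrite -(subrK y k) addrC; apply: le_trans (ler_normD _ _) _.
  apply: le_trans (lerD (GC _ _ Gxy) (ltW ky)) _.
  apply: (@le_trans _ _ (C * (`|h| + e / (C + 1)) + e / (C + 1))).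
    rewrite lerD2r ler_wpM2l// -[x](subrK h) addrC.
    by apply: le_trans (ler_normD _ _) _; rewrite lerD2l distrC ltW.
  rewrite mulrDr -addrA lerD2l -[X in _ + X]mul1r -mulrDl.
  by rewrite mulrC divfK// gt_eqF.
have Qex h : exists k, Q h k.
  have hD : forall e : R[i], 0 < e -> exists2 x, D x & `|h - x| < e.
    by apply/closure_approx; rewrite Dd.
  pose F := filter_from [set e : R[i] | 0 < e]
    (fun e => [set p : H * K | G p.1 p.2 /\ `|h - p.1| < e]).
  have FF : ProperFilter F.
    apply: filter_from_proper => [|e /= e0]; last first.
      by have [x [k Gk] hx] := hD _ e0; exists (x, k).
    apply: filter_from_filter; first by exists 1 => /=.
    move=> e1 e2 /= e10 e20.
    have [e [e0 ee1 ee2]] : exists e : R[i], [/\ 0 < e, e <= e1 & e <= e2].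
      have [|] := real_leP (gtr0_real e10) (gtr0_real e20) => h12.
        by exists e1; rewrite lexx.
      by exists e2; rewrite lexx (ltW h12).
    exists e => // p [Gp hp]; split; split => //; exact: lt_le_trans hp _.
  have [k Fk] : exists k : K, snd @ F --> k.
    apply: complete_filter => e e0.
    have C1 : 0 < C + 1 by rewrite ltr_wpDl.
    have e1 : 0 < e / 2 / (C + 1) by rewrite !divr_gt0.
    exists [set p | G p.1 p.2 /\ `|h - p.1| < e / 2 / (C + 1)].
      by exists (e / 2 / (C + 1)).
    move=> s t [Gs hs] [Gt' ht]; apply: le_lt_trans (GB _ _ _ _ Gs Gt') _.
    apply: (@le_lt_trans _ _ ((C + 1) * `|s.1 - t.1|)).
      by rewrite ler_wpM2r// lerDl.
    rewrite mulrC -ltr_pdivlMr// -(subrK h s.1) -addrA.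
    apply: le_lt_trans (ler_normD _ _) _.
    by rewrite [e]splitr mulrDl ltrD// distrC.
  exists k => e e0.
  have Fe : F [set p | G p.1 p.2 /\ `|h - p.1| < e] by exists e.
  move/cvgrPdist_lt : Fk => /(_ _ e0) Fk.
  by have [[x y] [/= [Gxy hx] ky]] := filter_ex (filterI Fe Fk); exists x, y.
have [T QT] := choice Qex.
have Qinj h k k' : Q h k -> Q h k' -> k = k'.
  move=> Q1 Q2; have := QC _ _ (Ql (-1) _ _ _ _ Q2 Q1).
  rewrite !scaleN1r addNr normr0 mulr0 normr_le0 addrC subr_eq0.
  by move/eqP.
exists T; split; last first.
  move=> h k Ghk; apply: Qinj (QT h) _ => e e0.
  by exists h, k; rewrite !subrr !normr0.
apply/bounded_opP; split; last by exists C => // x; exact: QC.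
by move=> a x y; apply: Qinj (QT _) _; exact: Ql.
Qed.

Lemma pythagoras H (I : choiceType) (F : {fset I}) (f : I -> H) :
  (forall i j, i != j -> inner (f i) (f j) = 0) ->
  `|\sum_(i <- F) f i| ^+ 2 = \sum_(i <- F) `|f i| ^+ 2.
Proof.
move=> fo; rewrite sqr_norm_inner inner_suml; apply: eq_big_seq => i iF.
rewrite inner_sumr (big_fsetD1 i)//= sqr_norm_inner big1_fset ?addr0// => j.
by rewrite !inE => /andP[ji _] _; apply: fo; rewrite eq_sym.
Qed.

(** The finite sums of the d i (c i) and of the e i (c i) are compared by
    Pythagoras' theorem.  The fibre N is only a module, so that the lemma applies
    to vectors indexed by I as well as to copies of a Hilbert space. *)
Lemma orthogonal_synthesis H K (I : choiceType) (N : lmodType R[i])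
    (d : I -> N -> H) (e : I -> N -> K) (C : R[i]) :
  (forall i, linear (d i)) -> (forall i, linear (e i)) ->
  (forall i j m m', i != j -> inner (d i m) (d j m') = 0) ->
  (forall i j m m', i != j -> inner (e i m) (e j m') = 0) ->
  0 <= C -> (forall i m, `|e i m| <= C * `|d i m|) ->
  (forall z, (forall i m, inner z (d i m) = 0) -> z = 0) ->
  exists T : H -> K, bounded_op T /\ forall i m, T (d i m) = e i m.
Proof.
move=> dl el dO eO C0 deC dt.
have d0 i : d i 0 = 0 by have := dl i (-1) 0 0; rewrite scaler0 addr0 scaleN1r addNr.
have e0 i : e i 0 = 0 by have := el i (-1) 0 0; rewrite scaler0 addr0 scaleN1r addNr.
(* A finite sum is encoded as one that is eventually constant along the finite
   subsets of I: for a linear combination, take the union of the two bounds F0. *)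
pose G h k := exists (c : I -> N) (F0 : {fset I}), forall F : {fset I},
  (F0 `<=` F)%fset -> h = \sum_(i <- F) d i (c i) /\ k = \sum_(i <- F) e i (c i).
have Gde i m : G (d i m) (e i m).
  exists (fun j => if j == i then m else 0), [fset i]%fset => F.
  rewrite fsub1set => iF; split; rewrite (big_fsetD1 i)//= eqxx big1_fset ?addr0// => j;
  by rewrite !inE => /andP[/negPf -> _] _.
have [] := @extend_linear_relation H K G C C0.
- by exists (fun=> 0), fset0 => F _; rewrite !big1.
- move=> a h k h' k' [c [F0 cP]] [c' [F0' cP']].
  exists (fun i => a *: c i + c' i), (F0 `|` F0')%fset => F.
  rewrite fsubUset => /andP[/cP[-> ->] /cP'[-> ->]].
  by rewrite !scaler_sumr -!big_split/=; split; apply: eq_bigr => i _; rewrite ?dl ?el.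
- move=> h k [c [F0 /(_ F0 (fsubset_refl _))[-> ->]]].
  rewrite -ler_sqr ?nnegrE ?mulr_ge0// exprMn.
  rewrite !pythagoras; [|by move=> *; exact: dO|by move=> *; exact: eO].
  rewrite mulr_sumr; apply: ler_sum => i _.
  by rewrite -exprMn ler_sqr ?nnegrE ?mulr_ge0.
- move=> z zG; apply: dt => i m; apply: zG.
  by exists (e i m); exact: Gde.
move=> T [Tb TG]; exists T; split=> // i m; exact: TG (Gde i m).
Qed.

End Extension.

(** * Tensor products with l2(I) *)

Section Ell2Facts.
Variables (R : realType).

Lemma inner_delta (I : choiceType) (x : ell2 R I) i : inner x (ell2_delta R i) = x i.
Proof.
suff: ell2_dot x (ell2_delta R i) = x i by [].
apply: ell2_dot_lim; apply: cvg_near_cst.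
exists [fset i]%fset => // A /=; rewrite fsub1set => iA.
rewrite partial_sumE (big_fsetD1 i)//= eqxx rmorph1 mulr1 big1_fset ?addr0// => j.
by rewrite !inE => /andP[/negPf -> _] _; rewrite rmorph0 mulr0.
Qed.

Lemma delta_orthonormal (I : choiceType) (i j : I) :
  inner (ell2_delta R i) (ell2_delta R j) = (i == j)%:R.
Proof. by rewrite inner_delta /= eq_sym. Qed.

Lemma delta_total (I : choiceType) (x : ell2 R I) :
  (forall i, inner x (ell2_delta R i) = 0) -> x = 0.
Proof. by move=> x0; apply/val_inj/funext => i; rewrite -[LHS]inner_delta x0. Qed.

Lemma norm_delta (I : choiceType) (i : I) : `|ell2_delta R i| = 1.
Proof.
apply/eqP; rewrite -(@eqrXn2 _ 2%N)// sqr_norm_inner delta_orthonormal eqxx.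
by rewrite expr1n.
Qed.

(** Covers both shifts, which are defined by a partial reindexing. *)
Lemma reindex_bounded (I J : choiceType) (g : J -> option I) (h : I -> J)
    (gK : ocancel g h) :
  bounded_op (fun x : ell2 R I => Ell2 (square_summable_reindex gK (ell2P x)) : ell2 R J).
Proof.
apply/bounded_opP; split.
  move=> a x y; apply/val_inj/funext => j /=.
  rewrite !fctE/=; case: (g j) => [i|]//.
  by rewrite scaler0 addr0.
exists 1 => // x; rewrite mul1r; apply: ell2_norm_le => // A.
have uA : uniq (pmap g A) by rewrite (pmap_uniq gK)// fset_uniq.
apply: le_trans (ell2_sum_le x [fset i in pmap g A]%fset).
rewrite [leRHS](perm_big (pmap g A))/=; last first.
  by apply: uniq_perm; rewrite ?fset_uniq// => i; rewrite !inE.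
elim: (enum_fset A) {uA} => [|j s IHs]/=; first by rewrite !big_nil.
rewrite big_cons; case: (g j) => [i|]/=; first by rewrite big_cons lerD2l.
by rewrite normr0 expr0n add0r.
Qed.

Lemma unilateral_shift_bounded : bounded_op (@unilateral_shift R).
Proof. exact: (reindex_bounded ounsuccK). Qed.

Lemma trunc_shift_bounded p : bounded_op (@trunc_shift R p).
Proof. exact: (reindex_bounded (@ounsucc_ordK p)). Qed.

Lemma diag_op_bounded (I : choiceType) (w : I -> R[i]) :
  (forall i, `|w i| <= 1) -> bounded_op (diag_op w).
Proof.
move=> w1; apply/bounded_opP; split.
  move=> a x y; apply/val_inj/funext => i; rewrite -[LHS]/(diag_op w _ i).
  rewrite diag_opE// [RHS]/= !fctE/= !diag_opE//=.
  by rewrite mulrDr mulrCA.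
exists 1 => // x; rewrite mul1r; apply: ell2_norm_le => // A.
apply: le_trans (ell2_sum_le x A); apply: ler_sum => i _.
by rewrite diag_opE// normrM exprMn ler_piMl ?exprn_ge0// exprn_ile1.
Qed.

End Ell2Facts.

Section TensorFacts.
Variable R : realType.
Implicit Types H K M : hilbertType R.

Section Tens.
Variables (H K : hilbertType R) (T : tensorProduct H K).

Lemma tens_total (z : T) : (forall x y, inner z (tens T x y) = 0) -> z = 0.
Proof.
move=> zt; have [zc _ _] := inner_eq0_closed (H := T) z.
apply: innerxx_eq0; apply: zc.
have : closure [set w : T | exists m (x : 'I_m -> H) (y : 'I_m -> K),
    w = \sum_i tens T (x i) (y i)] z by rewrite tens_dense.
apply: closure_subset => _ [m [x [y ->]]] /=.
by rewrite inner_suml big1// => i _; apply: inner_eq0C.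
Qed.

Lemma norm_tens x y : `|tens T x y| = `|x| * `|y|.
Proof.
apply/eqP; rewrite -(@eqrXn2 _ 2%N)// ?mulr_ge0// sqr_norm_inner inner_tens.
by rewrite exprMn !sqr_norm_inner.
Qed.

Lemma tensr_bounded x : bounded_op (tens T x).
Proof.
apply/bounded_opP; split; first exact: tens_linearr.
by exists `|x| => // y; rewrite norm_tens.
Qed.

Lemma tensl_bounded y : bounded_op (tens T ^~ y).
Proof.
apply/bounded_opP; split; first exact: tens_linearl.
by exists `|y| => // x; rewrite norm_tens mulrC.
Qed.

Lemma eq_on_tens (L : hilbertType R) (A B : T -> L) : bounded_op A -> bounded_op B ->
  (forall x y, A (tens T x y) = B (tens T x y)) -> A = B.
Proof.
move=> Ab Bb AB.
apply: (eq_bounded_op (X := [set w | exists x y, w = tens T x y])) => //.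
  by move=> z zt; apply: tens_total => x y; apply: zt; exists x, y.
by move=> _ [x [y ->]].
Qed.

(** The property that [tensor_op] selects.  As [tensor_op] has a default value,
    each operator needs a proof of existence. *)
Definition is_tensor_op (A : H -> H) (B : K -> K) (C : T -> T) : Prop :=
  bounded_op C /\ forall x y, C (tens T x y) = tens T (A x) (B y).

Lemma tensor_opE A B C : is_tensor_op A B C -> tensor_op A B = C.
Proof.
move=> [Cb CP]; rewrite /tensor_op; case: xgetP => [D _ [Db DP]|/(_ C)[]//].
by apply: eq_on_tens => // x y; rewrite DP CP.
Qed.

Lemma is_tensor_op_adj A B C : bounded_op A -> bounded_op B ->
  is_tensor_op A B C -> is_tensor_op (adjoint A) (adjoint B) (adjoint C).
Proof.
move=> Ab Bb [Cb CP]; split; first exact: adj_bounded.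
move=> x y; apply/eqP; rewrite -subr_eq0; apply/eqP; apply: tens_total => x' y'.
by rewrite innerBl adjP'// CP !inner_tens !adjP'// subrr.
Qed.

End Tens.

Section TensEll2.
Variables (I : choiceType) (M : hilbertType R) (T : tensorProduct (ell2 R I) M).
Local Notation delta := (ell2_delta R).

Lemma tens_delta_total (z : T) :
  (forall i m, inner z (tens T (delta i) m) = 0) -> z = 0.
Proof.
move=> zt; apply: tens_total => x m.
have mb := tensl_bounded T m.
rewrite -(adjP' mb) (_ : adjoint _ z = 0) ?inner0l//.
by apply: delta_total => i; rewrite adjP'.
Qed.

Lemma tens_delta_orthogonal i j m m' : i != j ->
  inner (tens T (delta i) m) (tens T (delta j) m') = 0.
Proof. by move=> /negPf ij; rewrite inner_tens delta_orthonormal ij mul0r. Qed.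

Lemma norm_tens_delta i m : `|tens T (delta i) m| = `|m|.
Proof. by rewrite norm_tens norm_delta mul1r. Qed.

Lemma is_tensor_op_delta A B (C : T -> T) : bounded_op A -> bounded_op B ->
  bounded_op C ->
  (forall i m, C (tens T (delta i) m) = tens T (A (delta i)) (B m)) ->
  is_tensor_op A B C.
Proof.
move=> Ab Bb Cb CP; split=> // x m.
have : (C \o tens T ^~ m) = (tens T ^~ (B m) \o A).
  apply: (eq_bounded_op (X := range (ell2_delta R (I := I)))).
  - by apply: bounded_op_comp => //; exact: tensl_bounded.
  - by apply: bounded_op_comp => //; exact: tensl_bounded.
  - by move=> y yd; apply: delta_total => i; apply: yd; exists i.
  - by move=> _ [i _ <-] /=.
by move/(congr1 (fun f => f x)).
Qed.

(** The conditions on A are met by weighted partial permutations of the basis,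
    among them the shifts and the diagonal operators; they make the vectors
    A e_i (x) B m orthogonal for distinct i. *)
Lemma tensor_op_exists A B : bounded_op A -> bounded_op B ->
  (forall i, `|A (delta i)| <= 1) ->
  (forall i j, i != j -> inner (A (delta i)) (A (delta j)) = 0) ->
  is_tensor_op A B (tensor_op (T := T) A B).
Proof.
move=> Ab Bb A1 AO; have [C C0 BC] := bop_bound Bb.
have [|||||i m|z|D [Db DP]] := @orthogonal_synthesis R T T I M
  (fun i => tens T (delta i)) (fun i m => tens T (A (delta i)) (B m)) C.
- by move=> i; exact: tens_linearr.
- by move=> i a m m'; rewrite (blinP Bb) tens_linearr.
- by move=> i j m m'; exact: tens_delta_orthogonal.
- by move=> i j m m' ij; rewrite inner_tens AO ?mul0r.
- exact: C0.
- rewrite norm_tens_delta norm_tens; apply: le_trans (BC m).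
  by rewrite ler_piMl.
- exact: tens_delta_total.
have h := is_tensor_op_delta Ab Bb Db DP.
by rewrite (tensor_opE h).
Qed.

End TensEll2.

(** This is 1 (x) Y, for tensor products that may be constructed differently. *)
Lemma tens_map_exists (I : choiceType) M1 M2
    (T1 : tensorProduct (ell2 R I) M1) (T2 : tensorProduct (ell2 R I) M2)
    (Y : M1 -> M2) : bounded_op Y ->
  exists X : T1 -> T2, bounded_op X /\ forall x m, X (tens T1 x m) = tens T2 x (Y m).
Proof.
move=> Yb; have [C C0 YC] := bop_bound Yb.
have [|||||i m|z|X [Xb XP]] := @orthogonal_synthesis R T1 T2 I M1
  (fun i => tens T1 (ell2_delta R i)) (fun i m => tens T2 (ell2_delta R i) (Y m)) C.
- by move=> i; exact: tens_linearr.
- by move=> i a m m'; rewrite (blinP Yb) tens_linearr.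
- by move=> i j m m'; exact: tens_delta_orthogonal.
- by move=> i j m m'; exact: tens_delta_orthogonal.
- exact: C0.
- by rewrite !norm_tens_delta.
- exact: tens_delta_total.
exists X; split=> // x m.
have : (X \o tens T1 ^~ m) = tens T2 ^~ (Y m).
  apply: (eq_bounded_op (X := range (ell2_delta R (I := I)))).
  - by apply: bounded_op_comp => //; exact: tensl_bounded.
  - exact: tensl_bounded.
  - by move=> y yd; apply: delta_total => i; apply: yd; exists i.
  - by move=> _ [i _ <-] /=.
by move/(congr1 (fun f => f x)).
Qed.

End TensorFacts.

(** * Unitary equivalence of tensor models *)

Section UnitaryEquivalence.
Variable R : realType.
Implicit Types H K L : hilbertType R.

Lemma unitarily_equivalentP n H K (V : 'I_n -> H -> H) (W : 'I_n -> K -> K) :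
  unitarily_equivalent V W <->
  exists Z : H -> K, unitary Z /\ forall i x, Z (V i x) = W i (Z x).
Proof.
split=> -[Z [Zu ZV]]; exists Z; split=> //; have [Zb Z1 Z2] := (unitaryP Z).1 Zu.
  by move=> i x; rewrite -ZV /= Z1.
by move=> i; apply/funext => x /=; rewrite ZV Z2.
Qed.

Lemma intertwine_adjoint H K (Z : H -> K) (A : H -> H) (B : K -> K) :
  unitary Z -> bounded_op A -> bounded_op B ->
  (forall x, Z (A x) = B (Z x)) -> forall x, Z (adjoint A x) = adjoint B (Z x).
Proof.
move=> /unitaryP[Zb Z1 Z2] Ab Bb ZA x; apply: inner_ext => y.
by rewrite (adjP' Bb) -[in RHS](Z2 y) -ZA (adjP Zb) (adjP' Ab) (adjP Zb) Z1.
Qed.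

Lemma unitarily_equivalent_sym n H K (V : 'I_n -> H -> H) (W : 'I_n -> K -> K) :
  unitarily_equivalent V W -> unitarily_equivalent W V.
Proof.
move=> /unitarily_equivalentP[Z [Zu ZV]]; apply/unitarily_equivalentP.
exists (adjoint Z); split=> [|i x]; first exact: unitary_adj.
have [Zb Z1 Z2] := (unitaryP Z).1 Zu.
by rewrite -[RHS]Z1 ZV Z2.
Qed.

Lemma unitarily_equivalent_trans n H K L (V : 'I_n -> H -> H)
    (W : 'I_n -> K -> K) (X : 'I_n -> L -> L) :
  unitarily_equivalent V W -> unitarily_equivalent W X ->
  unitarily_equivalent V X.
Proof.
move=> /unitarily_equivalentP[Z [Zu ZV]] /unitarily_equivalentP[Y [Yu YW]].
apply/unitarily_equivalentP; exists (Y \o Z); split=> [|i x].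
  exact: unitary_comp.
by rewrite /= ZV YW.
Qed.

End UnitaryEquivalence.

Section TensorForms.
Variables (R : realType) (I : choiceType) (i0 : I).
Local Notation delta := (ell2_delta R).
Local Notation ell2 := (ell2 R I).

Definition orthogonal_contraction (A : ell2 -> ell2) : Prop :=
  [/\ bounded_op A, forall i, `|A (delta i)| <= 1 &
      forall i j, i != j -> inner (A (delta i)) (A (delta j)) = 0].

(** The common features of the unilateral and the truncated shift: the basis vectors
    other than e_i0 are images of basis vectors, and e_i0 is orthogonal to the
    range. *)
Definition raising (A : ell2 -> ell2) : Prop :=
  [/\ orthogonal_contraction A, forall i, inner (A (delta i)) (delta i0) = 0 &
      forall i, i != i0 -> exists k, A (delta k) = delta i].

Variables (A : ell2 -> ell2) (n : nat) (D : 'I_n -> ell2 -> ell2).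
Hypotheses (Ar : raising A) (Dc : forall j, orthogonal_contraction (D j)).
Hypothesis (D0 : forall j, D j (delta i0) = delta i0).

Lemma tensor_op_contraction (M : hilbertType R) (T : tensorProduct ell2 M)
    B (Y : M -> M) :
  orthogonal_contraction B -> bounded_op Y ->
  is_tensor_op B Y (tensor_op (T := T) B Y).
Proof. by move=> [Bb B1 BO] Yb; exact: tensor_op_exists. Qed.

(** With [raising_kernel0], the kernel of the adjoint of A (x) 1 is e_i0 (x) M: a
    vector z in this kernel is orthogonal to A e_k (x) m for all k, hence to
    e_i (x) m for all i <> i0. *)
Lemma raising_kernel (M : hilbertType R) (T : tensorProduct ell2 M) (z : T) :
  adjoint (tensor_op A id) z = 0 ->
  z = tens T (delta i0) (adjoint (tens T (delta i0)) z).
Proof.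
have [Ac _ Ahit] := Ar.
have [Gb GP] := tensor_op_contraction T Ac (@bounded_op_id R M).
move=> Gz; apply/eqP; rewrite -subr_eq0; apply/eqP; apply: tens_delta_total => i m.
rewrite innerBl; have [->|ii0] := eqVneq i i0.
  have tb := tensr_bounded T (delta i0).
  by rewrite inner_tens delta_orthonormal eqxx mul1r adjP'// subrr.
rewrite inner_tens delta_orthonormal eq_sym (negPf ii0) mul0r subr0.
have [k <-] := Ahit _ ii0.
by rewrite -GP -adjP'// Gz inner0l.
Qed.

Lemma raising_kernel0 (M : hilbertType R) (T : tensorProduct ell2 M) m :
  adjoint (tensor_op A id) (tens T (delta i0) m) = 0.
Proof.
have [Ac A0 _] := Ar.
have [Gb GP] := tensor_op_contraction T Ac (@bounded_op_id R M).
apply: tens_delta_total => i m'; rewrite adjP'// GP inner_tens.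
by rewrite (inner_eq0C (A0 i)) mul0r.
Qed.

Lemma tensor_intertwine_corner (M1 M2 : hilbertType R)
    (T1 : tensorProduct ell2 M1) (T2 : tensorProduct ell2 M2) (X : T1 -> T2) :
  unitary X ->
  (forall z, X (tensor_op A id z) = tensor_op A id (X z)) ->
  exists Y : M1 -> M2, bounded_op Y /\
    forall m, X (tens T1 (delta i0) m) = tens T2 (delta i0) (Y m).
Proof.
move=> Xu XA; have [Ac _ _] := Ar; have [Xb X1 X2] := (unitaryP X).1 Xu.
have [G1b G1P] := tensor_op_contraction T1 Ac (@bounded_op_id R M1).
have [G2b G2P] := tensor_op_contraction T2 Ac (@bounded_op_id R M2).
exists (adjoint (tens T2 (delta i0)) \o (X \o tens T1 (delta i0))); split.
  apply: bounded_op_comp; first by apply: adj_bounded; exact: tensr_bounded.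
  by apply: bounded_op_comp => //; exact: tensr_bounded.
move=> m /=; apply: raising_kernel.
by rewrite -(intertwine_adjoint Xu G1b G2b XA) raising_kernel0 (blin0 Xb).
Qed.

Lemma tens_delta_inj (M : hilbertType R) (T : tensorProduct ell2 M) i :
  injective (tens T (delta i)).
Proof.
move=> m m' /eqP; rewrite -subr_eq0 -(blinB (tensr_bounded T _)).
by rewrite -normr_eq0 norm_tens_delta normr_eq0 subr_eq0 => /eqP.
Qed.

Lemma tensor_intertwine_reflect (M1 M2 : hilbertType R)
    (T1 : tensorProduct ell2 M1) (T2 : tensorProduct ell2 M2)
    (Y1 : 'I_n -> M1 -> M1) (Y2 : 'I_n -> M2 -> M2) (X : T1 -> T2) :
  (forall j, bounded_op (Y1 j)) -> (forall j, bounded_op (Y2 j)) ->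
  unitary X ->
  (forall z, X (tensor_op A id z) = tensor_op A id (X z)) ->
  (forall j z, X (tensor_op (D j) (Y1 j) z) = tensor_op (D j) (Y2 j) (X z)) ->
  unitarily_equivalent Y1 Y2.
Proof.
move=> Y1b Y2b Xu XA XD; have [Xb X1 X2] := (unitaryP X).1 Xu.
have X'A z : adjoint X (tensor_op A id z) = tensor_op A id (adjoint X z).
  by rewrite -[RHS]X1 XA X2.
have [Y [Yb XY]] := tensor_intertwine_corner Xu XA.
have [Y' [Y'b XY']] := tensor_intertwine_corner (unitary_adj Xu) X'A.
have YY' m : Y (Y' m) = m.
  by apply: (@tens_delta_inj _ T2 i0); rewrite -XY -XY' X2.
have Y'Y m : Y' (Y m) = m.
  by apply: (@tens_delta_inj _ T1 i0); rewrite -XY' -XY X1.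
have Yadj : adjoint Y = Y'.
  apply: adjE => // m m'.
  have := adjP Xb (tens T1 (delta i0) m) (tens T2 (delta i0) m').
  by rewrite XY XY' !inner_tens !delta_orthonormal eqxx !mul1r.
apply/unitarily_equivalentP; exists Y; split.
  by apply/unitaryP; split=> // m; rewrite Yadj.
move=> j m; apply: (@tens_delta_inj _ T2 i0).
have [_ E1] := tensor_op_contraction T1 (Dc j) (Y1b j).
have [_ E2] := tensor_op_contraction T2 (Dc j) (Y2b j).
have := XD j (tens T1 (delta i0) m).
by rewrite E1 D0 !XY E2 D0.
Qed.

Lemma tensor_intertwine_lift (M1 M2 : hilbertType R)
    (T1 : tensorProduct ell2 M1) (T2 : tensorProduct ell2 M2)
    (Y1 : 'I_n -> M1 -> M1) (Y2 : 'I_n -> M2 -> M2) :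
  (forall j, bounded_op (Y1 j)) -> (forall j, bounded_op (Y2 j)) ->
  unitarily_equivalent Y1 Y2 ->
  exists X : T1 -> T2, [/\ unitary X,
  (forall z, X (tensor_op A id z) = tensor_op A id (X z)) &
  (forall j z, X (tensor_op (D j) (Y1 j) z) = tensor_op (D j) (Y2 j) (X z))].
Proof.
move=> Y1b Y2b /unitarily_equivalentP[Y [/unitaryP[Yb YY1 YY2] YI]].
have [X [Xb XP]] := tens_map_exists T1 T2 Yb.
have [X' [X'b X'P]] := tens_map_exists T2 T1 (adj_bounded Yb).
have Xadj : adjoint X = X'.
  apply: (@eq_on_tens _ _ _ T2) => [||x m]//; first exact: adj_bounded.
  apply/eqP; rewrite -subr_eq0; apply/eqP; apply: tens_total => x' m'.
  by rewrite innerBl adjP'// XP X'P !inner_tens adjP'// subrr.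
have inter B (Z1 : M1 -> M1) (Z2 : M2 -> M2) : orthogonal_contraction B ->
    bounded_op Z1 -> bounded_op Z2 -> (forall m, Y (Z1 m) = Z2 (Y m)) ->
    forall z, X (tensor_op B Z1 z) = tensor_op B Z2 (X z).
  move=> Bc Z1b Z2b ZY z.
  have [G1b G1P] := tensor_op_contraction T1 Bc Z1b.
  have [G2b G2P] := tensor_op_contraction T2 Bc Z2b.
  have : X \o tensor_op (T := T1) B Z1 = tensor_op (T := T2) B Z2 \o X.
    apply: (@eq_on_tens _ _ _ T1); [exact: bounded_op_comp|exact: bounded_op_comp|].
    by move=> x m /=; rewrite G1P !XP G2P ZY.
  by move/(congr1 (fun f => f z)).
exists X; split.
- apply/unitaryP; rewrite Xadj; split=> // z.
    have : X' \o X = id.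
      apply: (@eq_on_tens _ _ _ T1); [exact: bounded_op_comp|exact: bounded_op_id|].
      by move=> x m /=; rewrite XP X'P YY1.
    by move/(congr1 (fun f => f z)).
  have : X \o X' = id.
    apply: (@eq_on_tens _ _ _ T2); [exact: bounded_op_comp|exact: bounded_op_id|].
    by move=> x m /=; rewrite X'P XP YY2.
  by move/(congr1 (fun f => f z)).
- by have [Ac _ _] := Ar; apply: inter => //; exact: bounded_op_id.
- by move=> j; apply: inter.
Qed.

Lemma tensor_op_adj (M : hilbertType R) (T : tensorProduct ell2 M) :
  tensor_op (T := T) (adjoint A) id = adjoint (tensor_op (T := T) A id).
Proof.
have [Ac _ _] := Ar; have [Ab _ _] := Ac.
have h := tensor_op_contraction T Ac (@bounded_op_id R M).
have := is_tensor_op_adj Ab (@bounded_op_id R M) h.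
by rewrite adj_id => /tensor_opE.
Qed.

(** The adjoint of the shift, which occurs in case (2), reduces to the shift, since
    a unitary that intertwines two operators intertwines their adjoints. *)
Lemma tensor_form_equivalent (H1 H2 M1 M2 : hilbertType R)
    (B : ell2 -> ell2)
    (V1 : 'I_n.+1 -> H1 -> H1) (V2 : 'I_n.+1 -> H2 -> H2)
    (Y1 : 'I_n -> M1 -> M1) (Y2 : 'I_n -> M2 -> M2) :
  B = A \/ B = adjoint A ->
  (forall j, bounded_op (Y1 j)) -> (forall j, bounded_op (Y2 j)) ->
  tensor_form B D Y1 V1 -> tensor_form B D Y2 V2 ->
  (unitarily_equivalent V1 V2 <-> unitarily_equivalent Y1 Y2).
Proof.
move=> BA Y1b Y2b [T1 [Z1 [Z1u Z10 Z1j]]] [T2 [Z2 [Z2u Z20 Z2j]]].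
pose O1 i := Z1 \o V1 i \o adjoint Z1; pose O2 i := Z2 \o V2 i \o adjoint Z2.
have VO1 : unitarily_equivalent V1 O1 by exists Z1.
have VO2 : unitarily_equivalent V2 O2 by exists Z2.
have [Ac _ _] := Ar.
have [G1b _] := tensor_op_contraction T1 Ac (@bounded_op_id R M1).
have [G2b _] := tensor_op_contraction T2 Ac (@bounded_op_id R M2).
have BAX (X : T1 -> T2) : unitary X ->
    (forall z, X (tensor_op B id z) = tensor_op B id (X z)) <->
    (forall z, X (tensor_op A id z) = tensor_op A id (X z)).
  move=> Xu; case: BA => [->//|->]; rewrite !tensor_op_adj.
  split; last exact: intertwine_adjoint.
  by move=> /(intertwine_adjoint Xu (adj_bounded G1b) (adj_bounded G2b)); rewrite !adjK.
split=> [V12|Y12].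
  have : unitarily_equivalent O1 O2.
    apply: unitarily_equivalent_trans (unitarily_equivalent_sym VO1) _.
    exact: unitarily_equivalent_trans V12 VO2.
  move=> /unitarily_equivalentP[X [Xu XO]].
  apply: (tensor_intertwine_reflect Y1b Y2b Xu).
    by apply/BAX => // z; have := XO ord0 z; rewrite /O1 /O2 Z10 Z20.
  by move=> j z; have := XO (lift ord0 j) z; rewrite /O1 /O2 Z1j Z2j.
apply: unitarily_equivalent_trans VO1 _.
apply: unitarily_equivalent_trans (unitarily_equivalent_sym VO2).
have [X [Xu XA XD]] := tensor_intertwine_lift T1 T2 Y1b Y2b Y12.
apply/unitarily_equivalentP; exists X; split=> // i z.
have [j|] := unliftP ord0 i => ->; first by rewrite /O1 /O2 Z1j Z2j.
by rewrite /O1 /O2 Z10 Z20; apply: (BAX X Xu).2.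
Qed.

End TensorForms.

Section Models.
Variable R : realType.

Lemma diag_op_delta (I : choiceType) (w : I -> R[i]) i : (forall i, `|w i| <= 1) ->
  diag_op w (ell2_delta R i) = w i *: ell2_delta R i.
Proof.
move=> w1; apply/val_inj/funext => j; rewrite -[LHS]/(diag_op w _ j) diag_opE//.
rewrite [RHS]/= !fctE/=; case: eqVneq => [->//|_].
by rewrite mulr0 scaler0.
Qed.

Lemma diag_orthogonal_contraction (I : choiceType) (w : I -> R[i]) :
  (forall i, `|w i| <= 1) -> orthogonal_contraction (diag_op w).
Proof.
move=> w1.
have dE i := diag_op_delta i w1.
split; first exact: diag_op_bounded.
  by move=> i; rewrite dE normrZ norm_delta mulr1.
by move=> i j ij; rewrite !dE innerZl innerZr delta_orthonormal (negPf ij) !mulr0.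
Qed.

Lemma unilateral_shift_raising : raising 0%N (@unilateral_shift R).
Proof.
split; [split|move=> k|].
- exact: unilateral_shift_bounded.
- by move=> k; rewrite unilateral_shift_delta norm_delta.
- by move=> i j ij; rewrite !unilateral_shift_delta delta_orthonormal eqSS (negPf ij).
- by rewrite unilateral_shift_delta delta_orthonormal.
- by case=> // k _; exists k; rewrite unilateral_shift_delta.
Qed.

Lemma trunc_shift_basis p (i : 'I_p) :
  (exists j : 'I_p,
    nat_of_ord j = i.+1 /\ trunc_shift (ell2_delta R i) = ell2_delta R j) \/
  (i.+1 = p /\ trunc_shift (ell2_delta R i) = 0).
Proof.
have [ip|ip] := ltnP i.+1 p.
  by left; exists (Ordinal ip); rewrite trunc_shift_delta.
have pE : i.+1 = p by apply/eqP; rewrite eqn_leq ip ltn_ord.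
by right; rewrite trunc_shift_delta_last.
Qed.

Lemma trunc_shift_raising p : raising (ord0 : 'I_p.+1) (@trunc_shift R p.+1).
Proof.
split; [split|move=> k|].
- exact: trunc_shift_bounded.
- move=> k; have [[j [_ ->]]|[_ ->]] := trunc_shift_basis k; first by rewrite norm_delta.
  by rewrite normr0 ler01.
- move=> i j ij.
  have [[i' [i'E ->]]|[_ ->]] := trunc_shift_basis i; last by rewrite inner0l.
  have [[j' [j'E ->]]|[_ ->]] := trunc_shift_basis j; last by rewrite inner0r.
  by rewrite delta_orthonormal -val_eqE/= i'E j'E eqSS val_eqE (negPf ij).
- have [[j [jE ->]]|[_ ->]] := trunc_shift_basis k; last by rewrite inner0l.
  by rewrite delta_orthonormal -val_eqE/= jE.
- case=> [[|k] kp] // _; exists (Ordinal (ltnW kp)).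
  by rewrite trunc_shift_delta; congr ell2_delta; exact: val_inj.
Qed.

End Models.

(** * Closed subspaces as Hilbert spaces *)

Section SubHilbert.
Variables (R : realType) (H : hilbertType R).

(** The proof of closedness is a parameter of the predicate, so that the type built
    on it carries that proof and its completeness can be a canonical instance. *)
Definition subspace_pred (L : set H) (Lc : closed_subspace L) : {pred H} :=
  fun x => `[< L x >].

Variables (L : set H) (Lc : closed_subspace L).

Lemma subspace_predP : submod_closed (subspace_pred Lc).
Proof.
have [_ L0 Ll] := Lc; split; first exact/asboolP.
by move=> a x y /asboolP Lx /asboolP Ly; apply/asboolP; exact: Ll.
Qed.

HB.instance Definition _ := GRing.isSubmodClosed.Build R[i] H
  (subspace_pred Lc) subspace_predP.

Record subhilbert := SubHilb {
  subhilbert_val :> H;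
  subhilbert_valP : subhilbert_val \in subspace_pred Lc }.

HB.instance Definition _ := [isSub for subhilbert_val].
HB.instance Definition _ := [Choice of subhilbert by <:].
HB.instance Definition _ := [SubChoice_isSubLmodule of subhilbert by <:].

Definition subspace_dot (x y : subhilbert) : R[i] := inner (val x) (val y).

Lemma subspace_dot_linear y a x x' :
  subspace_dot (a *: x + x') y = a * subspace_dot x y + subspace_dot x' y.
Proof. by rewrite /subspace_dot linearP innerDl innerZl. Qed.

Lemma subspace_dot_conj x y : subspace_dot x y = (subspace_dot y x)^*.
Proof. exact: innerC. Qed.

Lemma subspace_dot_gt0 x : x != 0 -> 0 < subspace_dot x x.
Proof.
move=> x0; rewrite /subspace_dot dnorm_gt0.
by apply: contraNneq x0 => x0; apply/eqP/val_inj.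
Qed.

HB.instance Definition _ := @Lmodule_isPreHilbert.Build R subhilbert
  subspace_dot subspace_dot_linear subspace_dot_conj subspace_dot_gt0.

Lemma norm_subspace (x : subhilbert) : `|x| = `|val x|.
Proof.
apply/eqP; rewrite -(@eqrXn2 _ 2%N)//.
by rewrite [X in X == _]sqr_norm_inner [X in _ == X]sqr_norm_inner.
Qed.

Lemma subspace_complete (F : set_system subhilbert) :
  ProperFilter F -> cauchy F -> cvg F.
Proof.
move=> FF /cauchy_ballP Fc.
have [l Fl] : exists l : H, subhilbert_val @ F --> l.
  apply: complete_filter => e e0.
  have e20 : 0 < e / 2 by rewrite divr_gt0.
  have [[A B] /= [FA FB] AB] := Fc _ e0.
  have FAB : F (A `&` B) by exact: filterI.
  exists (A `&` B) => // s t [As Bs] [At Bt].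
  have <- : `|s - t| = `|subhilbert_val s - subhilbert_val t|.
    by rewrite norm_subspace linearB.
  by have := AB (s, t) (conj As Bt); rewrite -ball_normE.
have Ll : L l.
  apply: (closed_subspace_approx Lc) => e e0.
  move/cvgrPdist_lt : Fl => /(_ _ e0) Fe.
  have [z lz] := filter_ex Fe.
  by exists (val z) => //; apply/asboolP; exact: subhilbert_valP z.
have lP : l \in subspace_pred Lc by exact/asboolP.
apply/cvg_ex; exists (SubHilb lP); apply/cvgrPdist_lt => e e0.
move/cvgrPdist_lt : Fl => /(_ _ e0); apply: filterS => z.
by rewrite norm_subspace linearB.
Qed.

HB.instance Definition _ := Uniform_isComplete.Build subhilbert subspace_complete.

Lemma inner_subspace (x y : subhilbert) : inner x y = inner (val x) (val y).
Proof. by []. Qed.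

Lemma subspace_linear (a : R[i]) (x y : subhilbert) :
  val (a *: x + y) = a *: val x + val y.
Proof. exact: linearP. Qed.

Lemma subspace_scale (a : R[i]) (x : subhilbert) : val (a *: x) = a *: val x.
Proof. exact: linearZ. Qed.

Lemma subspace_mem (x : subhilbert) : L (val x).
Proof. by apply/asboolP; exact: subhilbert_valP. Qed.

Definition subspace_of x (Lx : L x) : subhilbert := SubHilb (asboolT Lx).

End SubHilbert.

(** * Halmos-Wallen subspaces *)

Lemma adj_partial_isometry (R : realType) (H : hilbertType R) (A : H -> H) :
  bounded_op A -> (forall x, A (adjoint A (A x)) = A x) ->
  forall x, adjoint A (A (adjoint A x)) = adjoint A x.
Proof.
move=> Ab AP x; apply: inner_ext => y.
by rewrite (adjP' Ab) (adjP Ab) (adjP' Ab) AP -(adjP' Ab).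
Qed.

Section PowerPartialIsometry.
Variables (R : realType) (H : hilbertType R) (V : H -> H).
Hypothesis Vppi : power_partial_isometry V.

Lemma ppi_bounded : bounded_op V.
Proof. by have [] := Vppi 1. Qed.

Let Vb := ppi_bounded.

Lemma ppi_iter k x : iter k V (iter k (adjoint V) (iter k V x)) = iter k V x.
Proof.
have /partial_isometryP[Vkb] := Vppi k.
by rewrite adj_iter// => /(_ x).
Qed.

Lemma ppi_iter_adj k x :
  iter k (adjoint V) (iter k V (iter k (adjoint V) x)) = iter k (adjoint V) x.
Proof.
have Vkb := bounded_op_iter k Vb.
rewrite -(adj_iter k Vb); apply: adj_partial_isometry => // y.
by rewrite adj_iter// ppi_iter.
Qed.

Lemma adj_ppi : power_partial_isometry (adjoint V).
Proof.
move=> k; apply/partial_isometryP; split.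
  by apply: bounded_op_iter; exact: adj_bounded.
move=> x; rewrite adj_iter ?adjK//; last exact: adj_bounded.
exact: ppi_iter_adj.
Qed.

Lemma ppi_range_closed k : closed_subspace (range (iter k V)).
Proof.
have Vkb := bounded_op_iter k Vb.
pose D x := x - iter k V (iter k (adjoint V) x).
have Db : bounded_op D.
  apply: bounded_op_sub; first exact: bounded_op_id.
  apply: (bounded_op_comp Vkb); apply: bounded_op_iter; exact: adj_bounded.
rewrite (_ : range _ = [set x | D x = 0]); first exact: ker_closed.
apply/seteqP; split=> [_ [x _ <-] /=|x /= /eqP].
  by rewrite /D ppi_iter subrr.
by rewrite subr_eq0 => /eqP xE; exists (iter k (adjoint V) x).
Qed.

Definition stable_range := \bigcap_(n in [set n | (1 <= n)%N]) range (iter n V).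

Lemma stable_range_closed : closed_subspace stable_range.
Proof. by apply: closed_subspace_bigcap => k _; exact: ppi_range_closed. Qed.

Lemma hw_E_mull j k x : (j <= k)%N -> hw_E V j (hw_E V k x) = hw_E V k x.
Proof.
move=> jk; rewrite /hw_E /=.
by rewrite -[in iter k V _](subnKC jk) iterD ppi_iter -iterD subnKC.
Qed.

Lemma hw_E_mulr j k x : (j <= k)%N -> hw_E V k (hw_E V j x) = hw_E V k x.
Proof.
move=> jk; rewrite /hw_E /=; congr (iter k V _).
by rewrite -[in LHS](subnK jk) iterD ppi_iter_adj -iterD subnK.
Qed.

Lemma hw_F_mull j k x : (j <= k)%N -> hw_F V j (hw_F V k x) = hw_F V k x.
Proof.
move=> jk; rewrite /hw_F /=.
by rewrite -[in iter k (adjoint V) _](subnKC jk) iterD ppi_iter_adj -iterD subnKC.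
Qed.

Lemma hw_E_selfadjoint k : selfadjoint (hw_E V k).
Proof.
move=> x y; have Vkb := bounded_op_iter k Vb; rewrite /hw_E /= -(adj_iter k Vb).
by rewrite (adjP Vkb) (adjP' Vkb).
Qed.

Lemma hw_F_selfadjoint k : selfadjoint (hw_F V k).
Proof.
move=> x y; have Vkb := bounded_op_iter k Vb; rewrite /hw_F /= -(adj_iter k Vb).
by rewrite (adjP' Vkb) (adjP Vkb).
Qed.

Lemma hw_F_bounded k : bounded_op (hw_F V k).
Proof.
by apply: bounded_op_comp; apply: bounded_op_iter => //; exact: adj_bounded.
Qed.

Lemma hw_E_bounded k : bounded_op (hw_E V k).
Proof.
by apply: bounded_op_comp; apply: bounded_op_iter => //; exact: adj_bounded.
Qed.

End PowerPartialIsometry.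

(** If FE is idempotent, then EFx and FEFx have the same inner products with
    themselves and with each other, so EF = FEF; taking adjoints, FE = FEF. *)
Lemma projections_commute (R : realType) (H : hilbertType R) (E F : H -> H) :
  selfadjoint E -> selfadjoint F ->
  (forall x, E (E x) = E x) -> (forall x, F (F x) = F x) ->
  (forall x, F (E (F (E x))) = F (E x)) ->
  forall x, E (F x) = F (E x).
Proof.
move=> Es Fs EE FF FEFE.
have EF x : E (F x) = F (E (F x)).
  apply/eqP; rewrite -subr_eq0; apply/eqP; apply: innerxx_eq0.
  have ab : inner (E (F x)) (E (F x)) = inner (E (F x)) (F (E (F x))).
    by rewrite [LHS]Es EE [RHS]Es [LHS]Fs [RHS]Fs FEFE.
  by rewrite innerBl !innerBr ab subrr !Fs FF subrr subrr.
move=> x; apply: inner_ext => y.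
by rewrite EF Fs Es Fs -EF -Es -Fs.
Qed.

Section HalmosWallenCases.
Variables (R : realType) (H : hilbertType R) (V : H -> H).
Hypothesis Vppi : power_partial_isometry V.
Let Vb := ppi_bounded Vppi.
Let V'b := adj_bounded Vb.
Let V'ppi := adj_ppi Vppi.

(** That V^(k+l) is a partial isometry says that the product of the projections
    V*^k V^k and V^l V*^l is idempotent. *)
Lemma hw_EF_commute k l x : hw_E V l (hw_F V k x) = hw_F V k (hw_E V l x).
Proof.
apply: projections_commute => [|||y|y].
- exact: hw_E_selfadjoint.
- exact: hw_F_selfadjoint.
- by move=> y; exact: hw_E_mull.
- exact: hw_F_mull.
rewrite /hw_E /hw_F /=; congr (iter k (adjoint V) _).
have VD u : iter k V (iter l V u) = iter (k + l) V u by rewrite iterD.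
have V'D u : iter l (adjoint V) (iter k (adjoint V) u) = iter (k + l) (adjoint V) u.
  by rewrite addnC iterD.
by rewrite !VD V'D ppi_iter.
Qed.

Lemma hw_PP x : hw_P V (hw_P V x) = hw_P V x.
Proof.
have Sc := stable_range_closed Vppi.
by apply: (orth_proj_id Sc); have [] := orth_projP Sc x.
Qed.

Lemma hw_P_mem x : stable_range V (hw_P V x).
Proof. by have [] := orth_projP (stable_range_closed Vppi) x. Qed.

Lemma hw_Q_mem x : stable_range (adjoint V) (hw_Q V x).
Proof. by have [] := orth_projP (stable_range_closed V'ppi) x. Qed.

Lemma hw_P_id x : stable_range V x -> hw_P V x = x.
Proof. by move=> /(orth_proj_id (stable_range_closed Vppi)). Qed.

Lemma surjective_adj_isometry : stable_range (adjoint V) = setT ->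
  forall x, adjoint V (V x) = x.
Proof.
move=> QT x; have : stable_range (adjoint V) x by rewrite QT.
by move=> /(_ 1%N isT)[y _ <-] /=; exact: (ppi_iter_adj Vppi 1).
Qed.

Lemma hw_P_complement x : hw_P V (x - hw_P V x) = 0.
Proof.
have Sc := stable_range_closed Vppi.
have [_ xo] := orth_projP Sc x; have [Pu uo] := orth_projP Sc (x - hw_P V x).
apply: innerxx_eq0; have := uo _ Pu.
by rewrite innerBl xo// sub0r => /eqP; rewrite oppr_eq0 => /eqP.
Qed.

(** If (1 - P) Q is surjective, then P = 0 because P (1 - P) = 0, and therefore Q is
    surjective. *)
Lemma hw_s_isometry : hw_s V = setT ->
  (forall x, adjoint V (V x) = x) /\
  (forall x, (forall k, exists y, x = iter k V y) -> x = 0).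
Proof.
move=> sT.
have P0 x : hw_P V x = 0.
  have : hw_s V x by rewrite sT.
  by move=> [y _ <-] /=; exact: hw_P_complement.
have Q1 x : stable_range (adjoint V) x.
  have : hw_s V x by rewrite sT.
  by move=> [y _ <-] /=; rewrite P0 subr0; exact: hw_Q_mem.
split; first by apply: surjective_adj_isometry; apply/seteqP; split.
move=> x Vx; rewrite -(hw_P_id (x := x)) ?P0// => k _.
by have [y ->] := Vx k; exists y.
Qed.

Lemma hw_u_unitary : hw_u V = setT -> unitary V.
Proof.
move=> uT.
have P1 x : hw_P V x = x.
  have : hw_u V x by rewrite uT.
  by move=> [y _ <-] /=; exact: hw_PP.
have Q1 x : stable_range (adjoint V) x.
  have : hw_u V x by rewrite uT.
  by move=> [y _ <-] /=; rewrite P1; exact: hw_Q_mem.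
apply/unitaryP; split=> // x.
  by apply: surjective_adj_isometry; apply/seteqP; split.
have : stable_range V x by rewrite -[x]P1; exact: hw_P_mem.
by move=> /(_ 1%N isT)[y _ <-] /=; exact: (ppi_iter Vppi 1).
Qed.

Lemma hw_b_adj : hw_b V = hw_s (adjoint V).
Proof. by rewrite /hw_b /hw_s /hw_P /hw_Q adjK. Qed.

(** Every vector is a sum of terms (E_(n-1) - E_n)(F_(p-n) - F_(p-n+1)) y with
    n <= p.  Multiplication by E_p kills each of them, so V^p = 0.  Multiplication
    by 1 - E_1, the projection onto the kernel of V*, leaves only the term with
    n = 1; as F_p = 0 and as E_1 commutes with F_(p-1), this term is in the range
    of F_(p-1), where V^k is isometric for all k < p. *)
Lemma hw_p_nilpotent p : (1 <= p)%N -> hw_p V p = setT ->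
  (forall x, iter p V x = 0) /\
  (forall m, adjoint V m = 0 -> forall k, (k < p)%N ->
    iter k (adjoint V) (iter k V m) = m).
Proof.
move=> p1 pT.
pose t n y := ((hw_E V n.-1 \- hw_E V n) \o (hw_F V (p - n) \- hw_F V (p - n).+1)) y.
have dec x : exists y, x = \sum_(1 <= n < p.+1) t n y.
  have : hw_p V p x by rewrite pT.
  by move=> [y _ <-]; exists y.
have Eb k := hw_E_bounded Vppi k; have Fb k := hw_F_bounded Vppi k.
have Ep x : hw_E V p x = 0.
  have [y ->] := dec x; rewrite (blin_sum (Eb p)) big_nat big1// => n /andP[n1 np].
  rewrite /t /= (blinB (Eb p)) !hw_E_mulr ?subrr//.
  exact: leq_trans (leq_pred _) _.
have V'p x : iter p (adjoint V) x = 0.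
  rewrite -(ppi_iter_adj Vppi) -[iter p V _]/(hw_E V p x) Ep.
  by rewrite (blin0 (bounded_op_iter p V'b)).
have Vp x : iter p V x = 0.
  apply: innerxx_eq0.
  by rewrite (adjP (bounded_op_iter p Vb)) (adj_iter p Vb) V'p inner0r.
split=> // m m0 k kp.
suff Fm : hw_F V p.-1 m = m.
  rewrite -[LHS]/(hw_F V k m) -[in LHS]Fm hw_F_mull// -ltnS prednK//.
have E1m : m - hw_E V 1 m = m by rewrite /hw_E/= m0 (blin0 Vb) subr0.
have [y my] := dec m.
have mE : m = hw_F V p.-1 (y - hw_E V 1 y).
  rewrite -E1m my (blin_sum (Eb 1)) -sumrB big_nat_recl// big_nat.
  rewrite [X in _ + X]big1 ?addr0 => [|n /andP[n1 np]]; last first.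
    rewrite /t /= (blinB (Eb 1)) !hw_E_mull ?subrr//.
  rewrite /t /= subn1 prednK// (blinB (Eb 1)) (blinB (Fb _)).
  have -> : hw_F V p y = 0.
    by rewrite /hw_F/= Vp (blin0 (bounded_op_iter p V'b)).
  rewrite subr0 -hw_EF_commute hw_E_mulr// hw_E_mull// subrr subr0.
  by rewrite /hw_E /=.
by rewrite mE hw_F_mull.
Qed.

End HalmosWallenCases.

Section Totality.
Variables (R : realType) (H : hilbertType R) (V : H -> H).
Hypotheses (Vb : bounded_op V) (VP : forall x, V (adjoint V (V x)) = V x).

(** Inductively z = V^k u with u = V*^k z.  As z is orthogonal to V^k m for all m in
    the kernel of V*, the vector u is orthogonal to this kernel, onto which
    1 - V V* projects; so u = V V* u. *)
Lemma wandering_complement z k :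
  (forall i m, (i < k)%N -> adjoint V m = 0 -> inner z (iter i V m) = 0) ->
  z = iter k V (iter k (adjoint V) z).
Proof.
elim: k => [//|k IH] zk.
have zE : z = iter k V (iter k (adjoint V) z).
  by apply: IH => i m ik; apply: zk; exact: ltnW.
have V'b := adj_bounded Vb.
set u := iter k (adjoint V) z in zE *.
suff uE : u = V (adjoint V u) by rewrite iterSr/= -/u -uE.
have V'P x : adjoint V (V (adjoint V x)) = adjoint V x.
  exact: adj_partial_isometry.
have m0 : adjoint V (u - V (adjoint V u)) = 0 by rewrite (blinB V'b) V'P subrr.
apply/eqP; rewrite -subr_eq0; apply/eqP; apply: innerxx_eq0.
rewrite {1}innerBl [X in _ - X]adjP// m0 inner0r subr0.
have := zk k _ (ltnSn k) m0.
by rewrite -(adjP' (bounded_op_iter k Vb)) (adj_iter k Vb).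
Qed.

End Totality.

(** * Scalar twists and restrictions *)

Section ScalarTwists.
Variable R : realType.
Implicit Types H : hilbertType R.

Lemma unitary_scalar H (a : R[i]) : `|a| = 1 -> unitary (@scalar_op R H a).
Proof.
move=> a1; have aa : a * a^* = 1 by rewrite -normCK a1 expr1n.
apply/unitaryP; split=> [|x|x]; rewrite ?adj_scalar /scalar_op ?scalerA.
- exact: bounded_op_scalar.
- by rewrite mulrC aa scale1r.
- by rewrite aa scale1r.
Qed.

Lemma twist_scalar n H (lam : 'I_n -> 'I_n -> R[i]) i j : twist_scalars lam ->
  i != j -> twist (@scalar_twist R H n lam) i j = scalar_op (lam i j).
Proof.
move=> lamP ij; rewrite /twist; case: ifP => // _.
by rewrite /scalar_twist adj_scalar; have [_ ->] := lamP i j ij; rewrite conjCK.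
Qed.

Lemma twisted_ppi_scalarP n H (lam : 'I_n -> 'I_n -> R[i]) (V : 'I_n -> H -> H) :
  twist_scalars lam ->
  twisted_ppi (scalar_twist lam) V <->
  [/\ forall i, power_partial_isometry (V i),
      forall i j x, i != j ->
        adjoint (V i) (V j x) = lam i j *: V j (adjoint (V i) x) &
      forall i j x, i != j -> V i (V j x) = lam j i *: V j (V i x)].
Proof.
move=> lamP; split=> [[_ Vp V1 V2 _]|[Vp V1 V2]].
  split=> // i j x ij.
    by have /(congr1 (fun f => f x)) := V1 i j ij; rewrite twist_scalar.
  have /(congr1 (fun f => f x)) := V2 i j ij.
  by rewrite twist_scalar// eq_sym.
split=> //.
- split=> [i j ij|i j k l _ _].
    apply: unitary_scalar; have [] := lamP i j => //.
    by apply: contraTneq ij => ->; rewrite ltnn.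
  by apply/funext => x; rewrite /scalar_twist /scalar_op /= !scalerA mulrC.
- by move=> i j ij; rewrite twist_scalar//; apply/funext => x /=; exact: V1.
- move=> i j ij; rewrite twist_scalar 1?eq_sym//; apply/funext => x /=; exact: V2.
- move=> i j k ij; rewrite twist_scalar//; apply/funext => x /=.
  by rewrite /scalar_op (blinZ (ppi_bounded (Vp k))).
Qed.

End ScalarTwists.

Section Restriction.
Variables (R : realType) (H : hilbertType R) (L : set H).
Hypothesis Lc : closed_subspace L.
Local Notation M := (subhilbert Lc).

(** The default value 0 is never met when A maps L to L. *)
Definition restrict (A : H -> H) (x : M) : M := insubd 0 (A (val x)).

Lemma val_restrict A (x : M) : (forall y, L y -> L (A y)) ->
  val (restrict A x) = A (val x).
Proof.
by move=> AL; rewrite insubdK//; apply/asboolP; apply: AL; exact: subspace_mem.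
Qed.

Lemma val_iter_restrict A k (x : M) : (forall y, L y -> L (A y)) ->
  val (iter k (restrict A) x) = iter k A (val x).
Proof. by move=> AL; elim: k => [//|k IH]; rewrite !iterS val_restrict// IH. Qed.

Lemma restrict_bounded A : bounded_op A -> (forall y, L y -> L (A y)) ->
  bounded_op (restrict A).
Proof.
move=> Ab AL; have [C C0 AC] := bop_bound Ab.
apply/bounded_opP; split.
  move=> a x y; apply: val_inj; rewrite subspace_linear !val_restrict//.
  by rewrite subspace_linear (blinP Ab).
by exists C => // x; rewrite !norm_subspace val_restrict.
Qed.

Lemma adj_restrict A : bounded_op A -> reduces L A ->
  adjoint (restrict A) = restrict (adjoint A).
Proof.
move=> Ab AL; have AL1 y Ly := (AL y Ly).1; have AL2 y Ly := (AL y Ly).2.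
apply: adjE; first exact: restrict_bounded.
by move=> x y; rewrite !inner_subspace !val_restrict// adjP.
Qed.

Lemma val_adj_restrict A (x : M) : bounded_op A -> reduces L A ->
  val (adjoint (restrict A) x) = adjoint A (val x).
Proof.
by move=> Ab AL; rewrite adj_restrict// val_restrict// => y /AL[].
Qed.

Lemma restrict_ppi A : power_partial_isometry A -> reduces L A ->
  power_partial_isometry (restrict A).
Proof.
move=> Ap AL k; have Ab := ppi_bounded Ap.
have AL1 y Ly := (AL y Ly).1; have AL2 y Ly := (AL y Ly).2.
have rb := restrict_bounded Ab AL1.
apply/partial_isometryP; split; first exact: bounded_op_iter.
move=> x; apply: val_inj; rewrite adj_iter// adj_restrict//.
by rewrite !val_iter_restrict// ppi_iter.
Qed.

End Restriction.

(** * The tensor model of a wandering subspace *)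

(** The set I of exponents is nat or an initial segment of it, embedded in nat by
    [iota]; both shifts are covered by this choice. *)
Section WanderingModel.
Variables (R : realType) (H : hilbertType R) (W : H -> H).
Hypotheses (Wb : bounded_op W) (WP : forall x, W (adjoint W (W x)) = W x).
Variables (I : choiceType) (i0 : I) (iota : I -> nat).
Hypothesis iota_inj : injective iota.
Hypothesis iota0 : iota i0 = 0%N.
Hypothesis iota_pred : forall i, iota i = 0%N \/ exists i', iota i = (iota i').+1.
Hypothesis iota_succ : forall i, (exists i', iota i' = (iota i).+1) \/
  forall x, iter (iota i).+1 W x = 0.
Hypothesis W_iso : forall i m, adjoint W m = 0 ->
  iter (iota i) (adjoint W) (iter (iota i) W m) = m.
Hypothesis W_total : forall z,
  (forall i m, adjoint W m = 0 -> inner z (iter (iota i) W m) = 0) -> z = 0.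

Let W'b := adj_bounded Wb.
Let Wkb k := bounded_op_iter k Wb.
Definition wandering_closed := ker_closed W'b.
Local Notation M := (subhilbert wandering_closed).
Local Notation delta := (ell2_delta R).

Lemma wandering_mem (m : M) : adjoint W (val m) = 0.
Proof. exact: (subspace_mem m). Qed.

Lemma wandering_iter_lt j m m' : adjoint W m = 0 -> adjoint W m' = 0 ->
  forall i, (iota i < j)%N -> inner (iter (iota i) W m) (iter j W m') = 0.
Proof.
move=> m0 m'0 i ij; rewrite -(subnKC (ltnW ij)) iterD.
rewrite -(adjP' (Wkb _)) (adj_iter _ Wb) W_iso//.
rewrite -(subnSK ij) iterS -adjP' ?m0 ?inner0l//.
Qed.

Lemma wandering_orthogonal i j m m' : adjoint W m = 0 -> adjoint W m' = 0 ->
  inner (iter (iota i) W m) (iter (iota j) W m') = (i == j)%:R * inner m m'.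
Proof.
move=> m0 m'0; have [->|ij] := eqVneq i j.
  by rewrite mul1r -(adjP' (Wkb _)) (adj_iter _ Wb) W_iso.
rewrite mul0r; have [lt_ij|lt_ji|/iota_inj/eqP] := ltngtP (iota i) (iota j).
- exact: wandering_iter_lt.
- by apply: inner_eq0C; exact: wandering_iter_lt.
- by rewrite (negPf ij).
Qed.

Lemma wandering_norm i m : adjoint W m = 0 -> `|iter (iota i) W m| = `|m|.
Proof.
move=> m0; apply/eqP; rewrite -(@eqrXn2 _ 2%N)// !sqr_norm_inner.
by rewrite wandering_orthogonal// eqxx mul1r.
Qed.

(** W^k m and W^(k+1) m have the same norm, so W*W fixes W^k m, as W*W is a
    projection. *)
Lemma wandering_lower i i' m : adjoint W m = 0 -> iota i = (iota i').+1 ->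
  adjoint W (iter (iota i) W m) = iter (iota i') W m.
Proof.
move=> m0 ii'; have := wandering_norm i m0; rewrite -(wandering_norm i' m0) ii' iterS.
set u := iter _ _ _ => Wu; apply/eqP; rewrite -subr_eq0 -normr_eq0 -sqrf_eq0.
rewrite sqr_normB adjP'// -sqr_norm_inner.
have -> : `|adjoint W (W u)| ^+ 2 = `|W u| ^+ 2.
  by rewrite !sqr_norm_inner (adjP' Wb) WP.
have -> : (`|W u| ^+ 2)^* = `|W u| ^+ 2 by rewrite geC0_conj// exprn_ge0.
by rewrite Wu subrr.
Qed.

Lemma wandering_synthesis : exists F : M -> ell2 R I -> H,
  forall m, bounded_op (F m) /\ forall i, F m (delta i) = iter (iota i) W (val m).
Proof.
suff /choice[F FP] : forall m : M, exists F : ell2 R I -> H,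
    bounded_op F /\ forall i, F (delta i) = iter (iota i) W (val m) by exists F.
move=> m; have m0 := wandering_mem m.
have [||||||z|F [Fb FP]] := @orthogonal_synthesis R (ell2 R I) H I R[i]^o
  (fun i (c : R[i]) => c *: delta i)
  (fun i (c : R[i]) => c *: iter (iota i) W (val m)) `|m|.
- by move=> i a c c'; rewrite scalerDl scalerA.
- by move=> i a c c'; rewrite scalerDl scalerA.
- by move=> i j c c' ij; rewrite innerZl innerZr delta_orthonormal (negPf ij) !mulr0.
- move=> i j c c' ij; rewrite innerZl innerZr wandering_orthogonal//.
  by rewrite (negPf ij) mul0r !mulr0.
- by [].
- by move=> i c; rewrite !normrZ norm_delta wandering_norm// mulr1 mulrC norm_subspace.
- move=> z0; apply: delta_total => i.
  by have := z0 i 1; rewrite scale1r.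
exists F; split=> // i.
by have := FP i 1; rewrite !scale1r.
Qed.

Definition wandering_tens (x : ell2 R I) (m : M) : H :=
  projT1 (cid wandering_synthesis) m x.

Lemma wandering_tens_bounded m : bounded_op (wandering_tens ^~ m).
Proof. by rewrite /wandering_tens; case: cid => F /= /(_ m)[]. Qed.

Lemma wandering_tens_delta i m : wandering_tens (delta i) m = iter (iota i) W (val m).
Proof. by rewrite /wandering_tens; case: cid => F /= /(_ m)[]. Qed.

Lemma delta_range_total : oc (range (@ell2_delta R I)) `<=` [set 0].
Proof. by move=> y yd; apply: delta_total => i; apply: yd; exists i. Qed.

Lemma wandering_tens_linearl m : linear (wandering_tens ^~ m).
Proof. exact: blinear (wandering_tens_bounded m). Qed.

Lemma wandering_tens_linearr x : linear (wandering_tens x).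
Proof.
move=> a m m'.
have : wandering_tens ^~ (a *: m + m') =
    fun y => scalar_op a (wandering_tens y m) + wandering_tens y m'.
  apply: (eq_bounded_op (wandering_tens_bounded _) _ delta_range_total).
    apply: bounded_op_add; last exact: wandering_tens_bounded.
    by apply: bounded_op_scale; exact: wandering_tens_bounded.
  by move=> _ [i _ <-]; rewrite !wandering_tens_delta subspace_linear (blinP (Wkb _)).
by move/(congr1 (fun f => f x)).
Qed.

Lemma inner_wandering_tens x x' m m' :
  inner (wandering_tens x m) (wandering_tens x' m') = inner x x' * inner m m'.
Proof.
have Fb := wandering_tens_bounded m; have F'b := wandering_tens_bounded m'.
have : adjoint (wandering_tens ^~ m') \o wandering_tens ^~ m =
    @scalar_op R (ell2 R I) (inner m m').
  apply: (eq_bounded_op _ _ delta_range_total).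
  - by apply: bounded_op_comp => //; exact: adj_bounded.
  - exact: bounded_op_scalar.
  move=> _ [i _ <-] /=; apply/eqP; rewrite -subr_eq0; apply/eqP.
  apply: delta_total => j; rewrite innerBl innerZl (adjP' F'b) !wandering_tens_delta.
  rewrite wandering_orthogonal ?wandering_mem// delta_orthonormal.
  by rewrite /subspace_dot mulrC subrr.
move=> /(congr1 (fun f => f x)) FF.
by rewrite -(adjP' F'b) [adjoint _ _]FF innerZl mulrC.
Qed.

Lemma wandering_tens_dense :
  closure [set z : H | exists m (x : 'I_m -> ell2 R I) (y : 'I_m -> M),
    z = \sum_i wandering_tens (x i) (y i)] = setT.
Proof.
apply: dense_of_total.
- by exists 0%N, (fun=> 0), (fun=> 0); rewrite big_ord0.
- move=> a _ _ [k [x [y ->]]] [l [x' [y' ->]]].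
  exists (k + l)%N,
    (fun i => match fintype.split i with inl j => a *: x j | inr j => x' j end),
    (fun i => match fintype.split i with inl j => y j | inr j => y' j end).
  rewrite big_split_ord scaler_sumr; congr (_ + _); apply: eq_bigr => i _ /=.
    have -> : fintype.split (lshift l i) = inl i by exact: (unsplitK (inl i)).
    by rewrite (blinZ (wandering_tens_bounded _)).
  by have -> : fintype.split (rshift k i) = inr i by exact: (unsplitK (inr i)).
- move=> z zo; apply: W_total => i m m0.
  have mL : [set x | adjoint W x = 0] m by [].
  rewrite -[m]/(val (subspace_of wandering_closed mL)) -wandering_tens_delta.
  apply: zo; exists 1%N, (fun=> delta i), (fun=> subspace_of wandering_closed mL).
  by rewrite big_ord1.
Qed.

(** The given space is the tensor product; only the map of simple tensors is new. *)
Definition wandering_tensor : tensorProduct (ell2 R I) M :=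
  TensorProduct wandering_tens_linearl wandering_tens_linearr
    inner_wandering_tens wandering_tens_dense.

Local Notation T := wandering_tensor.

Lemma wandering_tensor_op A B (C : H -> H) : bounded_op A -> bounded_op B ->
  bounded_op C ->
  (forall i (m : M), C (iter (iota i) W (val m)) = wandering_tens (A (delta i)) (B m)) ->
  @tensor_op R (ell2 R I) M T A B = C.
Proof.
move=> Ab Bb Cb CP; apply: tensor_opE; apply: is_tensor_op_delta => // i m.
by have := CP i m; rewrite -wandering_tens_delta.
Qed.

Lemma wandering_tensor_shift A : bounded_op A ->
  (forall i, (exists i', iota i' = (iota i).+1 /\ A (delta i) = delta i') \/
     (A (delta i) = 0 /\ forall x, iter (iota i).+1 W x = 0)) ->
  @tensor_op R (ell2 R I) M T A id = W.
Proof.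
move=> Ab AP; apply: wandering_tensor_op => // [|i m]; first exact: bounded_op_id.
have [[i' [i'E ->]]|[-> WS]] := AP i.
  by rewrite wandering_tens_delta i'E.
by rewrite (blin0 (wandering_tens_bounded _)) -iterS WS.
Qed.

(** Here W stands for V_1 or for its adjoint, and V for the rest of the family:
    the relations below hold in both cases, with mu_j replaced by its conjugate in
    the second. *)
Section TwistedFamily.
Variables (n : nat) (V : 'I_n -> H -> H) (mu : 'I_n -> R[i]).
Variable lam : 'I_n -> 'I_n -> R[i].
Hypotheses (lamP : twist_scalars lam) (mu1 : forall j, `|mu j| = 1).
Hypothesis Vppi : forall j, power_partial_isometry (V j).
Hypothesis VW : forall j x, V j (W x) = mu j *: W (V j x).
Hypothesis W'V : forall j x, adjoint W (V j x) = mu j *: V j (adjoint W x).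
Hypothesis V'V : forall i j x, i != j ->
  adjoint (V i) (V j x) = lam i j *: V j (adjoint (V i) x).
Hypothesis VV : forall i j x, i != j -> V i (V j x) = lam j i *: V j (V i x).
Hypothesis irr : forall L : set H, closed_subspace L -> reduces L W ->
  (forall j, reduces L (V j)) -> L = [set 0] \/ L = setT.
Hypothesis nontrivial : exists x : H, x != 0.

Let Vb j := ppi_bounded (Vppi j).

Lemma adjV_W j x : adjoint (V j) (W x) = (mu j)^* *: W (adjoint (V j) x).
Proof.
apply: inner_ext => y; rewrite adjP'// (adjP Wb) W'V innerZr innerZl.
by rewrite (adjP Wb) (adjP' (Vb j)).
Qed.

Lemma W'_adjV j x : adjoint W (adjoint (V j) x) = (mu j)^* *: adjoint (V j) (adjoint W x).
Proof.
apply: inner_ext => y; rewrite (adjP' Wb) (adjP' (Vb j)) VW innerZr innerZl.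
by rewrite (adjP' (Vb j)) (adjP' Wb).
Qed.

Lemma wandering_reduced j : reduces [set m | adjoint W m = 0] (V j).
Proof.
move=> m /= m0; rewrite W'V W'_adjV m0 (blin0 (Vb j)) (blin0 (adj_bounded (Vb j))).
by rewrite !scaler0.
Qed.

Lemma V_iter j k x : V j (iter k W x) = mu j ^+ k *: iter k W (V j x).
Proof.
elim: k => [|k IH]; first by rewrite scale1r.
by rewrite !iterS VW IH (blinZ Wb) scalerA exprS.
Qed.

Lemma adjV_iter j k x :
  adjoint (V j) (iter k W x) = (mu j)^* ^+ k *: iter k W (adjoint (V j) x).
Proof.
elim: k => [|k IH]; first by rewrite scale1r.
by rewrite !iterS adjV_W IH (blinZ Wb) scalerA exprS.
Qed.

Definition wandering_family (j : 'I_n) : M -> M :=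
  @restrict R H _ wandering_closed (V j).

Local Notation Vt := wandering_family.

Lemma val_Vt j m : val (Vt j m) = V j (val m).
Proof. exact: val_restrict (fun y Ly => (@wandering_reduced j y Ly).1). Qed.

Lemma val_adjVt j m : val (adjoint (Vt j) m) = adjoint (V j) (val m).
Proof. exact: val_adj_restrict (Vb j) (@wandering_reduced j). Qed.

Lemma Vt_bounded j : bounded_op (Vt j).
Proof. exact: restrict_bounded (Vb j) (fun y Ly => (@wandering_reduced j y Ly).1). Qed.

Lemma wandering_family_twisted : twisted_ppi (scalar_twist lam) Vt.
Proof.
apply/twisted_ppi_scalarP => //; split=> [j|i j m ij|i j m ij].
- exact: restrict_ppi (Vppi j) (@wandering_reduced j).
- by apply: val_inj; rewrite val_adjVt val_Vt subspace_scale V'V// val_Vt val_adjVt.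
- by apply: val_inj; rewrite !val_Vt VV// subspace_scale !val_Vt.
Qed.

(** The witness X collects the W^k m with m orthogonal to L.  Its span is invariant
    under W, the V_j and their adjoints, so its orthogonal complement reduces
    them. *)
Lemma wandering_family_irreducible : irreducible Vt.
Proof.
split.
  apply: contrapT => /forallNP M0; have [x /eqP] := nontrivial; apply.
  apply: W_total => i m m0.
  have mL : [set x | adjoint W x = 0] m by [].
  have /negP/negPn/eqP/(congr1 val) := M0 (subspace_of wandering_closed mL).
  by move=> /= ->; rewrite (blin0 (Wkb _)) inner0r.
move=> L Lc Lr.
have Nr j m : oc L m -> oc L (Vt j m) /\ oc L (adjoint (Vt j) m).
  move=> mo; split=> l /Lr-/(_ j)[l1 l2].
    by rewrite (adjP (Vt_bounded j)) mo.
  by rewrite (adjP' (Vt_bounded j)) mo.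
pose X := [set x | exists i (m : M), oc L m /\ x = iter (iota i) W (val m)].
have XP x : oc X x <-> forall i (m : M), oc L m -> inner x (iter (iota i) W (val m)) = 0.
  split=> [xX i m mo|h _ [i [m [mo ->]]]]; last exact: h.
  by apply: xX; exists i, m.
have XW : reduces (oc X) W.
  move=> x /XP xX; split; apply/XP => i m mo.
    rewrite (adjP Wb); have [ii|[i' ii']] := iota_pred i.
      by rewrite ii /= wandering_mem inner0r.
    by rewrite (wandering_lower (wandering_mem m) ii') xX.
  rewrite (adjP' Wb) -iterS; have [[i' <-]|->] := iota_succ i; first exact: xX.
  by rewrite inner0r.
have XV j : reduces (oc X) (V j).
  move=> x /XP xX; split; apply/XP => i m mo; have [Nm N'm] := Nr j m mo.
    by rewrite (adjP (Vb j)) adjV_iter innerZr -val_adjVt xX// mulr0.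
  by rewrite (adjP' (Vb j)) V_iter innerZr -val_Vt xX// mulr0.
have [X0|XT] := irr (oc_closed X) XW XV; [left|right].
  apply/seteqP; split=> [l Ll|_ ->]; last by case: Lc.
  apply: val_inj; suff : oc X (val l) by rewrite X0.
  apply/XP => i m mo; have [ii|[i' ->]] := iota_pred i.
    by rewrite ii -inner_subspace; apply: inner_eq0C; exact: mo.
  by rewrite iterS -(adjP' Wb) wandering_mem inner0l.
apply: oc_trivial => // m mo; apply: innerxx_eq0; rewrite inner_subspace.
have /XP/(_ i0 m mo) : oc X (val m) by rewrite XT.
by rewrite iota0.
Qed.

Lemma wandering_tensor_diag j :
  @tensor_op R (ell2 R I) M T (diag_op (fun i => mu j ^+ iota i)) (Vt j) = V j.
Proof.
have w1 i : `|mu j ^+ iota i| <= 1 by rewrite normrX mu1 expr1n.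
apply: wandering_tensor_op => // [||i m].
- exact: diag_op_bounded.
- exact: Vt_bounded.
rewrite diag_op_delta// (blinZ (wandering_tens_bounded _)) wandering_tens_delta.
by rewrite val_Vt V_iter.
Qed.

Lemma wandering_model A B (V' : 'I_n.+1 -> H -> H) : raising i0 A ->
  (forall i, (exists i', iota i' = (iota i).+1 /\ A (delta i) = delta i') \/
     (A (delta i) = 0 /\ forall x, iter (iota i).+1 W x = 0)) ->
  (V' ord0 = W /\ B = A) \/ (V' ord0 = adjoint W /\ B = adjoint A) ->
  (forall j, V' (lift ord0 j) = V j) ->
  exists (M : hilbertType R) (Vt : 'I_n -> M -> M),
    irreducible_twisted_ppi lam Vt /\
    tensor_form B (fun j => diag_op (fun i => mu j ^+ iota i)) Vt V'.
Proof.
move=> Ar AP V'0 V'j.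
have [[Ab _ _] _ _] := Ar.
exists M, Vt; split.
  by split; [exact: wandering_family_twisted|exact: wandering_family_irreducible].
have AW := wandering_tensor_shift Ab AP.
exists T, id; rewrite adj_id; split.
- exact: unitary_id.
- case: V'0 => -[-> ->]; first exact/esym/AW.
  by rewrite (tensor_op_adj Ar T) AW.
- by move=> j; rewrite V'j wandering_tensor_diag.
Qed.

End TwistedFamily.

End WanderingModel.

(** * Unitary invariants of the cases *)

Section Kernels.
Variables (R : realType) (H : hilbertType R) (V : H -> H).
Hypotheses (Vppi : power_partial_isometry V) (nontrivial : exists x : H, x != 0).
Let Vb := ppi_bounded Vppi.
Let V'b := adj_bounded Vb.

Definition has_kernel (A : H -> H) := exists2 x, x != 0 & A x = 0.

Lemma no_kernel A x : ~ has_kernel A -> A x = 0 -> x = 0.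
Proof. by move=> nA Ax; apply: contrapT => /eqP x0; apply: nA; exists x. Qed.

Lemma ppi_partial x : V (adjoint V (V x)) = V x.
Proof. exact: (ppi_iter Vppi 1). Qed.

Lemma isometry_no_kernel : (forall x, adjoint V (V x) = x) -> ~ has_kernel V.
Proof. by move=> VV [x /eqP x0 Vx]; apply: x0; rewrite -[x]VV Vx (blin0 V'b). Qed.

Lemma pure_isometry_iso k m : (forall x, adjoint V (V x) = x) ->
  iter k (adjoint V) (iter k V m) = m.
Proof. by move=> VV; elim: k => [//|k IH]; rewrite iterSr iterS VV. Qed.

Lemma pure_isometry_total z :
  (forall x, (forall k, exists y, x = iter k V y) -> x = 0) ->
  (forall i m, adjoint V m = 0 -> inner z (iter i V m) = 0) -> z = 0.
Proof.
move=> V0 zV; apply: V0 => k; exists (iter k (adjoint V) z).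
by apply: (wandering_complement Vb ppi_partial) => i m _; exact: zV.
Qed.

Lemma pure_isometry_adj_kernel :
  (forall x, (forall k, exists y, x = iter k V y) -> x = 0) ->
  has_kernel (adjoint V).
Proof.
move=> V0; apply: contrapT => nV'; have [x /eqP] := nontrivial; apply.
apply: (pure_isometry_total V0) => i m /(no_kernel nV') ->.
by rewrite (blin0 (bounded_op_iter i Vb)) inner0r.
Qed.

Lemma nilpotent_kernel (A : H -> H) k : (forall x, iter k A x = 0) ->
  has_kernel A.
Proof.
move=> Ak; apply: contrapT => nA; have [x /eqP] := nontrivial; apply.
elim: k Ak => [|k IH] Ak; first exact: Ak.
by apply: IH => y; apply: (no_kernel nA); exact: Ak.
Qed.

Lemma nilpotent_adj k x : (forall x, iter k V x = 0) -> iter k (adjoint V) x = 0.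
Proof.
move=> Vk; rewrite -(adj_iter k Vb); apply: inner_ext => y.
by rewrite (adjP' (bounded_op_iter k Vb)) Vk inner0l inner0r.
Qed.

Definition kernel_pattern (c : hw_case) : Prop :=
  match c with
  | Case_s => ~ has_kernel V /\ has_kernel (adjoint V)
  | Case_b => has_kernel V /\ ~ has_kernel (adjoint V)
  | Case_u => ~ has_kernel V /\ ~ has_kernel (adjoint V)
  | Case_p p => [/\ has_kernel V, has_kernel (adjoint V), (1 <= p)%N,
      forall x, iter p V x = 0 & exists x, iter p.-1 V x != 0]
  end.

End Kernels.

Lemma hw_case_kernel_pattern (R : realType) (H : hilbertType R) (V : H -> H) c :
  power_partial_isometry V -> (exists x : H, x != 0) ->
  in_hw_case V c -> kernel_pattern V c.
Proof.
move=> Vppi nt; have Vb := ppi_bounded Vppi; have V'ppi := adj_ppi Vppi.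
case: c => [|| p |] /=.
- move=> /(hw_s_isometry Vppi)[V1 V2]; split.
    exact: isometry_no_kernel.
  exact: pure_isometry_adj_kernel.
- rewrite (hw_b_adj Vppi) => /(hw_s_isometry V'ppi)[V1 V2]; split.
    by have := pure_isometry_adj_kernel V'ppi nt V2; rewrite adjK.
  exact: isometry_no_kernel.
- move=> [p1 pT]; have [Vp Viso] := hw_p_nilpotent Vppi p1 pT.
  have V'p x : iter p (adjoint V) x = 0 by exact: nilpotent_adj.
  have [m m0 V'm] := nilpotent_kernel nt V'p.
  split=> //.
  + exact: nilpotent_kernel Vp.
  + by exists m.
  + exists m; apply: contraNneq m0 => Vm.
    rewrite -(Viso m V'm p.-1) ?prednK// Vm.
    by rewrite (blin0 (bounded_op_iter _ (adj_bounded Vb))).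
- move=> /(hw_u_unitary Vppi)/unitaryP[_ V1 V2]; split.
    exact: isometry_no_kernel.
  by apply: isometry_no_kernel => //; rewrite adjK.
Qed.

Lemma kernel_pattern_inj (R : realType) (H : hilbertType R) (V : H -> H) c c' :
  bounded_op V -> kernel_pattern V c -> kernel_pattern V c' -> c = c'.
Proof.
move=> Vb; have vanish k l : (k <= l)%N -> (forall x, iter k V x = 0) ->
    forall x, iter l V x = 0.
  by move=> kl Vk x; rewrite -(subnK kl) iterD Vk (blin0 (bounded_op_iter _ Vb)).
case: c => [|| p |]; case: c' => [|| q |] //=;
  try by [move=> [? ?] [? ?]|move=> [? ? ? ? ?] [? ?]|move=> [? ?] [? ? ? ? ?]].
move=> [_ _ p1 Vp [x xp]] [_ _ q1 Vq [y yq]].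
have [pq|qp|->//] := ltngtP p q.
  by rewrite (vanish p q.-1) ?eqxx // -ltnS prednK in yq.
by rewrite (vanish q p.-1) ?eqxx // -ltnS prednK in xp.
Qed.

Lemma kernel_pattern_intertwine (R : realType) (H K : hilbertType R)
    (V : H -> H) (W : K -> K) (Z : H -> K) c : unitary Z ->
  bounded_op V -> bounded_op W -> (forall x, Z (V x) = W (Z x)) ->
  kernel_pattern V c -> kernel_pattern W c.
Proof.
move=> Zu Vb Wb ZV; have [Zb Z1 Z2] := (unitaryP Z).1 Zu.
have ZV' := intertwine_adjoint Zu Vb Wb ZV.
have Z0 x : (Z x == 0) = (x == 0).
  by apply/eqP/eqP => [Zx|->]; [rewrite -[x]Z1 Zx (blin0 (adj_bounded Zb))|exact: blin0].
have ker (A : H -> H) (B : K -> K) : (forall x, Z (A x) = B (Z x)) ->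
    has_kernel A = has_kernel B.
  move=> ZA; apply/propext; split=> -[x x0 Ax].
    by exists (Z x); rewrite ?Z0// -ZA Ax (blin0 Zb).
  exists (adjoint Z x); first by rewrite -Z0 Z2.
  by apply/eqP; rewrite -Z0 ZA Z2 Ax.
have kV := ker _ _ ZV; have kV' := ker _ _ ZV'.
have Zi k x : Z (iter k V x) = iter k W (Z x).
  by elim: k => [//|k IH]; rewrite !iterS ZV IH.
case: c => [|| p |] /=.
- by rewrite kV kV'.
- by rewrite kV kV'.
- rewrite kV kV' => -[k1 k2 p1 Vp [x xp]]; split=> //.
    by move=> y; rewrite -[y]Z2 -Zi Vp (blin0 Zb).
  by exists (Z x); rewrite -Zi Z0.
- by rewrite kV kV'.
Qed.

(** * Models of irreducible twisted families *)

Section Models.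
Variables (R : realType) (n : nat) (H : hilbertType R).
Variables (lam : 'I_n.+1 -> 'I_n.+1 -> R[i]) (V : 'I_n.+1 -> H -> H).
Hypotheses (lamP : twist_scalars lam) (Vtw : twisted_ppi (scalar_twist lam) V).
Hypothesis (Virr : irreducible V).

Let V0 := V ord0.

Lemma tail_scalarsP : twist_scalars (tail_scalars lam).
Proof. move=> i j ij; apply: lamP.
by apply: contraNneq ij => /lift_inj ->. Qed.

Lemma twisted_ppiP : [/\ forall i, power_partial_isometry (V i),
  forall i j x, i != j -> adjoint (V i) (V j x) = lam i j *: V j (adjoint (V i) x) &
  forall i j x, i != j -> V i (V j x) = lam j i *: V j (V i x)].
Proof. exact/twisted_ppi_scalarP. Qed.

Lemma irreducible_head_tail (W : H -> H) : W = V0 \/ W = adjoint V0 ->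
  forall L : set H, closed_subspace L -> reduces L W ->
  (forall j : 'I_n, reduces L (V (lift ord0 j))) -> L = [set 0] \/ L = setT.
Proof.
have [Vp _ _] := twisted_ppiP; have [_ irr] := Virr.
move=> W0 L Lc LW LV; apply: irr => // i.
have [j|] := unliftP ord0 i => -> //.
case: W0 LW => -> LW; first exact: LW.
move=> x /LW; rewrite adjK; last exact: ppi_bounded (Vp ord0).
by case.
Qed.

Variables (I : choiceType) (i0 : I) (iota : I -> nat) (A : ell2 R I -> ell2 R I).
Hypotheses (iota_inj : injective iota) (iota0 : iota i0 = 0%N).
Hypothesis iota_pred : forall i, iota i = 0%N \/ exists i', iota i = (iota i').+1.
Hypothesis Ar : raising i0 A.

(** W acts on the W^k M, with M the kernel of its adjoint, as A acts on the basis
    of l2(I). *)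
Definition models_shift (W : H -> H) : Prop :=
  [/\ forall i,
        (exists i', iota i' = (iota i).+1 /\
           A (ell2_delta R i) = ell2_delta R i') \/
        (A (ell2_delta R i) = 0 /\ forall x, iter (iota i).+1 W x = 0),
      forall i m, adjoint W m = 0 ->
        iter (iota i) (adjoint W) (iter (iota i) W m) = m &
      forall z, (forall i m, adjoint W m = 0 ->
        inner z (iter (iota i) W m) = 0) -> z = 0].

Lemma models_shift_succ W : models_shift W ->
  forall i, (exists i', iota i' = (iota i).+1) \/ forall x, iter (iota i).+1 W x = 0.
Proof. by move=> [h _ _] i; have [[i' [? _]]|[_ ?]] := h i; [left; exists i'|right]. Qed.

Lemma tensor_model : models_shift V0 ->
  exists (M : hilbertType R) (Vt : 'I_n -> M -> M),
    irreducible_twisted_ppi (tail_scalars lam) Vt /\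
    tensor_form A (fun j => diag_op (fun i => lam ord0 (lift ord0 j) ^+ iota i)) Vt V.
Proof.
move=> Vs; have [AV Viso Vtot] := Vs; have [Vp V'V VV] := twisted_ppiP.
apply: (@wandering_model R H V0 _ _ I i0 iota iota_inj iota0 iota_pred
  (models_shift_succ Vs) Viso Vtot n (fun j => V (lift ord0 j))
  (fun j => lam ord0 (lift ord0 j))) => //.
- exact: ppi_bounded (Vp ord0).
- exact: ppi_partial (Vp ord0).
- exact: tail_scalarsP.
- by move=> j; have [] := lamP (neq_lift ord0 j).
- by move=> j x; apply: VV; rewrite eq_sym neq_lift.
- by move=> j x; apply: V'V; rewrite neq_lift.
- move=> i j x ij; apply: V'V.
  by apply: contraNneq ij => /lift_inj ->.
- move=> i j x ij; apply: VV.
  by apply: contraNneq ij => /lift_inj ->.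
- by apply: irreducible_head_tail; left.
- by case: Virr.
- exact: Ar.
- by left.
Qed.

Lemma tensor_model_adj : models_shift (adjoint V0) ->
  exists (M : hilbertType R) (Vt : 'I_n -> M -> M),
    irreducible_twisted_ppi (tail_scalars lam) Vt /\
    tensor_form (adjoint A)
      (fun j => diag_op (fun i => lam (lift ord0 j) ord0 ^+ iota i)) Vt V.
Proof.
move=> Vs; have [AV Viso Vtot] := Vs; have [Vp V'V VV] := twisted_ppiP.
have V0b := ppi_bounded (Vp ord0).
apply: (@wandering_model R H (adjoint V0) _ _ I i0 iota iota_inj iota0 iota_pred
  (models_shift_succ Vs) Viso Vtot n (fun j => V (lift ord0 j))
  (fun j => lam (lift ord0 j) ord0)) => //.
- exact: adj_bounded.
- exact: ppi_partial (adj_ppi (Vp ord0)).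
- exact: tail_scalarsP.
- by move=> j; have [] := lamP (i := lift ord0 j) (j := ord0); rewrite // eq_sym neq_lift.
- move=> j x; rewrite V'V ?neq_lift// scalerA.
  have [l1 ->] := lamP (neq_lift ord0 j).
  by rewrite mulrC -normCK l1 expr1n scale1r.
- by move=> j x; rewrite adjK//; apply: VV; rewrite neq_lift.
- move=> i j x ij; apply: V'V.
  by apply: contraNneq ij => /lift_inj ->.
- move=> i j x ij; apply: VV.
  by apply: contraNneq ij => /lift_inj ->.
- by apply: irreducible_head_tail; right.
- by case: Virr.
- exact: Ar.
- by right; rewrite adjK.
Qed.

End Models.

Lemma pure_isometry_models_shift (R : realType) (H : hilbertType R) (W : H -> H) :
  power_partial_isometry W -> hw_s W = setT ->
  models_shift id (@unilateral_shift R) W.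
Proof.
move=> Wp /(hw_s_isometry Wp)[W1 W2]; split=> [i|i m _|z].
- by left; exists i.+1; rewrite unilateral_shift_delta.
- exact: pure_isometry_iso.
- exact: pure_isometry_total.
Qed.

Lemma nilpotent_models_shift (R : realType) (H : hilbertType R) (W : H -> H) p :
  power_partial_isometry W -> hw_p W p.+1 = setT ->
  models_shift (@nat_of_ord p.+1) (@trunc_shift R p.+1) W.
Proof.
move=> Wp /(hw_p_nilpotent Wp (ltn0Sn p))[W1 W2]; split=> [i|i m m0|z zW].
- have [[j [jE ->]]|[-> ->]] := trunc_shift_basis R i; last by right.
  by left; exists j.
- exact: W2.
- rewrite (wandering_complement (ppi_bounded Wp) (ppi_partial Wp)
    (z := z) (k := p.+1)) ?W1//.
  by move=> i m ip m0; exact: (zW (Ordinal ip)).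
Qed.

(** Every U_ij is unitary and commutes with the family, so [schur] applies. *)
Lemma twisted_ppi_scalar_twist (R : realType) n (H : hilbertType R)
    (U : 'I_n -> 'I_n -> H -> H) (V : 'I_n -> H -> H) :
  twisted_ppi U V -> irreducible V ->
  exists lam : 'I_n -> 'I_n -> R[i], [/\ twist_scalars lam,
    forall i j : 'I_n, (i < j)%N -> U i j = scalar_op (lam i j) &
    twisted_ppi (scalar_twist lam) V].
Proof.
move=> [[Uu Uc] Vp V'V VV VU] Virr.
have /choice[c cP] : forall p : 'I_n * 'I_n, exists c : R[i],
    `|c| = 1 /\ ((p.1 < p.2)%N -> U p.1 p.2 = scalar_op c).
  move=> [i j] /=; have [ij|_] := boolP (i < j)%N; last first.
    by exists 1; rewrite normr1.
  have neq_ij : i != j by apply: contraTneq ij => ->; rewrite ltnn.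
  have [|k x|c [c1 cU]] := schur Virr _ (Uu _ _ ij).
  - by move=> k; exact: ppi_bounded.
  - have /(congr1 (fun f => f x)) := VU i j k neq_ij.
    by rewrite /twist ij.
  - by exists c.
pose lam (i j : 'I_n) : R[i] := if (i < j)%N then c (i, j) else (c (j, i))^*.
have lamP : twist_scalars lam.
  move=> i j; rewrite /lam neq_ltn => /orP[] ij; rewrite ij ltnNge (ltnW ij)/=.
    by have [] := cP (i, j).
  by rewrite conjCK norm_conjC; have [] := cP (j, i).
have UE (i j : 'I_n) : (i < j)%N -> U i j = scalar_op (lam i j).
  by move=> ij; rewrite /lam ij; have [_] := cP (i, j); apply.
have twE i j : i != j -> twist U i j = scalar_op (lam i j).
  move=> ij; rewrite /twist; case: ifPn => [/UE//|]; rewrite -leqNgt leq_eqVlt.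
  rewrite eq_sym val_eqE (negPf ij) /= => ji.
  by rewrite UE// adj_scalar; have [_ ->] := lamP i j ij; rewrite conjCK.
exists lam; split=> //; apply/twisted_ppi_scalarP => //; split=> // i j x ij.
  by have /(congr1 (fun f => f x)) := V'V i j ij; rewrite twE.
by have /(congr1 (fun f => f x)) := VV i j ij; rewrite twE// eq_sym.
Qed.

(* The family (V_1, ..., V_(n+1)) is V : 'I_n.+1 -> H -> H, with V_1 = V ord0 and
   V_(j+2) = V (lift ord0 j) for j : 'I_n. *)
Theorem theorem5p1 (R : realType) (n : nat) (n_gt1 : (1 < n.+1)%N) :
  (forall (H : hilbertType R) (U : 'I_n.+1 -> 'I_n.+1 -> H -> H)
      (V : 'I_n.+1 -> H -> H),
    twisted_ppi U V -> irreducible V ->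
    exists lam : 'I_n.+1 -> 'I_n.+1 -> R[i],
      twist_scalars lam /\
      (forall i j : 'I_n.+1, (i < j)%N -> U i j = scalar_op (lam i j)) /\
      (hw_s (V ord0) = setT ->
        exists (M : hilbertType R) (Vt : 'I_n -> M -> M),
          irreducible_twisted_ppi (tail_scalars lam) Vt /\
          form_s lam Vt V) /\
      (hw_b (V ord0) = setT ->
        exists (M : hilbertType R) (Vt : 'I_n -> M -> M),
          irreducible_twisted_ppi (tail_scalars lam) Vt /\
          form_b lam Vt V) /\
      (forall p, (1 <= p)%N -> hw_p (V ord0) p = setT ->
        exists (M : hilbertType R) (Vt : 'I_n -> M -> M),
          irreducible_twisted_ppi (tail_scalars lam) Vt /\
          form_p lam Vt V p) /\
      (hw_u (V ord0) = setT ->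
        [/\ unitary (V ord0),
            forall j : 'I_n,
              adjoint (V ord0) \o V (lift ord0 j) =
                U ord0 (lift ord0 j) \o V (lift ord0 j) \o adjoint (V ord0) /\
              V (lift ord0 j) \o V ord0 =
                U ord0 (lift ord0 j) \o V ord0 \o V (lift ord0 j),
            twisted_ppi (fun i j : 'I_n => U (lift ord0 i) (lift ord0 j))
              (fun j : 'I_n => V (lift ord0 j)) &
            irreducible V])) /\
  (forall (lam : 'I_n.+1 -> 'I_n.+1 -> R[i]) (H K : hilbertType R)
      (V : 'I_n.+1 -> H -> H) (W : 'I_n.+1 -> K -> K) (c c' : hw_case),
    twist_scalars lam ->
    irreducible_twisted_ppi lam V -> irreducible_twisted_ppi lam W ->
    in_hw_case (V ord0) c -> in_hw_case (W ord0) c' -> c <> c' ->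
    ~ unitarily_equivalent V W) /\
  (forall (lam : 'I_n.+1 -> 'I_n.+1 -> R[i]) (H1 H2 M1 M2 : hilbertType R)
      (V1 : 'I_n.+1 -> H1 -> H1) (V2 : 'I_n.+1 -> H2 -> H2)
      (Vt1 : 'I_n -> M1 -> M1) (Vt2 : 'I_n -> M2 -> M2),
    twist_scalars lam ->
    irreducible_twisted_ppi (tail_scalars lam) Vt1 ->
    irreducible_twisted_ppi (tail_scalars lam) Vt2 ->
    form_s lam Vt1 V1 /\ form_s lam Vt2 V2 \/
    form_b lam Vt1 V1 /\ form_b lam Vt2 V2 \/
    (exists p, (1 <= p)%N /\ form_p lam Vt1 V1 p /\ form_p lam Vt2 V2 p) ->
    (unitarily_equivalent V1 V2 <-> unitarily_equivalent Vt1 Vt2)).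
Proof.
split; [|split].
- move=> H U V Utw Virr; have [lam [lamP UE Vtw]] := twisted_ppi_scalar_twist Utw Virr.
  have Vp := let: And3 Vp _ _ := twisted_ppiP lamP Vtw in Vp.
  have V0p := Vp ord0.
  exists lam; split=> //; split=> //; split; [|split; [|split]].
  + move=> sT; apply: (tensor_model lamP Vtw Virr (I := nat) (i0 := 0%N) (iota := id)
      (A := @unilateral_shift R)) => //.
    * by case=> [|i]; [left|right; exists i].
    * exact: unilateral_shift_raising.
    * exact: pure_isometry_models_shift.
  + move=> bT; apply: (tensor_model_adj lamP Vtw Virr (I := nat) (i0 := 0%N) (iota := id)
      (A := @unilateral_shift R)) => //.
    * by case=> [|i]; [left|right; exists i].
    * exact: unilateral_shift_raising.
    * apply: pure_isometry_models_shift; first exact: adj_ppi.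
      by rewrite -hw_b_adj.
  + case=> // p _ pT.
    apply: (tensor_model lamP Vtw Virr (iota := @nat_of_ord p.+1)
      (i0 := ord0) (A := @trunc_shift R p.+1)) => //.
    * exact: val_inj.
    * case=> [[|i] ip]; [by left|right].
      by exists (Ordinal (ltnW ip)).
    * exact: trunc_shift_raising.
    * exact: nilpotent_models_shift.
  + move=> uT; have [[Uu Uc] _ V'V VV VU] := Utw; split=> //.
    * exact: hw_u_unitary.
    * move=> j; split.
        by rewrite V'V ?neq_lift.
      by rewrite VV ?(eq_sym _ ord0) ?neq_lift.
    * have neq (i j : 'I_n) : i != j -> lift ord0 i != lift ord0 j.
        by move=> ij; apply: contraNneq ij => /lift_inj ->.
      have tw (i j : 'I_n) : twist (fun i j : 'I_n => U (lift ord0 i) (lift ord0 j)) i j =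
          twist U (lift ord0 i) (lift ord0 j) by rewrite /twist /= !/bump /= !add1n ltnS.
      split=> [|i|i j ij|i j ij|i j k ij]; rewrite ?tw //.
      - by split=> [i j ij|i j k l ij kl]; [apply: Uu|apply: Uc].
      - by apply: V'V; exact: neq.
      - by apply: VV; exact: neq.
      - by apply: VU; exact: neq.
- move=> lam H K V W c c' lamP [Vtw [Vnt _]] [Wtw [Wnt _]] Vc Wc cc'.
  move=> /unitarily_equivalentP[Z [Zu ZV]]; apply: cc'.
  have [Vp _ _] := twisted_ppiP lamP Vtw; have [Wp _ _] := twisted_ppiP lamP Wtw.
  have Vb := ppi_bounded (Vp ord0); have Wb := ppi_bounded (Wp ord0).
  apply: (kernel_pattern_inj Wb); last exact: hw_case_kernel_pattern.
  apply: (kernel_pattern_intertwine Zu Vb Wb (ZV ord0)).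
  exact: hw_case_kernel_pattern.
- move=> lam H1 H2 M1 M2 V1 V2 Vt1 Vt2 lamP [Vt1w _] [Vt2w _] forms.
  have tP := tail_scalarsP lamP.
  have Vt1b j : bounded_op (Vt1 j).
    by have [Vp _ _] := (twisted_ppi_scalarP Vt1 tP).1 Vt1w; exact: ppi_bounded.
  have Vt2b j : bounded_op (Vt2 j).
    by have [Vp _ _] := (twisted_ppi_scalarP Vt2 tP).1 Vt2w; exact: ppi_bounded.
  have pow1 i j k : i != j -> `|lam i j ^+ k| <= 1.
    by move=> ij; rewrite normrX; have [-> _] := lamP i j ij; rewrite expr1n.
  have lamr j k : `|lam ord0 (lift ord0 j) ^+ k| <= 1 by apply: pow1; rewrite neq_lift.
  have laml j k : `|lam (lift ord0 j) ord0 ^+ k| <= 1.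
    by apply: pow1; rewrite eq_sym neq_lift.
  case: forms => [[f1 f2]|[[f1 f2]|[p [p1 [f1 f2]]]]].
  + apply: (tensor_form_equivalent (@unilateral_shift_raising R)
      _ _ _ _ _ f1 f2) => // [j|j|].
    * exact: diag_orthogonal_contraction.
    * by rewrite /D_op /d_op diag_op_delta// expr0 scale1r.
    * by left.
  + apply: (tensor_form_equivalent (@unilateral_shift_raising R)
      _ _ _ _ _ f1 f2) => // [j|j|].
    * exact: diag_orthogonal_contraction.
    * by rewrite /D_op /d_op diag_op_delta// expr0 scale1r.
    * by right.
  + case: p p1 f1 f2 => // p _ f1 f2.
    apply: (tensor_form_equivalent (@trunc_shift_raising R p)
      _ _ _ _ _ f1 f2) => // [j|j|].
    * exact: diag_orthogonal_contraction.
    * by rewrite /D_op /d_op diag_op_delta// expr0 scale1r.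
    * by left.
Qed.
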